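(* Let $k,l\ge1$. Let $\mathbf a=(a_1,\dots,a_k)$, $\mathbf b=(b_1,\dots,b_k)$, $\mathbf w=(\omega_1,\dots,\omega_k)$, $\mathbf t=(t_1,\dots,t_k)$ and $\mathbf a'=(a_{k+1},\dots,a_{k+l})$, $\mathbf b'=(b_{k+1},\dots,b_{k+l})$, $\mathbf w'=(\omega_{k+1},\dots,\omega_{k+l})$, $\mathbf t'=(t_{k+1},\dots,t_{k+l})$, where the $a_j,b_j$ are non-negative integers, the $\omega_j$ are complex variables and the $t_j$ are formal variables. Then $$\mathcal F^\hbar_{\mathbf a,\mathbf b}[\mathbf w|\mathbf t^*]\cdot\mathcal F^\hbar_{\mathbf a',\mathbf b'}[\mathbf w'|\mathbf t'^*]=\sum_{\sigma\in\Sigma_{k,l}}\mathcal F^\hbar_{\sigma(\mathbf a\mathbf a'),\,\sigma(\mathbf b\mathbf b')}[\sigma(\mathbf w\mathbf w')\,|\,\sigma(\mathbf t\mathbf t')^*].$$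
   Context: Put $\mathfrak{sh}(x)=e^{x}-e^{-x}$ and $K^\hbar_{a,b}(p;\omega)=\dfrac{e^{-ip\omega}}{\mathfrak{sh}^a(\pi p)\,\mathfrak{sh}^b(\pi\hbar p)}$. For $\mathbf a,\mathbf b\in\mathbb Z_{\ge0}^m$, $\mathbf n\in\mathbb Z^m$, $|\mathbf n|=\sum n_j$, the depth $m$ quantum polylogarithm is $$\mathcal F^\hbar_{\mathbf a,\mathbf b,\mathbf n}(\omega_1,\dots,\omega_m)=i^{|\mathbf n|-m}\int_{(\mathbb R+i0)^m}\prod_{j=1}^m K^\hbar_{a_j,b_j}(p_j;\omega_j)\frac{dp_j}{(p_1+\dots+p_j)^{n_j}},$$ where $(\mathbb R+i0)^m$ means $(\mathbb R+i\varepsilon)^m$ with $\varepsilon>0$ sufficiently small ($\varepsilon\to0^+$), with product measure, each line oriented from left to right. For $\mathrm{Re}\,\hbar>0$ the integral converges when $|\mathrm{Im}\,\omega_j|<\pi(a_j+b_j\mathrm{Re}\,\hbar)$ for all $j$; elsewhere it is understood by analytic continuation. Generating series (formal power series in $\mathbf u=(u_1,\dots,u_m)$): $\mathcal F^\hbar_{\mathbf a,\mathbf b}(\mathbf w|\mathbf u)=\sum_{n_1,\dots,n_m\ge1}\mathcal F^\hbar_{\mathbf a,\mathbf b,\mathbf n}(\mathbf w)\,u_1^{n_1-1}\cdots u_m^{n_m-1}$, and for $\mathbf t=(t_1,\dots,t_m)$ set $\mathcal F^\hbar_{\mathbf a,\mathbf b}[\mathbf w|\mathbf t^*]=\mathcal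 F^\hbar_{\mathbf a,\mathbf b}(\mathbf w|t_1,\,t_1+t_2,\dots,t_1+\dots+t_m)$. For a sequence $\mathbf x\mathbf x'=(x_1,\dots,x_{k+l})$ obtained by concatenating $\mathbf x=(x_1,\dots,x_k)$ and $\mathbf x'=(x_{k+1},\dots,x_{k+l})$, set $\sigma(\mathbf x\mathbf x')=(x_{\sigma(1)},\dots,x_{\sigma(k+l)})$. $\Sigma_{k,l}$ is the set of permutations $\sigma$ of $\{1,\dots,k+l\}$ shuffling $\{1,\dots,k\}$ and $\{k+1,\dots,k+l\}$, i.e. such that in the word $\sigma(1),\dots,\sigma(k+l)$ the letters $1,\dots,k$ appear in increasing order and the letters $k+1,\dots,k+l$ appear in increasing order. *)

(* Defs.v *)
From HB Require Import structures.
From mathcomp Require Import all_boot all_order all_algebra all_fingroup.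
From mathcomp Require Import all_classical all_reals all_analysis.
From mathcomp Require Import complex.
From mathcomp Require mpoly.
Import numFieldNormedType.Exports.
Import Order.TTheory GRing.Theory Num.Theory.

Set Implicit Arguments.
Unset Strict Implicit.
Unset Printing Implicit Defensive.

Local Open Scope classical_set_scope.
Local Open Scope ring_scope.
Local Open Scope complex_scope.

Section lebesgue_tuple.
Variable R : realType.
Local Notation RT := (measurableTypeR R).

Section cons.
Variables (m : nat) (mu : {sigma_finite_measure set (m.-tuple RT) -> \bar R}).

Definition tcons (x : RT * m.-tuple RT) : m.+1.-tuple RT :=
  [the m.+1.-tuple RT of x.1 :: x.2].

Lemma measurable_tcons : measurable_fun [set: RT * m.-tuple RT] tcons.
Proof. exact: measurable_cons. Qed.

Definition lebesgue_tcons : set (m.+1.-tuple RT) -> \bar R :=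
  pushforward (lebesgue_measure \x mu)%E tcons.

Let lebesgue_tcons0 : lebesgue_tcons set0 = 0%E.
Proof. by rewrite /lebesgue_tcons /pushforward preimage_set0 measure0. Qed.

Let lebesgue_tcons_ge0 A : (0 <= lebesgue_tcons A)%E.
Proof. by rewrite /lebesgue_tcons /pushforward measure_ge0. Qed.

Let lebesgue_tcons_sigma_additive : semi_sigma_additive lebesgue_tcons.
Proof.
move=> F mF tF mUF; rewrite /lebesgue_tcons /pushforward preimage_bigcup.
have mtc A : measurable A -> measurable (tcons @^-1` A).
  by move=> mA; rewrite -[X in measurable X]setTI; exact: measurable_tcons.
apply: measure_semi_sigma_additive.
- by move=> n; exact: mtc.
- apply/trivIsetP => /= i j _ _ ij; rewrite -preimage_setI.
  by move/trivIsetP : tF => /(_ _ _ _ _ ij) ->//; rewrite preimage_set0.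
- by rewrite -preimage_bigcup; exact: mtc.
Qed.

HB.instance Definition _ := isMeasure.Build _ _ _ lebesgue_tcons
  lebesgue_tcons0 lebesgue_tcons_ge0 lebesgue_tcons_sigma_additive.

Let lebesgue_tcons_sigma_finite : sigma_finite setT lebesgue_tcons.
Proof.
have /sigma_finiteP[F [TF ndF Foo]] := sigma_finiteT (@lebesgue_measure R).
have /sigma_finiteP[G [TG ndG Goo]] := sigma_finiteT mu.
pose uncons (t : m.+1.-tuple RT) : RT * m.-tuple RT :=
  (tnth t ord0, [tuple of behead t]).
have munc : measurable_fun setT uncons.
  apply/measurable_fun_pairP; split; first exact: measurable_tnth.
  exact: measurable_behead.
have tconsK : cancel tcons uncons.
  by case=> x t; rewrite /uncons /tcons; congr pair; apply: val_inj.
exists (fun n => uncons @^-1` (F n `*` G n)).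
  rewrite -preimage_bigcup (_ : \bigcup_n _ = setT) ?preimage_setT//.
  apply/seteqP; split=> // -[x y] _.
  have [i _ Fix] : (\bigcup_n F n) x by rewrite -TF.
  have [j _ Gjy] : (\bigcup_n G n) y by rewrite -TG.
  exists (maxn i j) => //; split => /=.
  - by move: x Fix; exact/subsetPset/ndF/leq_maxl.
  - by move: y Gjy; exact/subsetPset/ndG/leq_maxr.
move=> n; have [mF Fn] := Foo n; have [mG Gn] := Goo n; split.
  by rewrite -[X in measurable X]setTI; apply: munc => //; exact: measurableX.
rewrite /lebesgue_tcons /pushforward -comp_preimage (_ : _ \o _ = id).
  rewrite preimage_id product_measure1E// lte_mul_pinfty//.
  by rewrite ge0_fin_numE.
by apply/funext => x /=; rewrite tconsK.
Qed.

HB.instance Definition _ := Measure_isSigmaFinite.Build _ _ _ lebesgue_tcons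
  lebesgue_tcons_sigma_finite.

End cons.

Fixpoint lebesgue_tuple (m : nat) :
    {sigma_finite_measure set (m.-tuple RT) -> \bar R} :=
  if m is m'.+1 then lebesgue_tcons (lebesgue_tuple m')
  else \d_([tuple] : 0.-tuple RT).

End lebesgue_tuple.

(* The topology of a numFieldType, on the concrete type R[i]. *)
HB.instance Definition _ (R : realType) :=
  PseudoPointedMetric.copy R[i] (R[i]^o).

Section quantum_polylogarithm.
Variable R : realType.
Local Notation C := R[i].

Definition cexp (z : C) : C :=
  (expR (complex.Re z))%:C *
    ((cos (complex.Im z))%:C + 'i * (sin (complex.Im z))%:C).

Definition sh (x : C) : C := cexp x - cexp (- x).

Definition Kfun (hbar : C) (a b : nat) (p omega : C) : C :=
  cexp (- ('i * p * omega)) / (sh (pi%:C * p) ^+ a * sh (pi%:C * hbar * p) ^+ b).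

(* p_j = x_j + i eps runs over the line R + i eps, from left to right. *)
Definition qpolylog_eps (hbar : C) m (a b : 'rV[nat]_m) (n : 'rV[int]_m)
    (w : 'rV[C]_m) (eps : R) : C :=
  let p (x : m.-tuple (measurableTypeR R)) (j : 'I_m) : C :=
    (tnth x j : R)%:C + 'i * eps%:C in
  let f x := \prod_(j < m) (Kfun hbar (a 0 j) (b 0 j) (p x j) (w 0 j) /
                            (\sum_(i < m | (i <= j)%N) p x i) ^ (n 0 j)) in
  (\int[lebesgue_tuple R m]_x complex.Re (f x))%:C
  + 'i * (\int[lebesgue_tuple R m]_x complex.Im (f x))%:C.

(* In the convergence domain below, the integral does not depend on eps > 0
   small: the limit is that of an eventually constant function. *)
Definition qpolylog (hbar : C) m (a b : 'rV[nat]_m) (n : 'rV[int]_m)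
    (w : 'rV[C]_m) : C :=
  'i ^ (\sum_(j < m) n 0 j - m%:Z) *
  lim (qpolylog_eps hbar a b n w eps @[eps --> 0^'+]).

Definition qpolylog_domain (hbar : C) m (a b : 'rV[nat]_m) (w : 'rV[C]_m) :=
  0 < complex.Re hbar /\
  forall j : 'I_m, `|complex.Im (w 0 j)| <
    pi * ((a 0 j)%:R + (b 0 j)%:R * complex.Re hbar).

End quantum_polylogarithm.

(* multinomials' notations clash with those of mathcomp-analysis *)
Import -(notations) mpoly.

(* f : fps A N is the family of coefficients of the power series
   \sum_beta f beta x^beta in N commuting variables. *)
Definition fps (A : Type) (N : nat) := multinom N -> A.

Section formal_power_series.
Variables (A : comNzRingType).

Definition fps_mul N (f g : fps A N) : fps A N := fun alpha =>
  \sum_(bc : bmultinom N (mdeg alpha).+1 * bmultinom N (mdeg alpha).+1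
        | mnm_add bc.1 bc.2 == alpha) f bc.1 * g bc.2.

(* f (L_1, ..., L_m), for polynomials L_j without constant term: a monomial of
   degree > |alpha| in the L_j does not contribute to the coefficient alpha. *)
Definition fps_subst m N (f : fps A m) (L : 'I_m -> mpoly N A) : fps A N :=
  fun alpha => \sum_(beta : bmultinom m (mdeg alpha).+1)
    f beta * mcoeff alpha (\prod_(j < m) L j ^+ (beta : multinom m) j).

(* f [ t^* ] = f (t_1, t_1 + t_2, ..., t_1 + ... + t_m), where the entries of t
   are (indices of) formal variables among N given ones. *)
Definition fps_star m N (f : fps A m) (t : 'rV['I_N]_m) : fps A N :=
  fps_subst f (fun j => \sum_(i < m | (i <= j)%N) mpolyX A (mnm1 (t 0 i))).

End formal_power_series.

(* The coefficient of u^beta is the polylogarithm with n_j = beta_j + 1. *)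
Definition qpolylog_series (R : realType) (hbar : R[i]) m (a b : 'rV[nat]_m)
    (w : 'rV[R[i]]_m) : fps R[i] m :=
  fun beta => qpolylog hbar a b (\row_j (beta j).+1%:Z) w.

(* The same, as a function of the point z = (hbar, w) of C^(1+m). *)
Definition qpolylog_series_joint (R : realType) m (a b : 'rV[nat]_m)
    (z : 'rV[R[i]]_(1 + m)) : fps R[i] m :=
  qpolylog_series (lsubmx z 0 0) a b (rsubmx z).

Section analytic_continuation.
Variables (R : realType) (N : nat).
Local Notation C := R[i].

(* On a polydisc around z (the norm of row vectors is the max norm), f is the
   sum of an absolutely convergent power series. *)
Definition analytic_at (f : 'rV[C]_N -> C) (z : 'rV[C]_N) :=
  exists2 r : C, 0 < r & exists c : fps C N,
    (exists M : C, forall d : nat,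
       \sum_(beta : bmultinom N d) `|c beta| * r ^+ mdeg beta <= M) /\
    (forall v : 'rV[C]_N, `|v| < r ->
       (fun d : nat => \sum_(beta : bmultinom N d)
          c beta * \prod_(j < N) v 0 j ^+ (beta : multinom N) j)
       @ \oo --> f (z + v)).

(* The germ of F at gamma 0 continues analytically along the path gamma, and the
   continuation takes the value v at gamma 1; g s represents the germ at
   gamma s. *)
Definition continues_to (F : 'rV[C]_N -> C) (gamma : R -> 'rV[C]_N) (v : C) :=
  exists g : R -> 'rV[C]_N -> C,
  [/\ \forall z \near gamma 0, g 0 z = F z,
      (forall s : R, s \in `[0, 1] -> analytic_at (g s) (gamma s)),
      (forall s : R, s \in `[0, 1] -> \forall s' \near s, s' \in `[0, 1] ->
         \forall z \near gamma s', g s' z = g s z)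
    & g 1 (gamma 1) = v].

Variable m : nat.
Implicit Types (S : 'rV[C]_N -> fps C m) (gamma : R -> 'rV[C]_N).

Definition fps_continuable S gamma :=
  forall beta, exists v, continues_to (fun z => S z beta) gamma v.

Definition fps_continuation S gamma : fps C m :=
  fun beta => xget 0 [set v | continues_to (fun z => S z beta) gamma v].

End analytic_continuation.

(* Positions and letters are numbered from 0: letters < k form the first word. *)
Definition shuffles (k l : nat) : {set 'S_(k + l)} :=
  [set s : 'S_(k + l) | [forall i : 'I_(k + l), forall j : 'I_(k + l),
     (i < j)%N && ((s i < k)%N == (s j < k)%N) ==> (s i < s j)%N]]%SET.

(* Main.v *)
Require Import Defs.
From HB Require Import structures.
From mathcomp Require Import all_boot all_order all_algebra all_fingroup.
From mathcomp Require Import all_classical all_reals all_analysis.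
From mathcomp Require Import measurable_realfun complex ring lra.
From mathcomp Require mpoly.
Import -(notations) mpoly.
Import numFieldNormedType.Exports.
Import Order.TTheory GRing.Theory Num.Theory.
Local Open Scope classical_set_scope.
Local Open Scope ring_scope.
Local Open Scope complex_scope.
Set Implicit Arguments.
Unset Strict Implicit.
Unset Printing Implicit Defensive.

(** Let p_j be the variables of integration and q_j = p_j - i t_j. Since the sum
    over n >= 1 of i^(n - 1) u^(n - 1) / P^n is 1 / (P - i u), the generating
    series evaluated at t^* is the integral of the product of the kernels K(p_j)
    and of the inverses of the partial sums q_1 + ... + q_j. A product of two
    such products of inverses is the sum of the same expressions over all the
    shuffles of the letters q_j: this is [shuffle_prod], an induction on
    1 / (X Y) = (1 / X + 1 / Y) / (X + Y). It is applied to polynomials in t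
    modulo high degree, which is what a single coefficient sees
    ([shuffle_geom]). The product of the kernels is the same for all the orders
    of the letters, so Fubini and a renaming of the variables in each term give
    the formula in the domain of convergence ([fps_star_shuffle]).

    Both sides must be integrals over the same lines R + i eps, so the integrals
    must be independent of eps. The increments of a holomorphic integrand in the
    directions h and i h agree up to the factor i and an error of order h^2,
    while the integral is invariant under real translations. Thus the integral,
    as a function of eps, has increments of order h^2 and is constant
    ([cint_line_const]). The uniform estimates are carried by the class [tame],
    which contains the exponential and is closed under products and inverses,
    together with a lower bound for the hyperbolic sine on the lines
    ([sh_lower_bound]).

    For the continuations, each coefficient of the difference of the two sides
    is a polynomial in finitely many continued germs, and it vanishes near the
    start of the path; the identity theorem shows that it vanishes at the end.
    Germs are handled through expansions in homogeneous polynomials with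
    geometric bounds ([expandable]), which are stable under sums, products and
    projections to some of the coordinates. Such a germ that vanishes near a
    point close to its centre vanishes on a whole ball around the centre
    ([expandable_zero]), so that vanishing of the germ is an open and closed
    condition on the path ([germ_continuation_eq0]). *)

(** * The modulus and the complex exponential *)

Section complex_modulus.
Variable R : realType.
Local Notation C := R[i].
Local Notation cabs := (@Normc.normc R).

Lemma normr_cabs (z : C) : `|z| = (cabs z)%:C.
Proof. by []. Qed.

Lemma cabs_ge0 (z : C) : 0 <= cabs z.
Proof. by rewrite -ler0c -normr_cabs. Qed.

Lemma cabsM (x y : C) : cabs (x * y) = cabs x * cabs y.
Proof. exact: Normc.normcM. Qed.

Lemma cabsV (x : C) : cabs x^-1 = (cabs x)^-1.
Proof. exact: Normc.normcV. Qed.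

Lemma cabsN (x : C) : cabs (- x) = cabs x.
Proof. by case: x => a b /=; rewrite !sqrrN. Qed.

Lemma cabsD (x y : C) : cabs (x + y) <= cabs x + cabs y.
Proof. exact: le_normcD. Qed.

Lemma cabsB (x y : C) : cabs (x - y) <= cabs x + cabs y.
Proof. by rewrite -(cabsN y); exact: cabsD. Qed.

Lemma cabsX (x : C) n : cabs (x ^+ n) = cabs x ^+ n.
Proof.
elim: n => [|n IH]; first by rewrite !expr0 Normc.normc1.
by rewrite !exprS cabsM IH.
Qed.

Lemma cabs_eq0 (x : C) : (cabs x == 0) = (x == 0).
Proof.
apply/eqP/eqP => [/Normc.eq0_normc //|->]; exact: Normc.normc0.
Qed.

Lemma cabs_real (x : R) : cabs x%:C = `|x|.
Proof. by rewrite /= expr0n addr0 sqrtr_sqr. Qed.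

Lemma cabs_i : cabs 'i = 1.
Proof. by rewrite /= expr0n add0r expr1n sqrtr1. Qed.

Lemma sqr_cabs (z : C) : cabs z ^+ 2 = complex.Re z ^+ 2 + complex.Im z ^+ 2.
Proof. by case: z => a b /=; rewrite sqr_sqrtr// addr_ge0 ?sqr_ge0. Qed.

Lemma Re_le_cabs (z : C) : `|complex.Re z| <= cabs z.
Proof.
rewrite -(@ler_pXn2r _ 2) ?nnegrE ?cabs_ge0// sqr_cabs.
by rewrite real_normK ?num_real// lerDl sqr_ge0.
Qed.

Lemma Im_le_cabs (z : C) : `|complex.Im z| <= cabs z.
Proof.
rewrite -(@ler_pXn2r _ 2) ?nnegrE ?cabs_ge0// sqr_cabs.
by rewrite real_normK ?num_real// lerDr sqr_ge0.
Qed.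

Lemma cabs_le_ReIm (z : C) : cabs z <= `|complex.Re z| + `|complex.Im z|.
Proof.
rewrite -(@ler_pXn2r _ 2) ?nnegrE ?cabs_ge0 ?addr_ge0// sqr_cabs sqrrD.
rewrite !real_normK ?num_real//.
have : 0 <= `|complex.Re z| * `|complex.Im z| by rewrite mulr_ge0.
lra.
Qed.

Lemma cabs_prod (I : Type) (r : seq I) (P : pred I) (F : I -> C) :
  cabs (\prod_(i <- r | P i) F i) = \prod_(i <- r | P i) cabs (F i).
Proof.
apply: (big_morph cabs); [exact: cabsM|exact: Normc.normc1].
Qed.

Lemma cReM (x y : C) : complex.Re (x * y) =
  complex.Re x * complex.Re y - complex.Im x * complex.Im y.
Proof. by case: x y => [a b] [c d]. Qed.

Lemma cImM (x y : C) : complex.Im (x * y) =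
  complex.Re x * complex.Im y + complex.Im x * complex.Re y.
Proof. by case: x y => [a b] [c d]. Qed.

Lemma Re_mulr (x : C) (r : R) : complex.Re (x * r%:C) = complex.Re x * r.
Proof. by rewrite cReM /= mulr0 subr0. Qed.

Lemma Im_mulr (x : C) (r : R) : complex.Im (x * r%:C) = complex.Im x * r.
Proof. by rewrite cImM /= mulr0 add0r. Qed.

Lemma cReD (x y : C) : complex.Re (x + y) = complex.Re x + complex.Re y.
Proof. by case: x y => [a b] [c d]. Qed.

Lemma cImD (x y : C) : complex.Im (x + y) = complex.Im x + complex.Im y.
Proof. by case: x y => [a b] [c d]. Qed.

Lemma cReN (x : C) : complex.Re (- x) = - complex.Re x.
Proof. by case: x. Qed.

Lemma cImN (x : C) : complex.Im (- x) = - complex.Im x.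
Proof. by case: x. Qed.

Lemma Re_cexp (z : C) :
  complex.Re (cexp z) = expR (complex.Re z) * cos (complex.Im z).
Proof. by rewrite /cexp cReM /= ; ring. Qed.

Lemma Im_cexp (z : C) :
  complex.Im (cexp z) = expR (complex.Re z) * sin (complex.Im z).
Proof. by rewrite /cexp cImM /= ; ring. Qed.

Lemma complex_ext (x y : C) :
  complex.Re x = complex.Re y -> complex.Im x = complex.Im y -> x = y.
Proof. by case: x y => [a b] [c d] /= -> ->. Qed.

Lemma cexpD (x y : C) : cexp (x + y) = cexp x * cexp y.
Proof.
apply: complex_ext; [rewrite [RHS]cReM|rewrite [RHS]cImM].
  by rewrite !(Re_cexp, Im_cexp) cReD cImD expRD cosD; ring.
by rewrite !(Re_cexp, Im_cexp) cReD cImD expRD sinD; ring.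
Qed.

Lemma cabs_cexp (z : C) : cabs (cexp z) = expR (complex.Re z).
Proof.
apply/eqP; rewrite -(@eqrXn2 _ 2) ?cabs_ge0 ?expR_ge0// sqr_cabs.
rewrite Re_cexp Im_cexp !exprMn -mulrDr cos2Dsin2 mulr1; exact/eqP.
Qed.

Lemma sin_le_id (b : R) : `|sin b| <= `|b|.
Proof.
wlog b0 : b / 0 <= b => [H|].
  have [/H//|b0] := leP 0 b; rewrite -normrN -sinN -(normrN b).
  by apply: H; rewrite oppr_ge0 ltW.
have [c _] := @MVT_segment R sin cos 0 b b0 (fun x _ => is_derive_sin x)
  (continuous_subspaceT (@continuous_sin R)).
rewrite sin0 !subr0 => ->; rewrite normrM ler_piMl// ler_norml.
by rewrite cos_geN1 cos_le1.
Qed.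

Lemma cos_sub1 (b : R) : `|cos b - 1| <= b ^+ 2.
Proof.
have {1}-> : b = (b / 2) *+ 2 by rewrite -mulr_natr; field.
rewrite cos_mulr2n cos2sin2.
have := sin_le_id (b / 2).
rewrite -(@ler_pXn2r _ 2) ?nnegrE// !real_normK ?num_real// exprMn.
set s := sin _; have := sqr_ge0 s; rewrite ler_norml; nra.
Qed.

Lemma sin_sub_id (b : R) : `|b| <= 1 -> `|sin b - b| <= b ^+ 2.
Proof.
wlog b0 : b / 0 <= b => [H|].
  have [/H//|b0 b1] := leP 0 b.
  have := H (- b); rewrite sinN sqrrN -opprD !normrN; apply => //.
  by rewrite oppr_ge0 ltW.
rewrite ger0_norm// => b1.
have [c] := @MVT_segment R sin cos 0 b b0 (fun x _ => is_derive_sin x)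
  (continuous_subspaceT (@continuous_sin R)).
rewrite in_itv/= => /andP[c0 cb]; rewrite sin0 !subr0 => ->.
rewrite (_ : _ - b = (cos c - 1) * b); last by ring.
rewrite normrM (ger0_norm b0); have := cos_sub1 c => h.
have cb2 : c ^+ 2 <= b by nra.
by have := normr_ge0 (cos c - 1); nra.
Qed.

Lemma expR_sub1_id (a : R) : `|a| <= 2^-1 ->
  [/\ expR a <= 2, `|expR a - 1| <= 2 * `|a| & `|expR a - 1 - a| <= 2 * a ^+ 2].
Proof.
move=> a2; have [aN aP] : - 2^-1 <= a /\ a <= 2^-1.
  by move: a2; rewrite ler_norml => /andP[].
have h1 := expR_ge1Dx a; have h2 := expR_ge1Dx (- a).
have e0 := expR_gt0 a; have e1 : expR a * expR (- a) = 1.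
  by rewrite -expRD subrr expR0.
have h3 : expR a * (1 - a) <= 1 by nra.
have h4 : expR a <= 1 + a + 2 * a ^+ 2.
  rewrite -(ler_pM2r (_ : 0 < 1 - a)); last by lra.
  apply: le_trans h3 _; nra.
split; first by nra.
- have [a0|a0] := leP 0 a.
    by rewrite (ger0_norm a0) ger0_norm; nra.
  by rewrite (ltr0_norm a0) ler_norml; apply/andP; split; nra.
- by rewrite ler_norml; apply/andP; split; nra.
Qed.

(** Holomorphy of the exponential in quantitative form. All the estimates on
    derivatives of the integrand come from this one. *)
Lemma cexp_taylor2 (u : C) : cabs u <= 2^-1 ->
  cabs (cexp u - 1 - u) <= 5 * cabs u ^+ 2.
Proof.
move=> u2; apply: le_trans (cabs_le_ReIm _) _; rewrite sqr_cabs.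
have ha := le_trans (Re_le_cabs u) u2; have hb := le_trans (Im_le_cabs u) u2.
rewrite !(cReD, cImD, cReN, cImN) Re_cexp Im_cexp /=.
set a := complex.Re u in ha *; set b := complex.Im u in hb *.
have [e2 ea1 ea2] := expR_sub1_id ha; have e0 := expR_gt0 a.
have hc := cos_sub1 b.
have hs : `|sin b - b| <= b ^+ 2 by apply: sin_sub_id; apply: le_trans hb _; lra.
rewrite (_ : expR a * cos b - 1 - a =
  expR a * (cos b - 1) + (expR a - 1 - a)); last by ring.
rewrite (_ : expR a * sin b + - 0 - b =
  expR a * (sin b - b) + (expR a - 1) * b); last by ring.
have n1 := ler_normD (expR a * (cos b - 1)) (expR a - 1 - a).
have n2 := ler_normD (expR a * (sin b - b)) ((expR a - 1) * b).
have m1 : `|expR a * (cos b - 1)| <= 2 * b ^+ 2.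
  by rewrite normrM (gtr0_norm e0); apply: ler_pM => //; exact: ltW.
have m2 : `|expR a * (sin b - b)| <= 2 * b ^+ 2.
  by rewrite normrM (gtr0_norm e0); apply: ler_pM => //; exact: ltW.
have m3 : `|(expR a - 1) * b| <= a ^+ 2 + b ^+ 2.
  rewrite normrM; apply: (@le_trans _ _ (2 * `|a| * `|b|)).
    by apply: ler_wpM2r.
  rewrite -(real_normK (num_real a)) -(real_normK (num_real b)).
  by have := sqr_ge0 (`|a| - `|b|); rewrite sqrrB; lra.
have := sqr_ge0 a; have := sqr_ge0 b; lra.
Qed.

End complex_modulus.
Notation cabs := (@Normc.normc _).

(** * Uniform second order expansions *)

Section tame.
Variables (R : realType) (D : set R[i]).
Local Notation C := R[i].

(** The functions phi x are differentiable on D with derivatives phi' x, and the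
    values, the derivatives and the second order remainders are bounded by
    multiples of the same majorant B x. With B integrable, the bounds integrate
    over x. The restriction to increments of size at most 1 / c absorbs the
    terms of higher order in h. *)
Definition tame (X : Type) (phi : X -> C -> C) (B : X -> R) :=
  exists (phi' : X -> C -> C) (c : R),
  [/\ 1 <= c /\ forall x, 0 <= B x,
      forall x z, D z -> cabs (phi x z) <= c * B x,
      forall x z, D z -> cabs (phi' x z) <= c * B x
    & forall x z h, D z -> D (z + h) -> c * cabs h <= 1 ->
        cabs (phi x (z + h) - phi x z - h * phi' x z)
          <= c * cabs h ^+ 2 * B x].

Lemma tame_comp (X Y : Type) (g : Y -> X) (phi : X -> C -> C) (B : X -> R) :
  tame phi B -> tame (fun y => phi (g y)) (fun y => B (g y)).
Proof.
move=> [phi' [c [[c1 B0] H1 H2 H3]]]; exists (fun y => phi' (g y)), c.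
by split=> [|y|y|y]; [split| exact: H1|exact: H2|exact: H3].
Qed.

Lemma tame_le (X : Type) (phi : X -> C -> C) (A B : X -> R) :
  (forall x, A x <= B x) -> tame phi A -> tame phi B.
Proof.
move=> AB [phi' [c [[c1 B0] H1 H2 H3]]]; exists phi', c.
have c0 : 0 <= c by apply: le_trans c1.
split=> [|x z Dz|x z Dz|x z h Dz Dh hc].
- by split=> // x; exact: le_trans (B0 x) (AB x).
- by apply: le_trans (H1 _ _ Dz) _; rewrite ler_wpM2l.
- by apply: le_trans (H2 _ _ Dz) _; rewrite ler_wpM2l.
- by apply: le_trans (H3 _ _ _ Dz Dh hc) _; rewrite ler_wpM2l// mulr_ge0// sqr_ge0.
Qed.

Lemma eq_tame (X : Type) (psi phi : X -> C -> C) (B : X -> R) :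
  (forall x z, phi x z = psi x z) -> tame psi B -> tame phi B.
Proof.
by move=> E; rewrite (_ : phi = psi)//; apply/funext => x; apply/funext => z.
Qed.

Lemma tameB (X : Type) (phi psi : X -> C -> C) (B : X -> R) :
  tame phi B -> tame psi B -> tame (fun x z => phi x z - psi x z) B.
Proof.
move=> [p [c [[c1 B0] H1 H2 H3]]] [q [d [[d1 _] K1 K2 K3]]].
exists (fun x z => p x z - q x z), (c + d).
split=> [|x z Dz|x z Dz|x z h Dz Dh hcd].
- by split=> //; lra.
- by apply: le_trans (cabsB _ _) _; rewrite mulrDl lerD ?H1 ?K1.
- by apply: le_trans (cabsB _ _) _; rewrite mulrDl lerD ?H2 ?K2.
- rewrite (_ : _ - _ = (phi x (z + h) - phi x z - h * p x z) -
    (psi x (z + h) - psi x z - h * q x z)); last by ring.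
  apply: le_trans (cabsB _ _) _; rewrite !mulrDl.
  have h0 := cabs_ge0 h.
  by rewrite lerD// ?H3 ?K3//; nra.
Qed.

Lemma tameM (X : Type) (phi psi : X -> C -> C) (A B : X -> R) :
  tame phi A -> tame psi B ->
  tame (fun x z => phi x z * psi x z) (fun x => A x * B x).
Proof.
move=> [p [c [[c1 A0] H1 H2 H3]]] [q [d [[d1 B0] K1 K2 K3]]].
(* 4 = 1 + 2 + 1, for the three parts of the remainder of the product *)
exists (fun x z => p x z * psi x z + phi x z * q x z), (4 * c * d).
have cd1 : 1 <= c * d by nra.
have cd0 : 0 <= c * d by lra.
have ABge x : 0 <= A x * B x by rewrite mulr_ge0.
have M2 (u v a b : R) : 0 <= u -> 0 <= v -> u <= a -> v <= b -> u * v <= a * b.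
  by move=> *; exact: ler_pM.
have cde a b : (c * a) * (d * b) = c * d * (a * b) by ring.
split=> [|x z Dz|x z Dz|x z h Dz Dh].
- by split=> //; lra.
- rewrite cabsM; apply: le_trans (M2 _ _ _ _ _ _ (H1 _ _ Dz) (K1 _ _ Dz)) _;
    rewrite ?cabs_ge0// cde -[4 * c * d]mulrA.
  by have := mulr_ge0 cd0 (ABge x); lra.
- apply: le_trans (cabsD _ _) _; rewrite !cabsM.
  have := M2 _ _ _ _ (cabs_ge0 _) (cabs_ge0 _) (H2 x _ Dz) (K1 x _ Dz).
  have := M2 _ _ _ _ (cabs_ge0 _) (cabs_ge0 _) (H1 x _ Dz) (K2 x _ Dz).
  rewrite !cde -[4 * c * d]mulrA.
  by have := mulr_ge0 cd0 (ABge x); lra.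
have h0 := cabs_ge0 h; set e := cabs h in h0 * => hcd.
have e1 : e <= 1 by nra.
have ce1 : c * e <= 1 by nra.
have de1 : d * e <= 1 by nra.
have {}H3 := H3 x _ _ Dz Dh ce1; have {}K3 := K3 x _ _ Dz Dh de1.
rewrite -/e in H3 K3.
have c0 : 0 <= c by lra. have d0 : 0 <= d by lra.
set r1 := phi x (z + h) - _ - _ in H3; set r2 := psi x (z + h) - _ - _ in K3.
rewrite (_ : _ - _ = r1 * psi x (z + h) + (phi x z + h * p x z) * r2
  + h ^+ 2 * (p x z * q x z)); last by rewrite /r1 /r2; ring.
apply: le_trans (cabsD _ _) _; apply: le_trans (lerD (cabsD _ _) (lexx _)) _.
rewrite !cabsM -/e.
have b1 := M2 _ _ _ _ (cabs_ge0 _) (cabs_ge0 _) H3 (K1 x _ Dh).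
have b3 := M2 _ _ _ _ (cabs_ge0 _) (cabs_ge0 _) (H2 x _ Dz) (K2 x _ Dz).
have b2 : cabs (phi x z + h * p x z) <= 2 * c * A x.
  apply: le_trans (cabsD _ _) _; rewrite cabsM.
  have := H1 x _ Dz; have := M2 _ _ _ _ h0 (cabs_ge0 _) e1 (H2 x _ Dz).
  rewrite -/e; lra.
have {}b2 := M2 _ _ _ _ (cabs_ge0 _) (cabs_ge0 _) b2 K3.
have {}b3 := ler_wpM2l (sqr_ge0 e) b3.
rewrite -expr2.
rewrite (_ : c * e ^+ 2 * A x * (d * B x) = c * d * e ^+ 2 * (A x * B x)) in b1; last by ring.
rewrite (_ : 2 * c * A x * _ = 2 * (c * d * e ^+ 2 * (A x * B x))) in b2; last by ring.
rewrite (_ : e ^+ 2 * (c * A x * _) = c * d * e ^+ 2 * (A x * B x)) in b3; last by ring.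
rewrite (_ : 4 * c * d * _ * _ = 4 * (c * d * e ^+ 2 * (A x * B x))); last by ring.
lra.
Qed.

Lemma tame1 (X : Type) : tame (fun (_ : X) _ => 1) (fun=> 1).
Proof.
exists (fun _ _ => 0), 1; split=> [|x z _|x z _|x z h _ _ _].
- by split.
- by rewrite Normc.normc1 mulr1.
- by rewrite Normc.normc0 mulr1.
- by rewrite mulr0 subr0 subrr Normc.normc0 mulr1 mul1r sqr_ge0.
Qed.

Lemma tame_prod (X : Type) (I : Type) (r : seq I) (phi : I -> X -> C -> C)
    (B : I -> X -> R) :
  (forall i, tame (phi i) (B i)) ->
  tame (fun x z => \prod_(i <- r) phi i x z) (fun x => \prod_(i <- r) B i x).
Proof.
move=> H; elim: r => [|i r IH].
  rewrite (_ : (fun x z => _) = fun _ _ => 1); last first.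
    by apply/funext => x; apply/funext => z; rewrite big_nil.
  under [X in tame _ X]eq_fun do rewrite big_nil.
  exact: tame1.
rewrite (_ : (fun x z => _) =
    fun x z => phi i x z * \prod_(i <- r) phi i x z); last first.
  by apply/funext => x; apply/funext => z; rewrite big_cons.
under [X in tame _ X]eq_fun do rewrite big_cons.
exact: tameM.
Qed.

Lemma tameX (X : Type) (phi : X -> C -> C) (B : X -> R) n :
  tame phi B -> tame (fun x z => phi x z ^+ n) (fun x => B x ^+ n).
Proof.
move=> H; have := tame_prod (iota 0 n) (fun=> H).
rewrite (_ : (fun x z => _) = fun x z => phi x z ^+ n); last first.
  apply/funext => x; apply/funext => z.
  by rewrite big_const_seq count_predT size_iota -Monoid.iteropE.
rewrite (_ : (fun x => \prod_(i <- _) _) = fun x => B x ^+ n)//.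
apply/funext => x.
by rewrite big_const_seq count_predT size_iota -Monoid.iteropE.
Qed.

(** When phi x is comparable with B x from below as well, the remainder of the
    inverse has only factors phi x in its denominator, so it is bounded by a
    multiple of 1 / B x. *)
Lemma tameV (X : Type) (phi : X -> C -> C) (B : X -> R) (m : R) :
  0 < m -> (forall x, 0 < B x) ->
  (forall x z, D z -> m * B x <= cabs (phi x z)) ->
  tame phi B -> tame (fun x z => (phi x z)^-1) (fun x => (B x)^-1).
Proof.
move=> m0 B0 Hm [p [c [[c1 _] H1 H2 H3]]].
exists (fun x z => - p x z / phi x z ^+ 2),
  (c + m^-1 + c / m ^+ 2 + 3 * c ^+ 2 / m ^+ 3).
have c0 : 0 <= c by lra.
have t1 : 0 <= m^-1 by rewrite invr_ge0 ltW.
have t2 : 0 <= c / m ^+ 2 by rewrite divr_ge0 ?sqr_ge0.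
have t3 : 0 <= 3 * c ^+ 2 / m ^+ 3.
  by rewrite divr_ge0 ?exprn_ge0 ?mulr_ge0 ?sqr_ge0 ?(ltW m0).
have pos x z : D z -> 0 < cabs (phi x z).
  by move=> Dz; apply: lt_le_trans (Hm _ _ Dz); rewrite mulr_gt0.
have nz x z : D z -> phi x z != 0.
  by move=> Dz; rewrite -cabs_eq0 gt_eqF// pos.
have iB x : 0 < (B x)^-1 by rewrite invr_gt0.
have iV x z : D z -> (cabs (phi x z))^-1 <= m^-1 * (B x)^-1.
  by move=> Dz; rewrite -invfM lef_pV2 ?posrE ?pos ?mulr_gt0//; exact: Hm.
have iV0 x z : 0 <= (cabs (phi x z))^-1 by rewrite invr_ge0 cabs_ge0.
split=> [|x z Dz|x z Dz|x z h Dz Dh].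
- by split=> [|x]; [lra|exact: ltW].
- by rewrite cabsV; apply: le_trans (iV _ _ Dz) _; rewrite ler_wpM2r ?(ltW (iB x))//; lra.
- rewrite cabsM cabsN cabsV cabsX -exprVn.
  apply: (@le_trans _ _ (c * B x * (m^-1 * (B x)^-1) ^+ 2)).
    rewrite ler_pM ?cabs_ge0 ?sqr_ge0 ?H2//.
    by rewrite ler_pXn2r ?nnegrE ?iV// mulr_ge0// ltW.
  rewrite (_ : c * B x * _ = c / m ^+ 2 * (B x)^-1); last first.
    by field; rewrite !gt_eqF.
  by rewrite ler_wpM2r ?(ltW (iB x))//; lra.
have h0 := cabs_ge0 h; set e := cabs h in h0 *.
set K := c + _ + _ + _ => Ke.
have cK : c <= K by rewrite /K; lra.
have ce1 : c * e <= 1 by nra.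
have e1 : e <= 1 by nra.
have {}H3 := H3 x _ _ Dz Dh ce1; rewrite -/e in H3.
set r := phi x (z + h) - _ - _ in H3.
rewrite (_ : _ - _ = (- phi x z * r + h ^+ 2 * p x z ^+ 2 + h * p x z * r) *
   ((phi x z)^-1 ^+ 2 * (phi x (z + h))^-1)); last first.
  by rewrite /r; field; rewrite !nz.
rewrite cabsM [X in _ * X]cabsM cabsX !cabsV.
have M2 (u v a b : R) : 0 <= u -> 0 <= v -> u <= a -> v <= b -> u * v <= a * b.
  by move=> *; exact: ler_pM.
have num : cabs (- phi x z * r + h ^+ 2 * p x z ^+ 2 + h * p x z * r)
    <= 3 * c ^+ 2 * e ^+ 2 * B x ^+ 2.
  apply: le_trans (cabsD _ _) _; apply: le_trans (lerD (cabsD _ _) (lexx _)) _.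
  rewrite [cabs (- _ * _)]cabsM cabsN [cabs (h ^+ 2 * _)]cabsM.
  rewrite [cabs (h * _ * _)]cabsM [cabs (h * p x z)]cabsM !cabsX -/e.
  have b1 := M2 _ _ _ _ (cabs_ge0 _) (cabs_ge0 _) (H1 x _ Dz) H3.
  have b2 : cabs (p x z) ^+ 2 <= (c * B x) ^+ 2.
    by rewrite ler_pXn2r ?nnegrE ?cabs_ge0 ?H2// mulr_ge0// ltW.
  have {}b2 := ler_wpM2l (sqr_ge0 e) b2.
  have b3 : e * cabs (p x z) <= c * B x.
    rewrite -[leRHS]mul1r; apply: M2 => //; [exact: cabs_ge0|exact: H2].
  have {}b3 := M2 _ _ _ _ (mulr_ge0 h0 (cabs_ge0 _)) (cabs_ge0 _) b3 H3.
  lra.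
have den : (cabs (phi x z))^-1 ^+ 2 * (cabs (phi x (z + h)))^-1
    <= (m^-1 * (B x)^-1) ^+ 2 * (m^-1 * (B x)^-1).
  rewrite M2 ?sqr_ge0 ?iV//.
  by rewrite ler_pXn2r ?nnegrE ?iV// mulr_ge0// ltW.
apply: le_trans (M2 _ _ _ _ (cabs_ge0 _) _ num den) _.
  by rewrite mulr_ge0 ?sqr_ge0.
rewrite (_ : _ * _ = 3 * c ^+ 2 / m ^+ 3 * (e ^+ 2 * (B x)^-1)); last first.
  by field; rewrite !gt_eqF.
rewrite -[K * _ * _]mulrA; apply: ler_wpM2r.
  by rewrite mulr_ge0 ?sqr_ge0// ltW.
by rewrite /K; lra.
Qed.

Lemma tame_cexp (X : Type) (alpha : X -> C) (lam : C) (M : R) :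
  (forall z, D z -> cabs z <= M) ->
  tame (fun x z => cexp (alpha x + lam * z)) (fun x => expR (complex.Re (alpha x))).
Proof.
move=> DM; set l := cabs lam; set E := expR (l * M).
have l0 : 0 <= l := cabs_ge0 lam; have E0 : 0 < E := expR_gt0 _.
exists (fun x z => lam * cexp (alpha x + lam * z)),
  (1 + 2 * l + (1 + l + 5 * l ^+ 2) * E).
have bnd x z : D z ->
    cabs (cexp (alpha x + lam * z)) <= E * expR (complex.Re (alpha x)).
  move=> Dz; rewrite cabs_cexp cReD -expRD ler_expR addrC lerD2r.
  apply: le_trans (ler_norm _) _; apply: le_trans (Re_le_cabs _) _.
  by rewrite cabsM; apply: ler_pM; rewrite ?cabs_ge0 ?DM.
have l2 := sqr_ge0 l.
have lE : 0 <= l * E by rewrite mulr_ge0// ltW.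
have l2E : 0 <= l ^+ 2 * E by rewrite mulr_ge0// ltW.
split=> [|x z Dz|x z Dz|x z h Dz Dh].
- by split=> [|x]; [lra|rewrite ltW ?expR_gt0].
- by apply: le_trans (bnd _ _ Dz) _; rewrite ler_wpM2r ?expR_ge0//; lra.
- rewrite cabsM -/l; apply: le_trans (ler_wpM2l l0 (bnd _ _ Dz)) _.
  by rewrite mulrA ler_wpM2r ?expR_ge0//; lra.
have h0 := cabs_ge0 h; set e := cabs h in h0 *; set K := _ + _ + _ => Ke.
have lK : 2 * l <= K by rewrite /K; lra.
have le2 : cabs (lam * h) <= 2^-1 by rewrite cabsM -/e -/l; nra.
rewrite (_ : _ - _ = cexp (alpha x + lam * z) * (cexp (lam * h) - 1 - lam * h));
  last by rewrite mulrDr addrA [cexp (_ + lam * h)]cexpD; ring.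
rewrite cabsM.
apply: le_trans (ler_pM (cabs_ge0 _) (cabs_ge0 _) (bnd x _ Dz) (cexp_taylor2 le2)) _.
rewrite cabsM -/e -/l [leLHS](_ : _ =
  5 * l ^+ 2 * E * (e ^+ 2 * expR (complex.Re (alpha x)))); last by ring.
rewrite -[K * _ * _]mulrA; apply: ler_wpM2r.
  by rewrite mulr_ge0 ?sqr_ge0// expR_ge0.
by rewrite /K; lra.
Qed.

(** For the inverses of the partial sums p_1 + ... + p_j: with N the number of
    terms and z their common displacement, the imaginary part is at least e1,
    whatever the real parts. *)
Lemma tame_linV (X : Type) (s : X -> R) (N e1 : R) :
  0 < e1 -> 1 <= N -> (forall z, D z -> e1 <= complex.Im z) ->
  tame (fun x z => ((s x)%:C + N%:C * z)^-1) (fun=> 1).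
Proof.
move=> e0 N1 De.
exists (fun x z => - N%:C / ((s x)%:C + N%:C * z) ^+ 2),
  (1 + e1^-1 + N / e1 ^+ 2 + N ^+ 2 / e1 ^+ 3).
have t1 : 0 < e1^-1 by rewrite invr_gt0.
have t2 : 0 <= N / e1 ^+ 2 by rewrite divr_ge0 ?sqr_ge0//; lra.
have t3 : 0 <= N ^+ 2 / e1 ^+ 3 by rewrite divr_ge0 ?exprn_ge0 ?ltW//; lra.
have pos x z : D z -> e1 <= cabs ((s x)%:C + N%:C * z).
  move=> Dz; apply: le_trans (Im_le_cabs _); apply: le_trans (ler_norm _).
  rewrite cImD cImM /= !mul0r addr0 add0r; have := De _ Dz; nra.
have nz x z : D z -> (s x)%:C + N%:C * z != 0.
  by move=> Dz; rewrite -cabs_eq0 gt_eqF// (lt_le_trans e0)// pos.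
have iV x z : D z -> (cabs ((s x)%:C + N%:C * z))^-1 <= e1^-1.
  move=> Dz; rewrite lef_pV2 ?posrE// ?pos//.
  by apply: lt_le_trans (pos x z Dz).
have iV0 x z : 0 <= (cabs ((s x)%:C + N%:C * z))^-1.
  by rewrite invr_ge0 cabs_ge0.
have iV2 x z : D z -> (cabs ((s x)%:C + N%:C * z))^-1 ^+ 2 <= e1^-1 ^+ 2.
  move=> Dz; rewrite ler_pXn2r ?nnegrE//; [exact: iV|exact: ltW].
have N0 : 0 <= N by lra.
have cN : cabs N%:C = N by rewrite cabs_real ger0_norm.
split=> [|x z Dz|x z Dz|x z h Dz Dh].
- by split=> //; lra.
- by rewrite cabsV mulr1; apply: le_trans (iV _ _ Dz) _; lra.
- rewrite cabsM cabsN cabsV cabsX cN -exprVn mulr1.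
  apply: (@le_trans _ _ (N * e1^-1 ^+ 2)); last by rewrite exprVn; lra.
  by rewrite ler_wpM2l// iV2.
have h0 := cabs_ge0 h; set e := cabs h in h0 *; set K := _ + _ + _ + _ => Ke.
rewrite (_ : _ - _ = N%:C ^+ 2 * h ^+ 2 * (((s x)%:C + N%:C * z)^-1 ^+ 2
   * ((s x)%:C + N%:C * (z + h))^-1)); last by field; rewrite !nz.
rewrite cabsM [cabs (_ / _)]cabsM [cabs (N%:C ^+ 2 * _)]cabsM !cabsX !cabsV cN -/e mulr1.
rewrite mulrAC.
apply: ler_wpM2r; first exact: sqr_ge0.
apply: (@le_trans _ _ (N ^+ 2 * (e1^-1 ^+ 2 * e1^-1))).
  by rewrite ler_wpM2l ?sqr_ge0// ler_pM ?sqr_ge0 ?iV2 ?iV.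
rewrite (_ : _ * _ = N ^+ 2 / e1 ^+ 3); last by field; rewrite gt_eqF.
by rewrite /K; lra.
Qed.

End tame.

(** * Lower bounds for the hyperbolic sine *)

Section hyperbolic_sine.
Variable R : realType.
Local Notation C := R[i].

Lemma Re_sh (y : C) : complex.Re (sh y) =
  (expR (complex.Re y) - expR (- complex.Re y)) * cos (complex.Im y).
Proof. by rewrite /sh cReD cReN !Re_cexp cReN cImN cosN; ring. Qed.

Lemma Im_sh (y : C) : complex.Im (sh y) =
  (expR (complex.Re y) + expR (- complex.Re y)) * sin (complex.Im y).
Proof. by rewrite /sh cImD cImN !Im_cexp cReN cImN sinN; ring. Qed.

Lemma sh_ge_sin (y : C) :
  expR `|complex.Re y| * `|sin (complex.Im y)| <= cabs (sh y).
Proof.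
apply: le_trans (Im_le_cabs _); rewrite Im_sh normrM ler_wpM2r//.
rewrite gtr0_norm ?addr_gt0 ?expR_gt0//.
have [u0|u0] := ger0P (complex.Re y).
  by rewrite lerDl ltW ?expR_gt0.
by rewrite lerDr ltW ?expR_gt0.
Qed.

(** For y = u + i v, the square of |sh y| is (e^u - e^-u)^2 + 4 sin^2 v. *)
Lemma sh_ge_sinh (y : C) :
  expR `|complex.Re y| * (1 - expR (- (2 * `|complex.Re y|))) <= cabs (sh y).
Proof.
set u := complex.Re y.
have e1 (t : R) : expR t * expR (- t) = 1 by rewrite -expRD subrr expR0.
have -> : expR `|u| * (1 - expR (- (2 * `|u|))) = `|expR u - expR (- u)|.
  rewrite mulrBr mulr1 -expRD (_ : `|u| - 2 * `|u| = - `|u|); last by ring.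
  have [u0|u0] := ger0P u.
    by rewrite ger0_norm// subr_ge0 ler_expR; lra.
  by rewrite opprK distrC ger0_norm// subr_ge0 ler_expR; lra.
rewrite -(@ler_pXn2r _ 2) ?nnegrE ?cabs_ge0// sqr_cabs Re_sh Im_sh -/u.
rewrite real_normK ?num_real// !exprMn.
set c := cos _; set s := sin _.
have cs : c ^+ 2 + s ^+ 2 = 1 by exact: cos2Dsin2.
have -> : c ^+ 2 = 1 - s ^+ 2 by lra.
have := e1 u; set a := expR u; set b := expR (- u) => ab.
have := sqr_ge0 s; rewrite sqrrB sqrrD ab; nra.
Qed.

(** Off the zeros of the hyperbolic sine: with y = lam (x + z) = u + i v one has
    v = (Im lam / Re lam) u + Im z |lam|^2 / Re lam, so when u is small, v is
    bounded away from 0 and from pi. *)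
Lemma sh_lower_bound (D : set C) (lam : C) (e1 e2 M : R) :
  0 < complex.Re lam -> 0 < e1 -> e2 * cabs lam ^+ 2 <= complex.Re lam / 2 ->
  (forall z, D z -> cabs z <= M) ->
  (forall z, D z -> e1 <= complex.Im z <= e2) ->
  exists2 m : R, 0 < m & forall (x : R) z, D z ->
    m * expR (complex.Re lam * `|x|) <= cabs (sh (lam * (x%:C + z))).
Proof.
set l1 := complex.Re lam; set l2 := complex.Im lam => l10 e10 e2l DM De.
have [N NE] : exists N : R, N = l1 ^+ 2 + l2 ^+ 2 by exists (l1 ^+ 2 + l2 ^+ 2).
rewrite sqr_cabs -/l1 -/l2 -NE in e2l.
have N0 : 0 < N by rewrite NE ltr_pwDl ?sqr_ge0 ?exprn_gt0.
pose th1 := e1 * N / l1; pose kap := l2 / l1.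
have th10 : 0 < th1 by rewrite divr_gt0 ?mulr_gt0.
pose u0 := th1 / (2 * (`|kap| + 1)).
have k1 : 0 < `|kap| + 1 by rewrite ltr_pwDr.
have u00 : 0 < u0 by rewrite divr_gt0// mulr_gt0.
have [De0|/set0P[z0 Dz0]] := eqVneq D set0.
  by exists 1 => // x z; rewrite De0.
have th1h : th1 <= 2^-1.
  have /andP[ha hb] := De _ Dz0.
  rewrite /th1 ler_pdivrMr//; apply: (@le_trans _ _ (e2 * N)); last by lra.
  by rewrite (ler_pM2r N0) (le_trans ha).
have p2 := pihalf_ge1 R.
pose m0 := Num.min (sin (th1 / 2)) (1 - expR (- (2 * u0))).
have s0 : 0 < sin (th1 / 2).
  by apply: sin_gt0_pihalf; apply/andP; split; lra.
have m00 : 0 < m0.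
  by rewrite lt_min s0 subr_gt0 expR_lt1 oppr_lt0 mulr_gt0.
exists (m0 * expR (- (cabs lam * M))) => [|x z Dz].
  by rewrite mulr_gt0 ?expR_gt0.
set y := lam * (x%:C + z); set u := complex.Re y.
have uE : u = l1 * x + complex.Re (lam * z) 
  by rewrite /u /y mulrDr cReD Re_mulr.
have hu : l1 * `|x| - cabs lam * M <= `|u|.
  have h1 : `|complex.Re (lam * z)| <= cabs lam * M.
    by apply: le_trans (Re_le_cabs _) _; rewrite cabsM ler_wpM2l ?cabs_ge0 ?DM.
  have h3 := ler_normB u (complex.Re (lam * z)).
  rewrite {1}uE addrK normrM (gtr0_norm l10) in h3; lra.
apply: (@le_trans _ _ (expR `|u| * m0)).
  rewrite -mulrA -expRD mulrC ler_wpM2r ?(ltW m00)// ler_expR; lra.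
have [uu0|uu0] := leP u0 `|u|.
  apply: le_trans (sh_ge_sinh y); rewrite ler_wpM2l ?expR_ge0// -/u.
  rewrite /m0 ge_min; apply/orP; right.
  by rewrite lerD2l lerN2 ler_expR; lra.
apply: le_trans (sh_ge_sin y); rewrite ler_wpM2l ?expR_ge0//.
rewrite /m0 ge_min; apply/orP; left.
have /andP[t1 t2] := De _ Dz; set t := complex.Im z in t1 t2.
have vE : complex.Im y = kap * u + t * N / l1.
  rewrite uE /y cImM cReM cReD cImD /= -/l1 -/l2 -/t NE /kap.
  by field; rewrite gt_eqF.
have ku : `|kap * u| <= th1 / 2.
  rewrite normrM; apply: (@le_trans _ _ ((`|kap| + 1) * u0)).
    by apply: ler_pM => //; [rewrite lerDl|exact: ltW].
  by rewrite /u0 le_eqVlt; apply/orP; left; apply/eqP; field; rewrite gt_eqF.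
have tN1 : th1 <= t * N / l1 by rewrite ler_wpM2r ?invr_ge0 ?(ltW l10)// ler_wpM2r ?(ltW N0).
have tN2 : t * N / l1 <= 2^-1.
  rewrite ler_pdivrMr//; apply: (@le_trans _ _ (e2 * N)); last by lra.
  by rewrite ler_wpM2r ?(ltW N0).
move: ku; rewrite ler_norml => /andP[ku1 ku2].
apply: le_trans (ler_norm _).
have : th1 / 2 <= complex.Im y by rewrite vE; lra.
rewrite le_eqVlt => /predU1P[-> //|lt1]; apply: ltW.
rewrite ltr_sin// in_itv/= ?vE; apply/andP; split; lra.
Qed.

End hyperbolic_sine.

Section kernel.
Variable R : realType.
Local Notation C := R[i].

(** The width in the real direction leaves room for the comparison of vertical
    with horizontal increments. *)
Definition rect (e1 e2 : R) : set C :=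
  [set z | `|complex.Re z| <= 1 /\ e1 <= complex.Im z <= e2].

Lemma rect_cabs e1 e2 z : 0 < e1 -> rect e1 e2 z -> cabs z <= 1 + e2.
Proof.
move=> e10 [h1 /andP[h2 h3]]; apply: le_trans (cabs_le_ReIm _) _.
by apply: lerD => //; rewrite ger0_norm// (le_trans (ltW e10)).
Qed.

Lemma tame_shV (lam : C) (e1 e2 : R) :
  0 < complex.Re lam -> 0 < e1 -> e2 * cabs lam ^+ 2 <= complex.Re lam / 2 ->
  tame (rect e1 e2) (fun (x : R) z => (sh (lam * (x%:C + z)))^-1)
    (fun x => (expR (complex.Re lam * `|x|))^-1).
Proof.
move=> l0 e10 e2l.
have rM z : rect e1 e2 z -> cabs z <= 1 + e2 by exact: rect_cabs.
have [m m0 Hm] := sh_lower_bound l0 e10 e2l rM (fun z Dz => Dz.2).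
apply: (tameV m0) => [x|x z|]; [exact: expR_gt0|exact: Hm|].
have E1 := tame_cexp (fun x : R => lam * x%:C) lam rM.
have E2 := tame_cexp (fun x : R => - lam * x%:C) (- lam) rM.
apply: (@eq_tame _ _ _ (fun x z =>
    cexp (lam * x%:C + lam * z) - cexp (- lam * x%:C + - lam * z))).
  by move=> x z; rewrite /sh mulrDr; congr (_ - cexp _); ring.
apply: tameB; [apply: tame_le E1 => x|apply: tame_le E2 => x].
  rewrite Re_mulr ler_expR ler_wpM2l ?(ltW l0)//; exact: ler_norm.
rewrite Re_mulr cReN ler_expR mulNr -mulrN ler_wpM2l ?(ltW l0)//.
by rewrite -normrN; exact: ler_norm.
Qed.

(** The exponent is the decay rate of the kernel, which is positive exactly in
    the domain of convergence. The two bounds on e2 put the rectangle below the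
    zeros of the two hyperbolic sines in the upper half plane. *)
Lemma tame_Kfun (hbar w : C) (a b : nat) (e1 e2 : R) :
  0 < complex.Re hbar -> 0 < e1 -> e2 * pi <= 2^-1 ->
  e2 * pi * cabs hbar ^+ 2 <= complex.Re hbar / 2 ->
  tame (rect e1 e2) (fun (x : R) z => Kfun hbar a b (x%:C + z) w)
    (fun x => expR (- (pi * (a%:R + b%:R * complex.Re hbar) - `|complex.Im w|)
                    * `|x|)).
Proof.
move=> h0 e10 e2a e2b; have p0 := pi_gt0 R.
have T1 : tame (rect e1 e2) (fun (x : R) z => (sh (pi%:C * (x%:C + z)))^-1)
    (fun x => (expR (pi * `|x|))^-1).
  apply: tame_shV => //; rewrite cabs_real ger0_norm ?pi_ge0//=.
  by rewrite expr2 mulrA; nra.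
have T2 : tame (rect e1 e2)
    (fun (x : R) z => (sh (pi%:C * hbar * (x%:C + z)))^-1)
    (fun x => (expR (pi * complex.Re hbar * `|x|))^-1).
  have RE : complex.Re (pi%:C * hbar) = pi * complex.Re hbar.
    by rewrite mulrC Re_mulr mulrC.
  rewrite -RE; apply: tame_shV; rewrite ?RE ?mulr_gt0//.
  rewrite cabsM cabs_real ger0_norm ?pi_ge0// exprMn.
  rewrite (_ : e2 * _ = (e2 * pi * cabs hbar ^+ 2) * pi); last by ring.
  have := ler_wpM2r (ltW p0) e2b; lra.
have T3 := tame_cexp (fun x : R => - ('i * w) * x%:C) (- ('i * w))
  (fun z => @rect_cabs e1 e2 z e10).
have T := tameM T3 (tameM (tameX a T1) (tameX b T2)).
apply: eq_tame (tame_le _ T) => [x z|x].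
  rewrite /Kfun; congr (cexp _ * _); last by rewrite !exprVn -invfM.
  by ring.
rewrite Re_mulr cReN cReM /= mul0r mul1r sub0r opprK.
rewrite -!expRN -!expRM_natl -!expRD ler_expR.
have : complex.Im w * x <= `|complex.Im w| * `|x|.
  by rewrite -normrM ler_norm.
move: (a%:R : R) (b%:R : R) => A B H.
rewrite [leRHS](_ : _ = `|complex.Im w| * `|x| +
  (A * - (pi * `|x|) + B * - (pi * complex.Re hbar * `|x|))); last by ring.
by rewrite lerD2r.
Qed.

End kernel.

(** * Lebesgue measure on tuples *)

Section box_measure.
Variable R : realType.
Local Notation RT := (measurableTypeR R).
Local Notation leb := (@lebesgue_measure R).

Definition box m (A : 'I_m -> set RT) : set (m.-tuple RT) :=
  [set x | forall i, A i (tnth x i)].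

Lemma box_bigcap m (A : 'I_m -> set RT) :
  box A = \big[setI/setT]_(i < m) ((@tnth m RT ^~ i) @^-1` A i).
Proof.
rewrite -bigcap_seq; apply/seteqP; split=> x /= H i.
  by move=> _; exact: H.
by apply: H => /=; rewrite mem_index_enum.
Qed.

Lemma measurable_box m (A : 'I_m -> set RT) :
  (forall i, measurable (A i)) -> measurable (box A).
Proof.
move=> mA; rewrite box_bigcap; apply: bigsetI_measurable => i _.
rewrite -[X in measurable X]setTI.
exact: (@measurable_tnth _ RT m i measurableT).
Qed.

Lemma lebesgue_tuple_box m (A : 'I_m -> set RT) :
  (forall i, measurable (A i)) ->
  lebesgue_tuple R m (box A) = (\prod_(i < m) leb (A i))%E.
Proof.
elim: m A => [|m IH] A mA.
  rewrite big_ord0 /= diracE (_ : _ \in _ = true) //.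
  by apply/mem_set => -[].
rewrite big_ord_recl /= /lebesgue_tcons /pushforward.
rewrite (_ : _ @^-1` _ = A ord0 `*` box (fun i => A (lift ord0 i))).
  rewrite product_measure1E//; last exact: measurable_box.
  by rewrite IH.
apply/seteqP; split=> -[x t] /=.
  move=> H; split; first exact: (H ord0).
  by move=> i; have := H (lift ord0 i); rewrite tnthS.
move=> [H1 H2] i; have [->//|i0] := eqVneq i ord0.
have [j ->] : exists j, i = lift ord0 j.
  by case: (unliftP ord0 i) i0 => [j -> _|->]; [exists j|rewrite eqxx].
by rewrite tnthS; exact: H2.
Qed.

(** Boxes are closed under intersection and generate the measurable sets, and
    the cubes with sides [-n, n] have finite measure and exhaust the space. *)
Lemma lebesgue_tuple_unique m (mu : {measure set (m.-tuple RT) -> \bar R}) :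
  (forall A : 'I_m -> set RT, (forall i, measurable (A i)) ->
     mu (box A) = (\prod_(i < m) leb (A i))%E) ->
  forall X, measurable X -> lebesgue_tuple R m X = mu X.
Proof.
move=> muE X mX.
pose G : set (set (m.-tuple RT)) :=
  [set box A | A in [set A | forall i, measurable (A i)]].
pose g (n : nat) : set (m.-tuple RT) := box (fun=> `[- n%:R, n%:R]%classic).
have mitv (n : nat) : measurable (`[- n%:R, n%:R]%classic : set RT).
  exact: measurable_itv.
apply: (measure_unique G g) => //.
- apply/seteqP; split.
    apply: smallest_sub; first exact: smallest_sigma_algebra.
    move=> B; rewrite -bigcup_seq => -[i _ [C mC <-]].
    apply: sub_sigma_algebra.
    exists (fun j => if j == i then C else setT) => [j|].
      by case: ifP.
    apply/seteqP; split=> x /=; rewrite /box /=.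
      by move=> /(_ i); rewrite eqxx.
    by move=> [_ Cx] j; case: eqP => // ->.
  apply: smallest_sub; first exact: sigma_algebra_measurable.
  by move=> _ [A mA <-]; exact: measurable_box.
- move=> _ _ [A mA <-] [B mB <-]; exists (fun i => A i `&` B i).
    by move=> i; exact: measurableI.
  apply/seteqP; split=> x /=; rewrite /box /=.
    by move=> H; split=> i; have [] := H i.
  by move=> [H1 H2] i; split.
- by move=> n; exists (fun=> `[- n%:R, n%:R]%classic) => // i.
- apply/seteqP; split=> // x _.
  pose M := \sum_(i < m) `|tnth x i|.
  have xM i : `|tnth x i| <= (Num.truncn M).+1%:R.
    apply: (@le_trans _ _ M); last by apply: ltW; rewrite truncnS_gt.
    by rewrite /M (bigD1 i)//= lerDl sumr_ge0.
  exists (Num.truncn M).+1 => // i.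
  by have := xM i; rewrite ler_norml /= in_itv /=.
- by move=> _ [A mA <-]; rewrite muE//; exact: lebesgue_tuple_box.
- move=> n; apply: (eq_ind_r (fun x => (x < +oo)%E) _
    (lebesgue_tuple_box (fun=> mitv n))).
  suff /andP[] : (0 <= \prod_(i < m) leb (`[(- n%:R)%R, n%:R%R]%classic : set RT)
    < +oo)%E by [].
  apply: (big_ind (fun x : \bar R => (0 <= x < +oo)%E)).
  + by rewrite lee01 ltry.
  + move=> x y /andP[x0 xoo] /andP[y0 yoo].
    by rewrite mule_ge0//= lte_mul_pinfty// ge0_fin_numE.
  + move=> i _; rewrite measure_ge0/= lebesgue_measure_itv/=.
    by case: ifP => _; rewrite ?ltry // -EFinB ltry.
Qed.

End box_measure.

Section product_integral.
Context d1 d2 (T1 : measurableType d1) (T2 : measurableType d2) (R : realType).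
Variable m1 : {sigma_finite_measure set T1 -> \bar R}.
Variable m2 : {sigma_finite_measure set T2 -> \bar R}.
Variables (f : T1 -> R) (g : T2 -> R).
Hypotheses (intf : m1.-integrable setT (EFin \o f))
           (intg : m2.-integrable setT (EFin \o g)).

Let mfg : measurable_fun setT (fun z : T1 * T2 => f z.1 * g z.2).
Proof.
have /measurable_EFinP mf := measurable_int _ intf.
have /measurable_EFinP mg := measurable_int _ intg.
by apply: measurable_funM; exact: measurableT_comp.
Qed.

Lemma integrable_prod :
  (m1 \x m2)%E.-integrable setT (EFin \o (fun z => f z.1 * g z.2)).
Proof.
apply/integrable12ltyP; first by apply/measurable_EFinP; exact: mfg.
have -> : (\int[m1]_x \int[m2]_y `|(f x * g y)%:E|
   = \int[m1]_x (`|(f x)%:E| * \int[m2]_y `|(g y)%:E|))%E.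
  apply: eq_integral => x _.
  under eq_integral do rewrite EFinM abseM.
  rewrite ge0_integralZl//.
  by apply: measurableT_comp => //; exact: (measurable_int _ intg).
rewrite ge0_integralZr//; last 2 first.
- by apply: measurableT_comp => //; exact: (measurable_int _ intf).
- exact: integral_ge0.
have /integrableP[_ If] := intf; have /integrableP[_ Ig] := intg.
by rewrite lte_mul_pinfty// ?integral_ge0// ge0_fin_numE// integral_ge0.
Qed.

Lemma Rintegral_prod :
  (\int[(m1 \x m2)%E]_z (f z.1 * g z.2) = (\int[m1]_x f x) * (\int[m2]_y g y)).
Proof.
rewrite /Rintegral -fineM; last 2 first.
- exact: integrable_fin_num.
- exact: integrable_fin_num.
congr fine.
rewrite -(integral12_prod_meas1 integrable_prod) /fubini_F.
have -> : (\int[m1]_x \int[m2]_y (f x * g y)%:E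
   = \int[m1]_x ((f x)%:E * \int[m2]_y (g y)%:E))%E.
  apply: eq_integral => x _.
  under eq_integral do rewrite EFinM.
  by rewrite integralZl.
have fg : (\int[m2]_y (g y)%:E)%E \is a fin_num by exact: integrable_fin_num.
by rewrite -(fineK fg) integralZr.
Qed.

End product_integral.

(** A map under which boxes have preimages of the right measure transports
    integrals: this covers translations, permutations and concatenations of
    tuples at once. *)
Section transfer.
Context d (T : measurableType d) (R : realType) (m : nat).
Local Notation RT := (measurableTypeR R).
Local Notation leb := (@lebesgue_measure R).
Variables (mu : {measure set T -> \bar R}) (phi : T -> m.-tuple RT).
Hypothesis mphi : measurable_fun setT phi.
Hypothesis muphi : forall A : 'I_m -> set RT, (forall i, measurable (A i)) ->
  mu (phi @^-1` box A) = (\prod_(i < m) leb (A i))%E.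
Variable f : m.-tuple RT -> R.
Hypotheses (mf : measurable_fun setT f)
           (intf : mu.-integrable setT (EFin \o (f \o phi))).

Let mphi_mixin := isMeasurableFun.Build _ _ _ _ _ mphi.
Let mphi_pack : {mfun T >-> m.-tuple RT} := HB.pack phi mphi_mixin.

Let pushE X : measurable X -> lebesgue_tuple R m X = pushforward mu phi X.
Proof.
by move=> mX; apply: (@lebesgue_tuple_unique R m (pushforward mu mphi_pack)).
Qed.

Lemma integrable_transfer : (lebesgue_tuple R m).-integrable setT (EFin \o f).
Proof.
have mf' : measurable_fun setT (EFin \o f) by exact/measurable_EFinP.
have /integrableP[_] := integrable_pushforward mphi mf' intf measurableT.
move=> H; apply/integrableP; split=> //; apply: le_lt_trans H.
rewrite (eq_measure_integral (pushforward mu mphi_pack)) // => A mA _; exact: pushE.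
Qed.

Lemma Rintegral_transfer :
  \int[lebesgue_tuple R m]_x f x = \int[mu]_x f (phi x).
Proof.
have mf' : measurable_fun setT (EFin \o f) by exact/measurable_EFinP.
have E := integral_pushforward mphi mf' intf measurableT.
rewrite /Rintegral; congr fine.
rewrite preimage_setT in E; rewrite -[RHS]E.
apply: (eq_measure_integral (pushforward mu mphi_pack)) => A mA _; exact: pushE.
Qed.

End transfer.

Section tuple_maps.
Variable R : realType.
Local Notation RT := (measurableTypeR R).
Local Notation leb := (@lebesgue_measure R).

Lemma lebesgue_measure_translation (s : R) (A : set RT) : measurable A ->
  leb ((fun x => x + s) @^-1` A) = leb A.
Proof.
move=> mA.
have mphi : measurable_fun setT (fun x : RT => (x + s : RT)).
  by apply: measurable_funD.
pose phi_mixin := isMeasurableFun.Build _ _ _ _ _ mphi.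
pose phi : {mfun RT >-> RT} := HB.pack (fun x : RT => (x + s : RT)) phi_mixin.
apply/esym/(@lebesgue_measure_unique R (pushforward leb phi)) => //.
move=> _ [[a b] _ <-].
transitivity (leb (`]a - s, b - s]%classic : set RT)).
  rewrite !lebesgue_measure_itv/= !lte_fin ltrD2r.
  by case: ifP => // _; rewrite -!EFinB opprB addrA subrK.
rewrite /= /pushforward; congr (leb _).
by apply/seteqP; split=> x /=; rewrite !in_itv/= ltrBlDr lerBrDr.
Qed.

Definition ttranslate m (s : R) (x : m.-tuple RT) : m.-tuple RT :=
  [tuple tnth x i + s | i < m].

Lemma measurable_ttranslate m s : measurable_fun setT (@ttranslate m s).
Proof.
apply/measurable_fun_tnthP => i.
rewrite (_ : _ \o _ = fun x => tnth x i + s); last first.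
  by apply/funext => x /=; rewrite tnth_mktuple.
by apply: measurable_funD => //; exact: measurable_tnth.
Qed.

Lemma lebesgue_tuple_translation m s (A : 'I_m -> set RT) :
  (forall i, measurable (A i)) ->
  lebesgue_tuple R m (@ttranslate m s @^-1` box A) = (\prod_(i < m) leb (A i))%E.
Proof.
move=> mA; rewrite (_ : _ @^-1` _ = box (fun i => (fun x => x + s) @^-1` A i)).
  rewrite lebesgue_tuple_box.
    by apply: eq_bigr => i _; exact: lebesgue_measure_translation.
  move=> i; rewrite -[X in measurable X]setTI.
  have mphi : measurable_fun setT (fun x : RT => (x + s : RT)).
    by apply: measurable_funD.
  exact: mphi.
by apply/seteqP; split=> x H i; have := H i; rewrite tnth_mktuple.
Qed.

Definition tpermute m (s : 'S_m) (x : m.-tuple RT) : m.-tuple RT :=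
  [tuple tnth x (s i) | i < m].

Lemma measurable_tpermute m s : measurable_fun setT (@tpermute m s).
Proof.
apply/measurable_fun_tnthP => i.
rewrite (_ : _ \o _ = fun x => tnth x (s i)); last first.
  by apply/funext => x /=; rewrite tnth_mktuple.
exact: measurable_tnth.
Qed.

Lemma lebesgue_tuple_permutation m s (A : 'I_m -> set RT) :
  (forall i, measurable (A i)) ->
  lebesgue_tuple R m (@tpermute m s @^-1` box A) = (\prod_(i < m) leb (A i))%E.
Proof.
move=> mA; rewrite (_ : _ @^-1` _ = box (fun i => A ((s^-1)%g i))).
  rewrite lebesgue_tuple_box // (reindex_inj (@perm_inj _ s)) /=.
  by apply: eq_bigr => i _; rewrite permK.
apply/seteqP; split=> x H i.
  by have := H ((s^-1)%g i); rewrite tnth_mktuple permKV.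
by rewrite tnth_mktuple; have := H (s i); rewrite permK.
Qed.

Definition tcat k l (z : k.-tuple RT * l.-tuple RT) : (k + l).-tuple RT :=
  [tuple of z.1 ++ z.2].

Lemma measurable_tcat k l : measurable_fun setT (@tcat k l).
Proof.
apply/measurable_fun_tnthP => i; rewrite /comp /tcat.
case: (fintype.splitP i) => j ij.
  rewrite (_ : (fun _ => _) = fun z => tnth z.1 j); last first.
    apply/funext => z; rewrite (_ : i = lshift l j) ?tnth_lshift//.
    exact: val_inj.
  by apply: (@measurableT_comp _ _ _ _ _ _ (fun x => tnth x j));
    [exact: measurable_tnth|exact: measurable_fst].
rewrite (_ : (fun _ => _) = fun z => tnth z.2 j); last first.
  apply/funext => z; rewrite (_ : i = rshift k j) ?tnth_rshift//.
  exact: val_inj.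
by apply: (@measurableT_comp _ _ _ _ _ _ (fun x => tnth x j));
    [exact: measurable_tnth|exact: measurable_snd].
Qed.

Lemma lebesgue_tuple_cat k l (A : 'I_(k + l) -> set RT) :
  (forall i, measurable (A i)) ->
  (lebesgue_tuple R k \x lebesgue_tuple R l)%E (@tcat k l @^-1` box A)
  = (\prod_(i < k + l) leb (A i))%E.
Proof.
move=> mA; rewrite (_ : _ @^-1` _ =
    box (fun i => A (lshift l i)) `*` box (fun i => A (rshift k i))).
  rewrite product_measure1E; [|exact: measurable_box..].
  by rewrite big_split_ord/=; congr (_ * _)%E; exact: lebesgue_tuple_box.
apply/seteqP; split=> -[x y] /=.
  move=> H; split=> i; first by have := H (lshift l i); rewrite tnth_lshift.
  by have := H (rshift k i); rewrite tnth_rshift.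
move=> [H1 H2] i; rewrite /tcat /=; case: (fintype.splitP i) => j ij.
  rewrite (_ : i = lshift l j) ?tnth_lshift; [exact: H1|exact: val_inj].
rewrite (_ : i = rshift k j) ?tnth_rshift; [exact: H2|exact: val_inj].
Qed.

Lemma lebesgue_tuple_cons m (A : 'I_m.+1 -> set RT) :
  (forall i, measurable (A i)) ->
  (leb \x lebesgue_tuple R m)%E (@tcons R m @^-1` box A)
  = (\prod_(i < m.+1) leb (A i))%E.
Proof. by move=> mA; rewrite -lebesgue_tuple_box. Qed.

(** Products of integrable functions of one variable dominate the integrands
    below. *)
Lemma integrable_tuple_prod m (h : 'I_m -> R -> R) :
  (forall i, leb.-integrable setT (EFin \o h i)) ->
  (lebesgue_tuple R m).-integrable setT
    (EFin \o (fun x : m.-tuple RT => \prod_(i < m) h i (tnth x i))).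
Proof.
elim: m h => [|m IH] h ih.
  apply/integrableP; split.
    apply/measurable_EFinP; under eq_fun do rewrite big_ord0.
    exact: measurable_cst.
  rewrite /= integral_dirac//; last first.
    apply: measurableT_comp => //; apply/measurable_EFinP.
    by under eq_fun do rewrite big_ord0; exact: measurable_cst.
  by rewrite big_ord0 ltry.
apply: (integrable_transfer (@measurable_tcons R m) (@lebesgue_tuple_cons m)).
  apply: measurable_prod => i _.
  apply: (@measurableT_comp _ _ _ _ _ _ (h i)); last exact: measurable_tnth.
  by apply/measurable_EFinP; exact: (measurable_int _ (ih i)).
rewrite (_ : EFin \o _ = EFin \o (fun z : RT * m.-tuple RT =>
    h ord0 z.1 * (\prod_(i < m) h (lift ord0 i) (tnth z.2 i)))); last first.
  apply/funext => -[x t] /=; rewrite big_ord_recl; congr (_ * _)%:E.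
  by apply: eq_bigr => i _; rewrite tnthS.
exact: (@integrable_prod _ _ _ _ _ leb (lebesgue_tuple R m) (h ord0)
  (fun t => \prod_(i < m) h (lift ord0 i) (tnth t i)) (ih ord0)
  (IH _ (fun i => ih (lift ord0 i)))).
Qed.

End tuple_maps.

(** * Integrals of complex functions *)

Section complex_integral.
Context d (T : measurableType d) (R : realType).
Local Notation C := R[i].

Definition cmeasurable (f : T -> C) :=
  measurable_fun setT (fun x => complex.Re (f x)) /\
  measurable_fun setT (fun x => complex.Im (f x)).

Lemma cmeasurable_cst (c : C) : cmeasurable (fun=> c).
Proof. by split; exact: measurable_cst. Qed.

Lemma cmeasurable_real (g : T -> R) :
  measurable_fun setT g -> cmeasurable (fun x => (g x)%:C).
Proof. by move=> mg; split => //; exact: measurable_cst. Qed.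

Lemma cmeasurableN f : cmeasurable f -> cmeasurable (fun x => - f x).
Proof.
move=> [f1 f2]; split.
  by under eq_fun do rewrite cReN; exact: (measurable_funN f1).
by under eq_fun do rewrite cImN; exact: (measurable_funN f2).
Qed.

Lemma cmeasurableD f g :
  cmeasurable f -> cmeasurable g -> cmeasurable (fun x => f x + g x).
Proof.
move=> [f1 f2] [g1 g2]; split; under eq_fun do rewrite ?cReD ?cImD;
  exact: measurable_funD.
Qed.

Lemma cmeasurableM f g :
  cmeasurable f -> cmeasurable g -> cmeasurable (fun x => f x * g x).
Proof.
move=> [f1 f2] [g1 g2]; split.
  under eq_fun do rewrite cReM.
  by apply: measurable_funB; exact: measurable_funM.
under eq_fun do rewrite cImM.
by apply: measurable_funD; exact: measurable_funM.
Qed.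

Lemma cmeasurableV f : cmeasurable f -> cmeasurable (fun x => (f x)^-1).
Proof.
move=> [f1 f2].
have mn : measurable_fun setT
    (fun x => (complex.Re (f x) ^+ 2 + complex.Im (f x) ^+ 2)^-1).
  rewrite (_ : (fun x => _) = (fun r => r `^ (-1)) \o
      (fun x => complex.Re (f x) ^+ 2 + complex.Im (f x) ^+ 2)); last first.
    by apply/funext => x /=; rewrite powR_inv1// addr_ge0 ?sqr_ge0.
  apply: measurableT_comp; first exact: measurable_powR.
  by apply: measurable_funD; exact: measurable_funX.
split.
  rewrite (_ : (fun x => _) = fun x => complex.Re (f x) *
      (complex.Re (f x) ^+ 2 + complex.Im (f x) ^+ 2)^-1).
    exact: measurable_funM.
  by apply/funext => x; case: (f x).
rewrite (_ : (fun x => _) = fun x => - (complex.Im (f x) *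
    (complex.Re (f x) ^+ 2 + complex.Im (f x) ^+ 2)^-1)).
  exact: (measurable_funN (measurable_funM f2 mn)).
by apply/funext => x; case: (f x).
Qed.

Lemma cmeasurable_cexp f : cmeasurable f -> cmeasurable (fun x => cexp (f x)).
Proof.
move=> [f1 f2].
have mc g : measurable_fun setT g -> measurable_fun setT (fun x : T => cos (g x)).
  move=> mg; apply: measurableT_comp => //.
  by apply: continuous_measurable_fun; exact: continuous_cos.
have ms g : measurable_fun setT g -> measurable_fun setT (fun x : T => sin (g x)).
  move=> mg; apply: measurableT_comp => //.
  by apply: continuous_measurable_fun; exact: continuous_sin.
have me g : measurable_fun setT g -> measurable_fun setT (fun x : T => expR (g x)).
  by move=> mg; apply: measurableT_comp => //; exact: measurable_expR.
split.
  by under eq_fun do rewrite Re_cexp; apply: measurable_funM; [exact: me|exact: mc].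
by under eq_fun do rewrite Im_cexp; apply: measurable_funM; [exact: me|exact: ms].
Qed.

Lemma cmeasurable_sum (I : Type) (r : seq I) (P : pred I) (f : I -> T -> C) :
  (forall i, cmeasurable (f i)) ->
  cmeasurable (fun x => \sum_(i <- r | P i) f i x).
Proof.
move=> mf; elim: r => [|i r IH].
  by under eq_fun do rewrite big_nil; exact: cmeasurable_cst.
under eq_fun do rewrite big_cons.
by case: (P i) => //; exact: cmeasurableD.
Qed.

Lemma cmeasurable_prod (I : Type) (r : seq I) (f : I -> T -> C) :
  (forall i, cmeasurable (f i)) -> cmeasurable (fun x => \prod_(i <- r) f i x).
Proof.
move=> mf; elim: r => [|i r IH].
  by under eq_fun do rewrite big_nil; exact: cmeasurable_cst.
by under eq_fun do rewrite big_cons; exact: cmeasurableM.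
Qed.

Lemma cmeasurableX f n : cmeasurable f -> cmeasurable (fun x => f x ^+ n).
Proof.
move=> mf; elim: n => [|n IH]; first exact: cmeasurable_cst.
by under eq_fun do rewrite exprS; exact: cmeasurableM.
Qed.

Variable mu : {measure set T -> \bar R}.

Definition cint (f : T -> C) : C :=
  (\int[mu]_x complex.Re (f x))%:C + 'i * (\int[mu]_x complex.Im (f x))%:C.

Definition cintegrable (f : T -> C) :=
  mu.-integrable setT (EFin \o (fun x => complex.Re (f x))) /\
  mu.-integrable setT (EFin \o (fun x => complex.Im (f x))).

Lemma Re_cint f : complex.Re (cint f) = \int[mu]_x complex.Re (f x).
Proof. by rewrite /cint cReD cReM /=; ring. Qed.

Lemma Im_cint f : complex.Im (cint f) = \int[mu]_x complex.Im (f x).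
Proof. by rewrite /cint cImD cImM /=; ring. Qed.

Lemma cintegrable_le f (B : T -> R) : cmeasurable f ->
  (forall x, cabs (f x) <= B x) -> mu.-integrable setT (EFin \o B) ->
  cintegrable f.
Proof.
move=> [f1 f2] fB iB; split; (apply: le_integrable iB => //;
    first exact/measurable_EFinP) => x _ /=; rewrite lee_fin.
  by apply: le_trans (ler_norm _); apply: le_trans (fB x); exact: Re_le_cabs.
by apply: le_trans (ler_norm _); apply: le_trans (fB x); exact: Im_le_cabs.
Qed.

Lemma cintegrableD f g :
  cintegrable f -> cintegrable g -> cintegrable (fun x => f x + g x).
Proof.
move=> [f1 f2] [g1 g2]; split.
  rewrite (_ : _ \o _ = fun x => ((complex.Re (f x))%:E + (complex.Re (g x))%:E)%E).
    exact: integrableD.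
  by apply/funext => x /=; rewrite cReD.
rewrite (_ : _ \o _ = fun x => ((complex.Im (f x))%:E + (complex.Im (g x))%:E)%E).
  exact: integrableD.
by apply/funext => x /=; rewrite cImD.
Qed.

Lemma cintD f g : cintegrable f -> cintegrable g ->
  cint (fun x => f x + g x) = cint f + cint g.
Proof.
move=> [f1 f2] [g1 g2]; apply: complex_ext.
  rewrite [RHS]cReD !Re_cint -RintegralD//; congr Rintegral.
  by apply/funext => x; rewrite cReD.
rewrite [RHS]cImD !Im_cint -RintegralD//; congr Rintegral.
by apply/funext => x; rewrite cImD.
Qed.

Let integrable_lin (c e : R) f g :
  mu.-integrable setT (EFin \o f) -> mu.-integrable setT (EFin \o g) ->
  mu.-integrable setT (EFin \o (fun x => c * f x + e * g x)).
Proof.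
move=> h1 h2.
rewrite (_ : _ \o _ = fun x => (c%:E * (f x)%:E + e%:E * (g x)%:E)%E).
  by apply: integrableD => //; exact: integrableZl.
by apply/funext => x /=; rewrite EFinD !EFinM.
Qed.

Let Rintegral_lin (c e : R) f g :
  mu.-integrable setT (EFin \o f) -> mu.-integrable setT (EFin \o g) ->
  \int[mu]_x (c * f x + e * g x) = c * (\int[mu]_x f x) + e * (\int[mu]_x g x).
Proof.
move=> h1 h2; rewrite RintegralD ?RintegralZl//.
- rewrite (_ : _ \o _ = fun x => (c%:E * (f x)%:E)%E); last by apply/funext => x.
  exact: integrableZl.
- rewrite (_ : _ \o _ = fun x => (e%:E * (g x)%:E)%E); last by apply/funext => x.
  exact: integrableZl.
Qed.

Lemma cintegrableZ c f : cintegrable f -> cintegrable (fun x => c * f x).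
Proof.
move=> [f1 f2]; split.
  rewrite (_ : _ \o _ = EFin \o (fun x => complex.Re c * complex.Re (f x) +
      (- complex.Im c) * complex.Im (f x))); first exact: integrable_lin.
  by apply/funext => x /=; rewrite cReM mulNr.
rewrite (_ : _ \o _ = EFin \o (fun x => complex.Re c * complex.Im (f x) +
    complex.Im c * complex.Re (f x))); first exact: integrable_lin.
by apply/funext => x /=; rewrite cImM.
Qed.

Lemma cintZ c f : cintegrable f -> cint (fun x => c * f x) = c * cint f.
Proof.
move=> [f1 f2]; apply: complex_ext.
  rewrite [RHS]cReM !Re_cint !Im_cint -mulNr -Rintegral_lin//; congr Rintegral.
  by apply/funext => x; rewrite cReM mulNr.
rewrite [RHS]cImM !Re_cint !Im_cint -Rintegral_lin//; congr Rintegral.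
by apply/funext => x; rewrite cImM.
Qed.

Lemma cintegrable0 : cintegrable (fun=> 0).
Proof. by split; exact: integrable0. Qed.

Lemma cint0 : cint (fun=> 0) = 0.
Proof.
have := cintZ 0 cintegrable0; rewrite [X in _ = X]mul0r => E.
rewrite -[RHS]E; congr cint.
by apply/funext => x; rewrite mul0r.
Qed.

Lemma cintegrable_sum (I : Type) (r : seq I) (P : pred I) (f : I -> T -> C) :
  (forall i, P i -> cintegrable (f i)) ->
  cintegrable (fun x => \sum_(i <- r | P i) f i x).
Proof.
move=> mf; elim: r => [|i r IH].
  by under eq_fun do rewrite big_nil; exact: cintegrable0.
under eq_fun do rewrite big_cons.
case: (P i) (mf i) => // /(_ isT) Pi; exact: cintegrableD.
Qed.

Lemma cint_sum (I : Type) (r : seq I) (P : pred I) (f : I -> T -> C) :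
  (forall i, P i -> cintegrable (f i)) ->
  cint (fun x => \sum_(i <- r | P i) f i x) = \sum_(i <- r | P i) cint (f i).
Proof.
move=> mf; elim: r => [|i r IH].
  by under [X in cint X]eq_fun do rewrite big_nil; rewrite big_nil cint0.
under [X in cint X]eq_fun do rewrite big_cons.
rewrite big_cons; case: (P i) (mf i) => // /(_ isT) Pi; rewrite cintD ?IH//.
exact: cintegrable_sum.
Qed.

Lemma cabs_cint_le f (B : T -> R) : cmeasurable f ->
  (forall x, cabs (f x) <= B x) -> mu.-integrable setT (EFin \o B) ->
  cabs (cint f) <= 2 * (\int[mu]_x B x).
Proof.
move=> mf fB iB; have [f1 f2] := cintegrable_le mf fB iB.
apply: le_trans (cabs_le_ReIm _) _; rewrite Re_cint Im_cint mulr2n mulrDl mul1r.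
apply: lerD.
  apply: le_trans (le_normr_Rintegral measurableT f1) _.
  apply: le_Rintegral => // [|x _]; first exact: integrable_norm.
  by apply: le_trans (Re_le_cabs _) _.
apply: le_trans (le_normr_Rintegral measurableT f2) _.
apply: le_Rintegral => // [|x _]; first exact: integrable_norm.
by apply: le_trans (Im_le_cabs _) _.
Qed.

End complex_integral.

Lemma cint_prod d1 d2 (T1 : measurableType d1) (T2 : measurableType d2)
    (R : realType) (m1 : {sigma_finite_measure set T1 -> \bar R})
    (m2 : {sigma_finite_measure set T2 -> \bar R}) (f : T1 -> R[i])
    (g : T2 -> R[i]) :
  cintegrable m1 f -> cintegrable m2 g ->
  cintegrable (m1 \x m2)%E (fun z => f z.1 * g z.2) /\
  cint (m1 \x m2)%E (fun z => f z.1 * g z.2) = cint m1 f * cint m2 g.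
Proof.
move=> [f1 f2] [g1 g2].
have ie (h : T1 * T2 -> R) : (m1 \x m2)%E.-integrable setT (EFin \o h) ->
    cintegrable (m1 \x m2)%E (fun z => (h z)%:C).
  by move=> ih; split => //; exact: integrable0.
have ce (h : T1 * T2 -> R) :
    cint (m1 \x m2)%E (fun z => (h z)%:C) = (\int[(m1 \x m2)%E]_z h z)%:C.
  rewrite /cint /= (_ : (\int[_]_x 0) = 0) ?mulr0 ?addr0//.
  by rewrite /Rintegral integral0.
have E : (fun z : T1 * T2 => f z.1 * g z.2) = fun z =>
    ((complex.Re (f z.1) * complex.Re (g z.2))%:C +
     - 1 * (complex.Im (f z.1) * complex.Im (g z.2))%:C) +
    ('i * (complex.Re (f z.1) * complex.Im (g z.2))%:C +
     'i * (complex.Im (f z.1) * complex.Re (g z.2))%:C).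
  apply/funext => z; case: (f z.1) => a b; case: (g z.2) => p q.
  by apply: complex_ext; rewrite !(cReM, cImM, cReD, cImD) /=; ring.
have i11 := ie _ (integrable_prod f1 g1); have i22 := ie _ (integrable_prod f2 g2).
have i12 := ie _ (integrable_prod f1 g2); have i21 := ie _ (integrable_prod f2 g1).
have j22 := cintegrableZ (- 1) i22.
have j12 := cintegrableZ 'i i12; have j21 := cintegrableZ 'i i21.
rewrite E; split.
  by apply: cintegrableD; apply: cintegrableD.
rewrite !cintD ?cintZ//; last 2 first.
- exact: cintegrableD.
- exact: cintegrableD.
have c11 := etrans (ce _) (congr1 (real_complex R) (Rintegral_prod f1 g1)).
have c22 := etrans (ce _) (congr1 (real_complex R) (Rintegral_prod f2 g2)).
have c12 := etrans (ce _) (congr1 (real_complex R) (Rintegral_prod f1 g2)).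
have c21 := etrans (ce _) (congr1 (real_complex R) (Rintegral_prod f2 g1)).
rewrite c11 c22 c12 c21 /cint.
by apply: complex_ext; rewrite !(cReM, cImM, cReD, cImD, cReN, cImN) /=; ring.
Qed.

Section change_of_variables.
Context d (T : measurableType d) (R : realType) (m : nat).
Local Notation RT := (measurableTypeR R).
Local Notation leb := (@lebesgue_measure R).
Variables (mu : {measure set T -> \bar R}) (phi : T -> m.-tuple RT).
Hypothesis mphi : measurable_fun setT phi.
Hypothesis muphi : forall A : 'I_m -> set RT, (forall i, measurable (A i)) ->
  mu (phi @^-1` box A) = (\prod_(i < m) leb (A i))%E.
Variable f : m.-tuple RT -> R[i].
Hypotheses (mf : cmeasurable f) (intf : cintegrable mu (f \o phi)).

Lemma cintegrable_transfer : cintegrable (lebesgue_tuple R m) f.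
Proof.
by split; [exact: (integrable_transfer mphi muphi mf.1 intf.1)|
           exact: (integrable_transfer mphi muphi mf.2 intf.2)].
Qed.

Lemma cint_transfer : cint (lebesgue_tuple R m) f = cint mu (f \o phi).
Proof.
congr (_%:C + 'i * _%:C).
  exact: (Rintegral_transfer mphi muphi mf.1 intf.1).
exact: (Rintegral_transfer mphi muphi mf.2 intf.2).
Qed.

End change_of_variables.

(** * Independence of the height of the lines of integration *)

Section horizontal_lines.
Variable R : realType.
Local Notation C := R[i].
Local Notation RT := (measurableTypeR R).

(** Cut the interval into n equal pieces and let n grow. *)
Lemma quadratic_increments_const (F : R -> C) (a b K delta : R) :
  0 <= K -> 0 < delta ->
  (forall x y, a <= x -> x <= y -> y <= b -> y - x <= delta ->
     cabs (F y - F x) <= K * (y - x) ^+ 2) ->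
  forall y, a <= y <= b -> F y = F a.
Proof.
move=> K0 d0 H y /andP[ay yb]; apply/eqP; rewrite -subr_eq0 -cabs_eq0.
set c := cabs _; have c0 : 0 <= c by exact: cabs_ge0.
have step (n : nat) : (y - a) / n.+1%:R <= delta -> c * n.+1%:R <= K * (y - a) ^+ 2.
  set t := _ / _ => td; have t0 : 0 <= t by rewrite divr_ge0 ?subr_ge0.
  have n0 : (0 : R) < n.+1%:R by rewrite ltr0n.
  have tn : t * n.+1%:R = y - a by rewrite /t divfK// gt_eqF.
  have ind (j : nat) : (j <= n.+1)%N ->
      cabs (F (a + t * j%:R) - F a) <= K * t ^+ 2 * j%:R.
    elim: j => [|j IH] jn; first by rewrite !mulr0 addr0 subrr Normc.normc0.
    rewrite (_ : _ - _ = (F (a + t * j.+1%:R) - F (a + t * j%:R)) +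
        (F (a + t * j%:R) - F a)); last by ring.
    apply: le_trans (cabsD _ _) _.
    have E : (a + t * j.+1%:R) - (a + t * j%:R) = t.
      by rewrite -natr1; ring.
    have jn' : j.+1%:R <= (n.+1%:R : R) by rewrite ler_nat.
    have tj : t * j.+1%:R <= y - a by rewrite -tn ler_wpM2l.
    have tj0 : 0 <= t * j%:R by rewrite mulr_ge0.
    have h1 := H (a + t * j%:R) (a + t * j.+1%:R).
    rewrite E in h1; have h2 := IH (ltnW jn).
    have {}h1 : cabs (F (a + t * j.+1%:R) - F (a + t * j%:R)) <= K * t ^+ 2.
      by apply: h1 => //; lra.
    rewrite [leRHS](_ : _ = K * t ^+ 2 + K * t ^+ 2 * j%:R); first exact: lerD.
    by rewrite -natr1; ring.
  have := ind n.+1 (leqnn _); rewrite tn addrCA subrr addr0 -/c => h.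
  have := ler_wpM2r (ltW n0) h.
  have -> : K * t ^+ 2 * n.+1%:R * n.+1%:R = K * (t * n.+1%:R) ^+ 2 by ring.
  by rewrite tn.
rewrite eq_le c0 andbT leNgt; apply/negP => cp.
pose N := (Num.truncn ((y - a) / delta) + Num.truncn (K * (y - a) ^+ 2 / c)).+1.
have N0 : (0 : R) < N.+1%:R by rewrite ltr0n.
have h1 : (y - a) / N.+1%:R <= delta.
  rewrite ler_pdivrMr// [leRHS]mulrC -ler_pdivrMr//.
  apply: (@le_trans _ _ (Num.truncn ((y - a) / delta)).+1%:R).
    by apply: ltW; exact: truncnS_gt.
  by rewrite ler_nat /N !ltnS (leq_trans (leq_addr _ _) (leqnSn _)).
have h2 : K * (y - a) ^+ 2 < c * N.+1%:R.
  rewrite [ltRHS]mulrC -ltr_pdivrMr//; apply: lt_le_trans (truncnS_gt _) _.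
  by rewrite ler_nat /N !ltnS (leq_trans (leq_addl _ _) (leqnSn _)).
by have := step N h1; rewrite leNgt h2.
Qed.

(** The integral is invariant under real translations, and the increments of f
    in the directions h and i h agree up to the factor i and an error quadratic
    in h. *)
Lemma cint_line_const m (f : m.-tuple RT -> C -> C) (B : m.-tuple RT -> R)
    (e1 e2 : R) :
  tame (rect e1 e2) f B -> (lebesgue_tuple R m).-integrable setT (EFin \o B) ->
  (forall z, cmeasurable (fun x => f x z)) ->
  (forall x s z, f (ttranslate s x) z = f x (z + s%:C)) ->
  forall y, e1 <= y <= e2 ->
  cint (lebesgue_tuple R m) (fun x => f x ('i * y%:C)) =
  cint (lebesgue_tuple R m) (fun x => f x ('i * e1%:C)).
Proof.
move=> [f' [c [[c1 B0] H1 _ H3]]] iB mf ft.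
set mu := lebesgue_tuple R m.
have c0 : 0 < c by lra.
have iZ (k : R) : mu.-integrable setT (EFin \o (fun x => k * B x)).
  rewrite (_ : _ \o _ = fun x => (k%:E * (B x)%:E)%E); last by apply/funext => x.
  exact: integrableZl.
have if' z : rect e1 e2 z -> cintegrable mu (fun x => f x z).
  by move=> Dz; apply: (@cintegrable_le _ _ _ _ _ (fun x => c * B x)) => // x; exact: H1.
set J := \int[mu]_x B x; have J0 : 0 <= J by rewrite Rintegral_ge0.
apply: (@quadratic_increments_const _ e1 e2 (4 * c * J) c^-1).
- by rewrite !mulr_ge0//; lra.
- by rewrite invr_gt0.
move=> y y' ey yy' ye hd; set h := y' - y in hd *.
have h0 : 0 <= h by rewrite subr_ge0.
have ch : c * h <= 1 by rewrite mulrC -ler_pdivlMr// div1r.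
have h1 : h <= 1 by nra.
have Ry (s t : R) : `|s| <= 1 -> e1 <= t <= e2 -> rect e1 e2 ('i * t%:C + s%:C).
  move=> s1 t12; split.
    by rewrite cReD Re_mulr /= mul0r add0r.
  by rewrite cImD Im_mulr /= mul1r addr0.
have D0 : rect e1 e2 ('i * y%:C).
  by have := @Ry 0 y; rewrite addr0; apply; [rewrite normr0|apply/andP; split; lra].
have D1 : rect e1 e2 ('i * y%:C + h%:C).
  by apply: Ry; [rewrite ger0_norm|apply/andP; split; lra].
have E2 : 'i * y'%:C = 'i * y%:C + 'i * h%:C :> C.
  by rewrite -mulrDr -rmorphD /h addrC subrK.
have D2 : rect e1 e2 ('i * y%:C + 'i * h%:C).
  rewrite -E2; have := @Ry 0 y'; rewrite addr0.
  by apply; [rewrite normr0|apply/andP; split; lra].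
have trans : cint mu (fun x => f x ('i * y%:C + h%:C)) =
    cint mu (fun x => f x ('i * y%:C)).
  rewrite (@cint_transfer _ _ R m mu _ (@measurable_ttranslate R m h)
    (@lebesgue_tuple_translation R m h) (fun x => f x ('i * y%:C)) (mf _)).
    by congr cint; apply/funext => x /=; rewrite ft.
  by rewrite /comp; under eq_fun do rewrite ft; exact: if'.
(* the vertical increment minus i times the horizontal one, which integrates to 0 *)
pose g x := f x ('i * y%:C + 'i * h%:C) + - 1 * f x ('i * y%:C) +
  (- 'i * f x ('i * y%:C + h%:C) + 'i * f x ('i * y%:C)).
have i0 := if' _ D0; have i1 := if' _ D1; have i2 := if' _ D2.
have gE : cint mu g = cint mu (fun x => f x ('i * y'%:C)) -
    cint mu (fun x => f x ('i * y%:C)).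
  rewrite /g !cintD ?cintZ//; try by repeat (apply: cintegrableD => //);
    exact: cintegrableZ.
  by rewrite trans E2; ring.
rewrite -gE.
have mg : cmeasurable g.
  by repeat (apply: cmeasurableD || apply: cmeasurableM) => //; exact: cmeasurable_cst.
have ch1 : cabs (h%:C) = h by rewrite cabs_real ger0_norm.
have ch2 : cabs ('i * h%:C) = h by rewrite cabsM cabs_i mul1r.
have gB x : cabs (g x) <= 2 * c * h ^+ 2 * B x.
  have k1 := H3 x _ h%:C D0 D1; have k2 := H3 x _ ('i * h%:C) D0 D2.
  rewrite ch1 in k1; rewrite ch2 in k2.
  have {}k1 := k1 ch; have {}k2 := k2 ch.
  rewrite (_ : g x = (f x ('i * y%:C + 'i * h%:C) - f x ('i * y%:C) -
       'i * h%:C * f' x ('i * y%:C)) - 'i * (f x ('i * y%:C + h%:C) -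
       f x ('i * y%:C) - h%:C * f' x ('i * y%:C))); last by rewrite /g; ring.
  by apply: le_trans (cabsB _ _) _; rewrite [cabs ('i * _)]cabsM cabs_i mul1r; lra.
apply: le_trans (cabs_cint_le mg gB (iZ _)) _.
by rewrite RintegralZl// -/J -mulrA -!mulrA; lra.
Qed.

End horizontal_lines.

(** * The integrals of the quantum polylogarithms *)

Section exponential_decay.
Variable R : realType.

Lemma integrable_expR_norm (eta : R) : 0 < eta ->
  (@lebesgue_measure R).-integrable setT
     (EFin \o (fun x : R => expR (- eta * `|x|))).
Proof.
move=> eta0; have cf : continuous (fun x : R => expR (- eta * `|x|)).
  move=> x; apply: continuous_comp; last exact: continuous_expR.
  by apply: continuousM; [exact: cst_continuous|exact: norm_continuous].
apply/integrableP; split.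
  by apply/measurable_EFinP; exact: continuous_measurable_fun.
under eq_integral do rewrite /= gtr0_norm ?expR_gt0//.
rewrite (@ge0_symfun_integralT _ (fun x : R => expR (- eta * `|x|)))//; last first.
  by move=> x /=; rewrite normrN.
rewrite (_ : [set x : R | _] = `[0, +oo[%classic); last first.
  by apply/seteqP; split => x/=; rewrite in_itv/= andbT.
have := integral_exponential_pdf eta0.
rewrite /exponential_pdf /= => E.
rewrite [X in (_ * X)%E](_ : _ = ((eta^-1)%:E * 1)%E) ?mule1 -?EFinM ?ltry//.
rewrite -[RHS]mule1 -E -ge0_integralZl//; last 3 first.
- apply/measurable_EFinP; exact: measurable_exponential_pdf.
- by move=> x _; rewrite lee_fin; apply: exponential_pdf_ge0; exact: ltW.
- by rewrite lee_fin invr_ge0 ltW.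
rewrite [LHS]integral_mkcond; apply: eq_integral => x _.
rewrite !patchE; case: ifPn => [|_]; last by rewrite mule0.
rewrite inE/= in_itv/= andbT => x0.
by rewrite -EFinM mulrA mulVf ?gt_eqF// mul1r ger0_norm.
Qed.

End exponential_decay.

Section integrand.
Variable R : realType.
Local Notation C := R[i].
Local Notation RT := (measurableTypeR R).

(** The integrand at p_j = x_j + z. All the variables share the displacement z,
    so moving the contour is a question in one complex variable. *)
Definition qintegrand (hbar : C) m (a b : 'rV[nat]_m) (n : 'rV[int]_m)
    (w : 'rV[C]_m) (x : m.-tuple RT) (z : C) : C :=
  \prod_(j < m) (Kfun hbar (a 0 j) (b 0 j) ((tnth x j)%:C + z) (w 0 j) /
     (\sum_(i < m | (i <= j)%N) ((tnth x i)%:C + z)) ^ (n 0 j)).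

Lemma qpolylog_epsE hbar m (a b : 'rV[nat]_m) n (w : 'rV[C]_m) eps :
  qpolylog_eps hbar a b n w eps =
  cint (lebesgue_tuple R m) (fun x => qintegrand hbar a b n w x ('i * eps%:C)).
Proof. by []. Qed.

Lemma cmeasurable_qintegrand hbar m (a b : 'rV[nat]_m) (n : 'I_m -> nat)
    (w : 'rV[C]_m) z :
  cmeasurable (fun x => qintegrand hbar a b (\row_j (n j)%:Z) w x z).
Proof.
have mp i : cmeasurable (fun x : m.-tuple RT => (tnth x i)%:C + z).
  apply: cmeasurableD; last exact: cmeasurable_cst.
  by apply: cmeasurable_real; exact: measurable_tnth.
have msh (c : C) i : cmeasurable (fun x : m.-tuple RT => sh (c * ((tnth x i)%:C + z))).
  have mc : cmeasurable (fun x : m.-tuple RT => c * ((tnth x i)%:C + z)).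
    by apply: cmeasurableM => //; exact: cmeasurable_cst.
  by apply: cmeasurableD; [|apply: cmeasurableN]; apply: cmeasurable_cexp => //;
    exact: cmeasurableN.
apply: cmeasurable_prod => j; rewrite mxE; apply: cmeasurableM.
  rewrite /Kfun; apply: cmeasurableM.
    apply: cmeasurable_cexp; apply: cmeasurableN; apply: cmeasurableM.
      by apply: cmeasurableM => //; exact: cmeasurable_cst.
    exact: cmeasurable_cst.
  by apply: cmeasurableV; apply: cmeasurableM; apply: cmeasurableX.
by apply: cmeasurableV; apply: cmeasurableX; exact: cmeasurable_sum.
Qed.

Lemma qintegrand_translate hbar m (a b : 'rV[nat]_m) n (w : 'rV[C]_m) x s z :
  qintegrand hbar a b n w (ttranslate s x) z =
  qintegrand hbar a b n w x (z + s%:C).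
Proof.
have E i : (tnth (ttranslate s x) i)%:C + z = (tnth x i)%:C + (z + s%:C).
  by rewrite tnth_mktuple rmorphD /=; ring.
by apply: eq_bigr => j _; rewrite E; under eq_bigr do rewrite E.
Qed.

(** The bounds on eps keep the zeros of both hyperbolic sines off the strip. *)
Definition small_height (hbar : C) (e : R) :=
  [/\ 0 < e, e * pi <= 2^-1 & e * pi * cabs hbar ^+ 2 <= complex.Re hbar / 2].

Lemma small_height_exists hbar : 0 < complex.Re hbar -> exists e, small_height hbar e.
Proof.
move=> h0; have p0 := pi_gt0 R.
have N0 : 0 < cabs hbar ^+ 2.
  rewrite exprn_gt0// lt_neqAle cabs_ge0 andbT eq_sym cabs_eq0.
  by apply/eqP => E; rewrite E ltxx in h0.
exists (Num.min (2^-1 / pi) (complex.Re hbar / 2 / (pi * cabs hbar ^+ 2))).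
split.
- by rewrite lt_min !divr_gt0// mulr_gt0.
- by rewrite -ler_pdivlMr// ge_min lexx.
- by rewrite -mulrA -(ler_pdivlMr _ _ (mulr_gt0 p0 N0)) ge_min lexx orbT.
Qed.

Lemma tame_qintegrand hbar m (a b : 'rV[nat]_m) (n : 'I_m -> nat)
    (w : 'rV[C]_m) (e1 e2 : R) :
  qpolylog_domain hbar a b w -> 0 < e1 -> small_height hbar e2 ->
  exists2 B, (lebesgue_tuple R m).-integrable setT (EFin \o B) &
    tame (rect e1 e2) (qintegrand hbar a b (\row_j (n j)%:Z) w) B.
Proof.
move=> [h0 Hw] e10 [e20 e2a e2b].
pose eta j := pi * ((a 0 j)%:R + (b 0 j)%:R * complex.Re hbar) - `|complex.Im (w 0 j)|.
have eta0 j : 0 < eta j by rewrite subr_gt0.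
exists (fun x : m.-tuple RT => \prod_(j < m) expR (- eta j * `|tnth x j|)).
  exact: (@integrable_tuple_prod R m (fun j r => expR (- eta j * `|r|))
    (fun j => integrable_expR_norm (eta0 j))).
apply: tame_prod => j.
have T1 := tame_comp (fun x : m.-tuple RT => (tnth x j : R))
  (tame_Kfun (w 0 j) (a 0 j) (b 0 j) h0 e10 e2a e2b).
pose N : nat := #|[pred i : 'I_m | (i <= j)%N]|.
have N1 : 1 <= N%:R :> R.
  by rewrite ler1n; apply/card_gt0P; exists j; rewrite inE.
have T2 := tameX (n j) (@tame_linV _ (rect e1 e2) _
  (fun x : m.-tuple RT => \sum_(i < m | (i <= j)%N) (tnth x i : R)) N%:R e1 e10 N1
  (fun z Dz => proj1 (andP Dz.2))).
apply: eq_tame (tame_le _ (tameM T1 T2)) => [x z|x].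
  rewrite mxE big_split /= sumr_const exprVn; congr (_ / _ ^+ _).
  by rewrite rmorph_sum rmorph_nat mulr_natl.
by rewrite expr1n mulr1.
Qed.

Lemma qintegrand_integrable hbar m (a b : 'rV[nat]_m) (n : 'I_m -> nat)
    (w : 'rV[C]_m) (e : R) :
  qpolylog_domain hbar a b w -> small_height hbar e ->
  cintegrable (lebesgue_tuple R m)
    (fun x => qintegrand hbar a b (\row_j (n j)%:Z) w x ('i * e%:C)).
Proof.
move=> Dw he; have e0 : 0 < e by case: he.
have [B iB [_ [c [_ H1 _ _]]]] := tame_qintegrand n Dw e0 he.
apply: (@cintegrable_le _ _ _ _ _ (fun x => c * B x)).
- exact: cmeasurable_qintegrand.
- move=> x; apply: H1; split; rewrite ?Re_mulr ?Im_mulr /=.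
    by rewrite mul0r normr0.
  by rewrite mul1r lexx.
- rewrite (_ : _ \o _ = fun x => (c%:E * (B x)%:E)%E); last by apply/funext => x.
  exact: integrableZl.
Qed.

(** By independence of the height, the limit as eps tends to 0 is that of a
    function that is constant for eps <= e. *)
Lemma qpolylog_cint hbar m (a b : 'rV[nat]_m) (n : 'I_m -> nat)
    (w : 'rV[C]_m) (e : R) :
  qpolylog_domain hbar a b w -> small_height hbar e ->
  qpolylog hbar a b (\row_j (n j)%:Z) w =
  'i ^ (\sum_(j < m) (n j)%:Z - m%:Z) * cint (lebesgue_tuple R m)
    (fun x => qintegrand hbar a b (\row_j (n j)%:Z) w x ('i * e%:C)).
Proof.
move=> Dw he; have e0 : 0 < e by case: he.
rewrite /qpolylog; under eq_bigr do rewrite mxE.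
congr (_ * _); apply: lim_near_cst; first exact: (@norm_hausdorff C C^o).
near=> y; rewrite qpolylog_epsE.
have y0 : 0 < y by near: y; exact: nbhs_right_gt.
have ye : y <= e by near: y; exact: nbhs_right_le.
have [B iB tB] := tame_qintegrand n Dw y0 he.
apply/esym/(cint_line_const tB iB) => [z|x s z|].
- exact: cmeasurable_qintegrand.
- exact: qintegrand_translate.
- by rewrite ye lexx.
Unshelve. all: by end_near.
Qed.

End integrand.

(** * The shuffle identity *)

Section shuffle_words.
Variable T : eqType.
Implicit Types (s t w : seq T) (P : pred T).

Fixpoint shuf s : seq T -> seq (seq T) :=
  fix shuf_s t := match s, t with
    | [::], _ => [:: t]
    | _, [::] => [:: s]
    | x :: s', y :: t' => [seq x :: w | w <- shuf s' t] ++
                          [seq y :: w | w <- shuf_s t']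
  end.

Lemma shufs0 s : shuf s [::] = [:: s]. Proof. by case: s. Qed.

Lemma shuf0s t : shuf [::] t = [:: t]. Proof. by case: t. Qed.

Lemma shuf_cons x s y t : shuf (x :: s) (y :: t) =
  [seq x :: w | w <- shuf s (y :: t)] ++ [seq y :: w | w <- shuf (x :: s) t].
Proof. by []. Qed.

Lemma shuf_ind (Q : seq T -> seq T -> Prop) :
  (forall t, Q [::] t) -> (forall s, Q s [::]) ->
  (forall x s y t, Q s (y :: t) -> Q (x :: s) t -> Q (x :: s) (y :: t)) ->
  forall s t, Q s t.
Proof.
move=> H0 H1 H2; elim=> [//|x s IHs]; elim=> [//|y t IHt]; exact: H2.
Qed.

Lemma perm_shuf s t w : w \in shuf s t -> perm_eq w (s ++ t).
Proof.
move: s t w; apply: shuf_ind => [t w|s w|x s y t IH1 IH2 w].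
- by rewrite shuf0s inE => /eqP->.
- by rewrite shufs0 inE cats0 => /eqP->.
rewrite shuf_cons mem_cat => /orP[] /mapP[v vin ->].
  by rewrite cat_cons perm_cons IH1.
rewrite (permPr (_ : perm_eq _ (y :: (x :: s) ++ t))) ?perm_cons ?IH2//.
by rewrite -(cat1s y t) -(cat1s y (_ ++ t)) perm_catCA.
Qed.

Lemma mem_shuf_cons z v s t : (z :: v \in shuf s t) =
  (if s is x :: s' then (z == x) && (v \in shuf s' t) else false) ||
  (if t is y :: t' then (z == y) && (v \in shuf s t') else false).
Proof.
case: s t => [|x s] [|y t] //.
- by rewrite !shuf0s !inE eqseq_cons.
- by rewrite !shufs0 !inE eqseq_cons orbF.
rewrite shuf_cons mem_cat; congr (_ || _).
  apply/mapP/andP => [[u uin [-> ->]]|[/eqP-> vin]]; first by rewrite eqxx.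
  by exists v.
apply/mapP/andP => [[u uin [-> ->]]|[/eqP-> vin]]; first by rewrite eqxx.
by exists v.
Qed.

(** For words in disjoint alphabets, P telling them apart, the shuffles are the
    words whose two subwords are the given ones. *)
Lemma mem_shuf P s t w : all P s -> all (predC P) t ->
  (w \in shuf s t) = (seq.filter P w == s) && (seq.filter (predC P) w == t).
Proof.
elim: w s t => [|z v IH] s t Ps Pt.
  case: s t {Ps Pt} => [|x s] [|y t] //; rewrite ?shufs0// shuf_cons mem_cat.
  by apply/negbTE; rewrite negb_or; apply/andP; split; apply/mapP => -[].
rewrite mem_shuf_cons /=; have [Pz|Pz] /= := boolP (P z).
  rewrite [X in _ || X](_ : _ = false) ?orbF; last first.
    by case: t Pt => //= y t /andP[Py _]; case: eqP => // E; rewrite -E Pz in Py.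
  case: s Ps => //= x s /andP[_ Ps]; rewrite eqseq_cons -andbA; congr (_ && _).
  exact: IH.
rewrite [X in X || _](_ : _ = false); last first.
  by case: s Ps => //= x s /andP[Px _]; case: eqP => // E; rewrite -E (negPf Pz) in Px.
case: t Pt => [|y t] /=; first by rewrite andbF.
move=> /andP[_ Pt]; rewrite eqseq_cons andbCA; congr (_ && _); exact: IH.
Qed.

Lemma uniq_shuf P s t : all P s -> all (predC P) t -> uniq (shuf s t).
Proof.
move: s t; apply: shuf_ind => [t|s|x s y t IH1 IH2]; rewrite ?shuf0s ?shufs0//.
move=> /= /andP[Px Ps] /andP[Py Pt].
rewrite cat_uniq !map_inj_uniq; try by move=> ? ? [].
rewrite IH1 ?IH2 /= ?Px ?Py ?Ps ?Pt// andbT.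
apply/hasPn => _ /mapP[v _ ->]; apply/mapP => -[u _ [E _]].
by rewrite -E (negPf Py) in Px.
Qed.

Lemma pairwise_filterE P (r : rel T) w :
  pairwise r (seq.filter P w) = pairwise (fun x y => P x && P y ==> r x y) w.
Proof.
elim: w => //= x w IH; case: (boolP (P x)) => Px /=.
  by rewrite IH all_filter; congr (_ && _); apply: eq_all => y /=; case: (P y).
by rewrite all_predT.
Qed.

End shuffle_words.

Section shuffle_identity.
Variables (T : eqType) (K : comNzRingType) (I : K -> Prop).
Hypotheses (I0 : I 0) (ID : forall x y, I x -> I y -> I (x + y))
           (IM : forall x y, I y -> I (x * y)).
Variables (q : T -> K) (r : seq T -> K).
Hypothesis r_perm : forall s t, perm_eq s t -> r s = r t.
Hypothesis rV : forall s, s != [::] -> I ((\sum_(x <- s) q x) * r s - 1).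

(** With r s the inverse of the sum of the letters of s, the product over the
    suffixes of s of the inverses of their sums. *)
Fixpoint suffix_prod s := if s is x :: s' then r s * suffix_prod s' else 1.

(** The classical shuffle identity for products of inverses of partial sums,
    modulo an ideal. Multiplying by the total sum Q(s) + Q(t) turns a product
    for (s, t) into the sum of the products in which the first letter of s,
    respectively of t, has been removed. *)
Lemma shuffle_prod s t :
  I (suffix_prod s * suffix_prod t - \sum_(w <- shuf s t) suffix_prod w).
Proof.
move: s t; apply: shuf_ind => [t|s|x s y t IH1 IH2].
- by rewrite shuf0s big_seq1 mul1r subrr.
- by rewrite shufs0 big_seq1 mulr1 subrr.
set rho := r ((x :: s) ++ y :: t).
have E1 : \sum_(w <- shuf s (y :: t)) suffix_prod (x :: w) =
    rho * \sum_(w <- shuf s (y :: t)) suffix_prod w.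
  rewrite mulr_sumr; apply: eq_big_seq => w /perm_shuf wp /=.
  by congr (_ * _); apply: r_perm; rewrite /= perm_cons.
have E2 : \sum_(w <- shuf (x :: s) t) suffix_prod (y :: w) =
    rho * \sum_(w <- shuf (x :: s) t) suffix_prod w.
  rewrite mulr_sumr; apply: eq_big_seq => w /perm_shuf wp /=.
  congr (_ * _); apply: r_perm.
  by rewrite -(cat1s y t) perm_sym perm_catCA /= perm_cons perm_sym.
rewrite shuf_cons big_cat !big_map E1 E2 /=.
set S1 := \sum_(w <- shuf s _) _ in IH1 *.
set S2 := \sum_(w <- shuf (x :: s) _) _ in IH2 *.
set Qs := \sum_(z <- x :: s) q z; set Qt := \sum_(z <- y :: t) q z.
have h1 : I (Qs * r (x :: s) - 1) by exact: rV.
have h2 : I (Qt * r (y :: t) - 1) by exact: rV.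
have h3 : I ((Qs + Qt) * rho - 1) by rewrite -big_cat; exact: rV.
rewrite [suffix_prod (x :: s)]/= [suffix_prod (y :: t)]/= in IH1 IH2 *.
set A := suffix_prod s in IH1 IH2 *; set B := suffix_prod t in IH1 IH2 *.
set a := r (x :: s) in h1 IH1 IH2 *; set b := r (y :: t) in h2 IH1 IH2 *.
(* every bracket below lies in the ideal *)
rewrite (_ : _ - _ = rho * (A * (b * B) - S1) + rho * (a * A * B - S2) +
   (- (a * A * (b * B)) * ((Qs + Qt) * rho - 1) +
   (rho * A * b * B * (Qs * a - 1) + rho * a * A * B * (Qt * b - 1)))); last by ring.
by repeat apply: ID; apply: IM.
Qed.

End shuffle_identity.

(** * Permutations and words *)

Section shuffle_permutations.
Variables k l : nat.

Lemma shufflesP (s : 'S_(k + l)) : (s \in shuffles k l) =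
  pairwise (fun x y : 'I_(k + l) => ((x < k)%N == (y < k)%N) ==> (x < y)%N)
    (codom s).
Proof.
rewrite inE /codom /image_mem pairwise_map; apply/idP/idP.
  move=> /forallP H; apply: (@sub_in_pairwise _ predT
      (fun i j : 'I_(k + l) => (i < j)%N)).
  - by move=> i j _ _ /= ij; have /forallP/(_ j) := H i; rewrite ij.
  - by rewrite all_predT.
  have := iota_ltn_sorted 0 (k + l); rewrite sorted_pairwise; last exact: ltn_trans.
  by rewrite -val_enum_ord pairwise_map.
move=> H; apply/forallP => i; apply/forallP => j; apply/implyP => /andP[ij e].
move: H => /(pairwiseP i)/(_ i j).
rewrite !inE size_enum_ord !ltn_ord !nth_ord_enum /= e /=.
by apply.
Qed.

Let W1 := codom (@lshift k l).
Let W2 := codom (@rshift k l).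
Let P (x : 'I_(k + l)) := (x < k)%N.

(** A permutation s is recorded as the word s_m ... s_1, so that the first
    letters of the word s are the suffixes of its record. *)
Lemma perm_shuffles_words :
  perm_eq [seq rev (codom s) | s : 'S_(k + l) <- enum (shuffles k l)]
          (shuf (rev W1) (rev W2)).
Proof.
have PW1 : all P W1 by apply/allP => _ /codomP[i ->]; rewrite /P /= ltn_ord.
have PW2 : all (predC P) W2.
  by apply/allP => _ /codomP[i ->]; rewrite /P /= -leqNgt leq_addr.
have pW n (f : 'I_n -> 'I_(k + l)) : (forall i j, (f i < f j)%N = (i < j)%N) ->
    pairwise (fun x y : 'I_(k + l) => (x < y)%N) (codom f).
  move=> fm; rewrite /codom /image_mem pairwise_map.
  apply: (@sub_pairwise _ (fun i j : 'I_n => (i < j)%N)) => [i j|].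
    by rewrite /= fm.
  have := iota_ltn_sorted 0 n; rewrite sorted_pairwise; last exact: ltn_trans.
  by rewrite -val_enum_ord pairwise_map.
have pW1 : pairwise (fun x y : 'I_(k + l) => (x < y)%N) W1 by exact: pW.
have pW2 : pairwise (fun x y : 'I_(k + l) => (x < y)%N) W2.
  by apply: pW => i j /=; rewrite ltn_add2l.
have seq_eq (u v : seq 'I_(k + l)) :
    pairwise (fun x y : 'I_(k + l) => (x < y)%N) u ->
    pairwise (fun x y : 'I_(k + l) => (x < y)%N) v -> u =i v -> u = v.
  move=> pu pv; apply: (@irr_sorted_eq _ (fun x y : 'I_(k + l) => (x < y)%N)).
  - by move=> y x z; exact: ltn_trans.
  - by move=> x; rewrite ltnn.
  - exact: pairwise_sorted.
  - exact: pairwise_sorted.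
have memW1 x : (x \in W1) = P x.
  apply/codomP/idP => [[i ->]|Px]; first by rewrite /P /= ltn_ord.
  by exists (Ordinal Px); exact: val_inj.
have memW2 x : (x \in W2) = ~~ P x.
  apply/codomP/idP => [[i ->]|]; first by rewrite /P /= -leqNgt leq_addr.
  rewrite /P -leqNgt => kx; have xk : (x - k < l)%N by rewrite ltn_subLR.
  by exists (Ordinal xk); apply: val_inj; rewrite /= subnKC.
have inj : injective (fun s : 'S_(k + l) => rev (codom s)).
  move=> s t /(can_inj revK) /eq_in_map E; apply/permP => i.
  by apply: E; rewrite mem_enum.
apply: uniq_perm.
- by rewrite map_inj_uniq ?enum_uniq.
- by apply: (@uniq_shuf _ P); rewrite all_rev.
move=> w; rewrite (@mem_shuf _ P) ?all_rev// -(revK w).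
move: (rev w) => {}w; rewrite !filter_rev !(inj_eq (can_inj (@revK _))).
rewrite (_ : [seq _ | s <- _] = map rev (map (fun s : 'S_(k + l) => codom s)
  (enum (shuffles k l)))); last by rewrite -map_comp.
rewrite (mem_map (can_inj (@revK _))).
apply/mapP/andP.
  move=> [s]; rewrite mem_enum shufflesP => sP ->.
  have wP : pairwise (fun x y : 'I_(k + l) => P x && P y ==> (x < y)%N) (codom s) /\
      pairwise (fun x y : 'I_(k + l) => ~~ P x && ~~ P y ==> (x < y)%N) (codom s).
    by split; apply: sub_pairwise sP => x y; rewrite -!/(P _);
      case: (P x); case: (P y).
  have ms x : x \in codom s by rewrite -(permKV s x) codom_f.
  split; apply/eqP/seq_eq => //.
  - by rewrite pairwise_filterE wP.1.
  - by move=> x; rewrite mem_filter ms andbT memW1.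
  - by rewrite pairwise_filterE; apply: wP.2.
  - by move=> x; rewrite mem_filter ms andbT memW2.
move=> [/eqP w1 /eqP w2].
have uw : perm_eq w (enum 'I_(k + l)).
  rewrite -(perm_filterC P w) w1 w2; apply: uniq_perm.
  - rewrite cat_uniq [uniq W1](map_inj_uniq (@lshift_inj k l)) enum_uniq.
    rewrite [uniq W2](map_inj_uniq (@rshift_inj k l)) enum_uniq andbT /=.
    by apply/hasPn => x; rewrite memW2 memW1.
  - exact: enum_uniq.
  - by move=> x; rewrite mem_cat memW1 memW2 mem_enum orbN.
have sw : size w = (k + l)%N by rewrite (perm_size uw) size_enum_ord.
have uqw : uniq w by rewrite (perm_uniq uw) enum_uniq.
pose t : (k + l).-tuple 'I_(k + l) := tcast sw (in_tuple w).
have tE : tval t = w by rewrite val_tcast.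
have tinj : injective (tnth t).
  by apply/tuple_uniqP; rewrite tE.
have cT : codom (perm tinj) = w.
  rewrite -tE -[RHS](map_tnth_enum t); apply: eq_codom => i; exact: permE.
exists (perm tinj); last by rewrite cT.
rewrite mem_enum shufflesP cT.
have h1 : pairwise (fun x y : 'I_(k + l) => (x < y)%N) (seq.filter P w) by rewrite w1.
have h2 : pairwise (fun x y : 'I_(k + l) => (x < y)%N) (seq.filter (predC P) w).
  by rewrite w2.
rewrite pairwise_filterE in h1; rewrite pairwise_filterE in h2.
have : pairwise (fun x y : 'I_(k + l) => (P x && P y ==> (x < y)%N) &&
   (~~ P x && ~~ P y ==> (x < y)%N)) w by rewrite (pairwise_relI _ _ w) h1 h2.
apply: sub_pairwise => x y /=; rewrite -!/(P _).
by case: (P x); case: (P y) => //= /andP[].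
Qed.

End shuffle_permutations.

(** * Substitution and geometric series modulo high degree *)

Section order_of_vanishing.
Variables (A : comNzRingType) (N : nat).
Implicit Types (p q L : mpoly N A).

Definition ord_ge n p := forall alpha, (mdeg alpha < n)%N -> mcoeff alpha p = 0.

Lemma ord_ge0 p : ord_ge 0 p. Proof. by []. Qed.

Lemma ord_geD n p q : ord_ge n p -> ord_ge n q -> ord_ge n (p + q).
Proof. by move=> hp hq alpha h; rewrite mcoeffD hp ?hq ?addr0. Qed.

Lemma ord_geM a b p q : ord_ge a p -> ord_ge b q -> ord_ge (a + b) (p * q).
Proof.
move=> hp hq alpha h; rewrite mcoeffM big1// => -[u v] /= /eqP E.
have [ua|ua] := ltnP (mdeg u) a; first by rewrite hp ?mul0r.
rewrite hq ?mulr0//; have {}E : mdeg alpha = (mdeg u + mdeg v)%N.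
  by rewrite [in LHS]E mdegD.
by rewrite -(ltn_add2l (mdeg u)) -E; apply: leq_trans h _; rewrite leq_add2r.
Qed.

Lemma ord_ge_prod m (n : 'I_m -> nat) (p : 'I_m -> mpoly N A) :
  (forall j, ord_ge (n j) (p j)) -> ord_ge (\sum_j n j) (\prod_j p j).
Proof.
move=> H; elim/big_ind2: _ => // a p' b q' ha hb; exact: ord_geM.
Qed.

Lemma ord_geX n p : ord_ge 1 p -> ord_ge n (p ^+ n).
Proof.
move=> H; elim: n => [|n IH]; first exact: ord_ge0.
by rewrite exprS -add1n; exact: ord_geM.
Qed.

Lemma ord_ge_sumX (I : Type) (r : seq I) (P : pred I) (t : I -> 'I_N) :
  ord_ge 1 (\sum_(i <- r | P i) mpolyX A (mnm1 (t i))).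
Proof.
apply: (big_ind (ord_ge 1)) => [alpha _|p q|i _ alpha].
- by rewrite mcoeff0.
- exact: ord_geD.
- by rewrite mcoeffX => h; case: eqP => // E; rewrite -E mdeg1 in h.
Qed.

Definition mnm_of_ffun m D (f : {ffun 'I_m -> 'I_D.+1}) : multinom m :=
  Multinom [tuple (f i : nat) | i < m].

Lemma mnm_of_ffunE m D (f : {ffun 'I_m -> 'I_D.+1}) i :
  mnm_of_ffun f i = f i.
Proof. by rewrite /fun_of_multinom tnth_mktuple. Qed.

Lemma leq_mnm_mdeg m (b : multinom m) i : (b i <= mdeg b)%N.
Proof. by rewrite mdegE (bigD1 i)//= leq_addr. Qed.

(** Coefficients of product form turn the substitution into a product of
    substitutions into series of one variable. Terms of degree above that of
    alpha in the L j do not contribute, as the L j have no constant term. *)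
Lemma fps_subst_prod m (c : 'I_m -> nat -> A) (L : 'I_m -> mpoly N A) alpha D :
  (mdeg alpha <= D)%N -> (forall j, ord_ge 1 (L j)) ->
  fps_subst (fun beta : multinom m => \prod_j c j (beta j)) L alpha =
  mcoeff alpha (\prod_j \sum_(n < D.+1) mpolyC N (c j n) * L j ^+ n).
Proof.
move=> aD hL; rewrite bigA_distr_bigA /= raddf_sum /=.
pose G (beta : multinom m) := (\prod_j c j (beta j)) *
  mcoeff alpha (\prod_(j < m) L j ^+ beta j).
rewrite [RHS](eq_bigr (fun f => G (mnm_of_ffun f))); last first.
  move=> f _; rewrite big_split /= -rmorph_prod mcoeffCM /G.
  rewrite -[RHS]/(_ * _); congr (_ * _); [|congr (mcoeff alpha _)];
    by apply: eq_bigr => j _; rewrite mnm_of_ffunE.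
rewrite (bigID (fun f => (mdeg (mnm_of_ffun f) < (mdeg alpha).+1)%N)) /=.
rewrite [X in _ = _ + X]big1 ?addr0; last first.
  move=> f; rewrite -leqNgt => hf; rewrite /G.
  rewrite (_ : mcoeff _ _ = 0) ?mulr0//.
  have := @ord_ge_prod m (mnm_of_ffun f) (fun j => L j ^+ mnm_of_ffun f j)
    (fun j => @ord_geX _ _ (hL j)); apply.
  by rewrite -mdegE.
pose h (beta : bmultinom m (mdeg alpha).+1) : {ffun 'I_m -> 'I_D.+1} :=
  [ffun i => inord ((beta : multinom m) i)].
pose h' (f : {ffun 'I_m -> 'I_D.+1}) : bmultinom m (mdeg alpha).+1 :=
  insubd (@bm0 m (mdeg alpha)) (mnm_of_ffun f).
have hE (beta : bmultinom m (mdeg alpha).+1) : mnm_of_ffun (h beta) = beta.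
  apply/mnmP => i; rewrite mnm_of_ffunE ffunE inordK// ltnS.
  apply: leq_trans aD; rewrite -ltnS; apply: leq_ltn_trans (bmdeg beta).
  exact: leq_mnm_mdeg.
rewrite (reindex_onto h h') => [|f hf]; last first.
  by apply/ffunP => i; rewrite ffunE /h' val_insubd hf mnm_of_ffunE inord_val.
apply: eq_big => [beta|beta _]; last by rewrite hE.
rewrite hE bmdeg /=; apply/esym/eqP/val_inj.
by rewrite /h' val_insubd hE bmdeg.
Qed.

End order_of_vanishing.

Section geometric_series.
Variables (F : fieldType) (N : nat) (iota : F).

(** The terms of order at most D in L of the expansion of 1 / (P - iota L). *)
Definition geom D (P : F) (L : mpoly N F) : mpoly N F :=
  \sum_(n < D.+1) mpolyC N (iota ^+ n / P ^+ n.+1) * L ^+ n.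

(** With u = (iota / P) L, the left hand side is - u ^ (D + 1). *)
Lemma geomV D P L : P != 0 -> ord_ge 1 L ->
  ord_ge D.+1 ((mpolyC N P - mpolyC N iota * L) * geom D P L - 1).
Proof.
move=> P0 hL; set u := mpolyC N (iota / P) * L.
have hu : ord_ge 1 u by rewrite -[1%N]add0n; apply: ord_geM.
have E1 : geom D P L = mpolyC N P^-1 * \sum_(n < D.+1) u ^+ n.
  rewrite mulr_sumr; apply: eq_bigr => n _.
  rewrite /u exprMn -rmorphXn mulrA -rmorphM; congr (mpolyC N _ * _).
  by rewrite expr_div_n exprS invfM; ring.
have E2 : mpolyC N P - mpolyC N iota * L = - (mpolyC N P * (u - 1)).
  rewrite /u mulrBr mulr1 mulrA -rmorphM mulrCA divff// mulr1; ring.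
have -> : (mpolyC N P - mpolyC N iota * L) * geom D P L - 1 = (- 1) * u ^+ D.+1.
  have PP : mpolyC N P * mpolyC N P^-1 = 1 by rewrite -rmorphM divff.
  have S : u ^+ D.+1 - 1 = (u - 1) * \sum_(n < D.+1) u ^+ n by exact: subrX1.
  rewrite E1 E2 [X in X - 1](_ : _ = - (mpolyC N P * mpolyC N P^-1) *
    ((u - 1) * \sum_(n < D.+1) u ^+ n)); last by ring.
  by rewrite -S PP; ring.
by rewrite -[D.+1]add0n; apply: ord_geM => //; exact: ord_geX.
Qed.

Variable p : 'I_N -> F.
Let X x : mpoly N F := mpolyX F (mnm1 x).
Let r D s := geom D (\sum_(x <- s) p x) (\sum_(x <- s) X x).

(** The suffixes of a reversed word are the reversed prefixes of the word. *)
Lemma suffix_prod_codom D m (f : 'I_m -> 'I_N) :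
  suffix_prod (r D) (rev (codom f)) =
  \prod_(j < m) geom D (\sum_(i < m | (i <= j)%N) p (f i))
                       (\sum_(i < m | (i <= j)%N) X (f i)).
Proof.
elim: m f => [|m IH] f.
  by rewrite big_ord0 /codom /image_mem enum_ord0.
have cE : codom f = rcons (codom (fun i => f (widen_ord (leqnSn m) i))) (f ord_max).
  by rewrite /codom /image_mem enum_ordSr map_rcons -map_comp.
rewrite cE rev_rcons /= IH big_ord_recr mulrC /=; congr (_ * _).
  apply: eq_bigr => j _; congr (geom D _ _).
    by rewrite [RHS]big_mkcond big_ord_recr /= leqNgt ltn_ord addr0 -big_mkcond.
  by rewrite [RHS]big_mkcond big_ord_recr /= leqNgt ltn_ord addr0 -big_mkcond.
have sE (V : nmodType) (G : 'I_N -> V) :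
    \sum_(x <- f ord_max :: rev (codom (fun i => f (widen_ord (leqnSn m) i)))) G x
    = \sum_(i < m.+1 | (i <= m)%N) G (f i).
  rewrite -rev_rcons -cE (perm_big _ (permEl (perm_rev _))) /=.
  rewrite big_image /=; apply: eq_bigl => i; by rewrite -ltnS ltn_ord.
by rewrite /r !sE.
Qed.

End geometric_series.

Section pointwise_shuffle.
Variables (F : fieldType) (iota : F) (k l : nat) (p : 'I_(k + l) -> F).
Hypothesis p_neq0 : forall s, s != [::] -> \sum_(x <- s) p x != 0.
Let X x : mpoly (k + l) F := mpolyX F (mnm1 x).

Lemma shuffle_geom D alpha : (mdeg alpha <= D)%N ->
  mcoeff alpha (
    (\prod_(j < k) geom iota D (\sum_(i < k | (i <= j)%N) p (lshift l i))
                               (\sum_(i < k | (i <= j)%N) X (lshift l i))) *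
    (\prod_(j < l) geom iota D (\sum_(i < l | (i <= j)%N) p (rshift k i))
                               (\sum_(i < l | (i <= j)%N) X (rshift k i)))) =
  \sum_(s in shuffles k l) mcoeff alpha (
    \prod_(j < k + l) geom iota D (\sum_(i < k + l | (i <= j)%N) p (s i))
                                  (\sum_(i < k + l | (i <= j)%N) X (s i))).
Proof.
move=> aD.
pose q x := mpolyC (k + l) (p x) - mpolyC (k + l) iota * X x.
pose r s := geom iota D (\sum_(x <- s) p x) (\sum_(x <- s) X x).
have I0 : ord_ge D.+1 (0 : mpoly (k + l) F) by move=> a _; rewrite mcoeff0.
have IM (x y : mpoly (k + l) F) : ord_ge D.+1 y -> ord_ge D.+1 (x * y).
  by rewrite -[D.+1]add0n; apply: ord_geM.
have rp s t : perm_eq s t -> r s = r t.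
  by move=> st; rewrite /r !(perm_big _ st).
have rV s : s != [::] -> ord_ge D.+1 ((\sum_(x <- s) q x) * r s - 1).
  move=> s0; rewrite big_split /= -rmorph_sum sumrN -mulr_sumr.
  by apply: geomV; [exact: p_neq0|exact: ord_ge_sumX].
have := shuffle_prod I0 (@ord_geD _ _ D.+1) IM rp rV
  (rev (codom (@lshift k l))) (rev (codom (@rshift k l))) alpha aD.
rewrite mcoeffB => /subr0_eq.
rewrite !suffix_prod_codom => ->.
rewrite -(perm_big _ (perm_shuffles_words k l)) /= big_map raddf_sum /=.
rewrite big_enum /=; apply: eq_bigr => s _; by rewrite suffix_prod_codom.
Qed.

End pointwise_shuffle.

(** * The formula in the domain of convergence *)

Section generating_series.
Variable R : realType.
Local Notation C := R[i].
Local Notation RT := (measurableTypeR R).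

Lemma cintegrable_cmeasurable d (T : measurableType d)
    (mu : {measure set T -> \bar R}) (f : T -> C) :
  cintegrable mu f -> cmeasurable f.
Proof.
by move=> [/measurable_int/measurable_EFinP f1 /measurable_int/measurable_EFinP f2].
Qed.

Lemma cmeasurable_comp d1 d2 (T1 : measurableType d1) (T2 : measurableType d2)
    (f : T2 -> C) (phi : T1 -> T2) :
  measurable_fun setT phi -> cmeasurable f -> cmeasurable (f \o phi).
Proof.
move=> mphi [f1 f2]; split.
  exact: (measurableT_comp f1 mphi).
exact: (measurableT_comp f2 mphi).
Qed.

Section integrand_series.
Variables (hbar : C) (m : nat) (a b : 'rV[nat]_m) (w : 'rV[C]_m) (e : R).

Definition contour (x : m.-tuple RT) (i : 'I_m) : C := (tnth x i : R)%:C + 'i * e%:C.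

Definition qkernel (x : m.-tuple RT) : C :=
  \prod_(j < m) Kfun hbar (a 0 j) (b 0 j) (contour x j) (w 0 j).

(** The coefficient at alpha of the integrand of the generating series: the
    kernels times the product of the series 1 / (P_j - i L_j). *)
Definition series_integrand N (t : 'rV['I_N]_m) D alpha (x : m.-tuple RT) : C :=
  qkernel x * mcoeff alpha (\prod_(j < m)
    geom 'i D (\sum_(i < m | (i <= j)%N) contour x i)
      (\sum_(i < m | (i <= j)%N) mpolyX C (mnm1 (t 0 i)))).

Hypotheses (Dw : qpolylog_domain hbar a b w) (he : small_height hbar e).

(** For n_j = beta_j + 1 the prefactor i^(|n| - m) is the product of the
    i^beta_j, which go into the factors of the integrand. *)
Lemma qpolylog_series_cint (beta : multinom m) :
  let f x := qkernel x * \prod_(j < m)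
    ('i ^+ beta j / (\sum_(i < m | (i <= j)%N) contour x i) ^+ (beta j).+1) in
  cintegrable (lebesgue_tuple R m) f /\
  qpolylog_series hbar a b w beta = cint (lebesgue_tuple R m) f.
Proof.
move=> f.
have fE : f = fun x => 'i ^+ mdeg beta *
    qintegrand hbar a b (\row_j (beta j).+1%:Z) w x ('i * e%:C).
  apply/funext => x; rewrite /f /qkernel /qintegrand !big_split /= mdegE.
  rewrite -expr_sum mulrCA; congr (_ * (_ * _)).
  by apply: eq_bigr => j _; rewrite mxE.
have int := qintegrand_integrable (fun j => (beta j).+1) Dw he.
rewrite fE; split; first exact: cintegrableZ.
rewrite cintZ// /qpolylog_series (qpolylog_cint (fun j => (beta j).+1) Dw he).
congr (_ * _); rewrite (_ : _ - _ = (mdeg beta)%:Z)//.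
rewrite mdegE (eq_bigr (fun j => (beta j)%:Z + 1)) => [|j _]; last by rewrite -addn1 PoszD.
by rewrite big_split /= sumr_const card_ord natz addrK (big_morph Posz PoszD (erefl _)).
Qed.

Lemma fps_star_cint N (t : 'rV['I_N]_m) D alpha : (mdeg alpha <= D)%N ->
  cintegrable (lebesgue_tuple R m) (series_integrand t D alpha) /\
  fps_star (qpolylog_series hbar a b w) t alpha =
  cint (lebesgue_tuple R m) (series_integrand t D alpha).
Proof.
move=> aD; pose L j := \sum_(i < m | (i <= j)%N) mpolyX C (mnm1 (t 0 i)).
pose c x (beta : bmultinom m (mdeg alpha).+1) :=
  mcoeff alpha (\prod_(j < m) L j ^+ (beta : multinom m) j) *
  (qkernel x * \prod_(j < m) ('i ^+ (beta : multinom m) j /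
     (\sum_(i < m | (i <= j)%N) contour x i) ^+ ((beta : multinom m) j).+1)).
have fE : series_integrand t D alpha = fun x => \sum_beta c x beta.
  apply/funext => x; rewrite /series_integrand.
  have := @fps_subst_prod _ N m (fun j n => 'i ^+ n /
    (\sum_(i < m | (i <= j)%N) contour x i) ^+ n.+1) L alpha D aD
    (fun j => @ord_ge_sumX _ _ _ _ _ _).
  move=> <-; rewrite /fps_subst mulr_sumr; apply: eq_bigr => beta _.
  by rewrite mulrA mulrC.
have ic beta : cintegrable (lebesgue_tuple R m) (fun x => c x beta).
  by apply: cintegrableZ; exact: (qpolylog_series_cint beta).1.
rewrite fE; split; first exact: cintegrable_sum.
rewrite cint_sum//; apply: eq_bigr => beta _.
have [i1 E1] := qpolylog_series_cint beta.
by rewrite E1 mulrC -cintZ.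
Qed.

End integrand_series.

Lemma contour_sum_neq0 m (e : R) (x : m.-tuple RT) (s : seq 'I_m) :
  0 < e -> s != [::] -> \sum_(i <- s) contour e x i != 0.
Proof.
move=> e0 s0; apply/eqP => /(congr1 (@complex.Im R)) /=.
have -> : complex.Im (\sum_(i <- s) contour e x i) = (size s)%:R * e.
  elim: s {s0} => [|y s IH]; first by rewrite big_nil mul0r.
  rewrite big_cons cImD IH /contour cImD Im_mulr /= -natr1; ring.
by move/eqP; rewrite mulf_eq0 pnatr_eq0 size_eq0 (negPf s0) gt_eqF.
Qed.

(** By Fubini the left hand side is an integral over R^(k + l), the shuffle
    identity expands its integrand, and the variables are renamed in each
    term. *)
Lemma fps_star_shuffle k l (a b : 'rV[nat]_k) (a' b' : 'rV[nat]_l) (hbar : C)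
    (w : 'rV[C]_k) (w' : 'rV[C]_l) :
  let t : 'rV['I_(k + l)]_k := \row_i lshift l i in
  let t' : 'rV['I_(k + l)]_l := \row_j rshift k j in
  qpolylog_domain hbar a b w -> qpolylog_domain hbar a' b' w' ->
  fps_mul (fps_star (qpolylog_series hbar a b w) t)
          (fps_star (qpolylog_series hbar a' b' w') t')
  = \sum_(s in shuffles k l)
      fps_star (qpolylog_series hbar (col_perm s (row_mx a a'))
                  (col_perm s (row_mx b b')) (col_perm s (row_mx w w')))
               (col_perm s (row_mx t t')).
Proof.
move=> t t' Dw Dw'; have h0 : 0 < complex.Re hbar by case: Dw.
have [e he] := small_height_exists h0.
have e0 : 0 < e by case: he.
have Ds (s : 'S_(k + l)) : qpolylog_domain hbar (col_perm s (row_mx a a'))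
    (col_perm s (row_mx b b')) (col_perm s (row_mx w w')).
  split=> // j; rewrite !mxE; case: fintype.splitP => i _.
    exact: Dw.2.
  exact: Dw'.2.
apply/funext => alpha; set D := mdeg alpha.
pose H (s : 'S_(k + l)) := series_integrand hbar (col_perm s (row_mx a a'))
    (col_perm s (row_mx b b')) (col_perm s (row_mx w w')) e
    (col_perm s (row_mx t t')) D alpha.
have iH s : cintegrable (lebesgue_tuple R (k + l)) (H s).
  by have [] := fps_star_cint (Ds s) he (col_perm s (row_mx t t')) (leqnn D).
have iHp s : cintegrable (lebesgue_tuple R (k + l)) (H s \o @tpermute R (k + l) s).
  have mH := cintegrable_cmeasurable (iH s).
  apply: (cintegrable_transfer (@measurable_tpermute R (k + l) (s^-1)%g)
    (@lebesgue_tuple_permutation R (k + l) (s^-1)%g)).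
    by apply: cmeasurable_comp => //; exact: measurable_tpermute.
  have E : (H s \o @tpermute R (k + l) s) \o @tpermute R (k + l) (s^-1)%g = H s.
    apply/funext => x; rewrite /comp; congr (H s _).
    by apply: eq_from_tnth => i; rewrite !tnth_mktuple permK.
  rewrite E; exact: iH.
pose F x := \sum_(s in shuffles k l) H s (tpermute s x).
have iF : cintegrable (lebesgue_tuple R (k + l)) F.
  by apply: cintegrable_sum => s _; exact: iHp.
transitivity (cint (lebesgue_tuple R (k + l)) F); last first.
  rewrite cint_sum => [|s _]; last exact: iHp.
  rewrite (_ : (\sum_(s in shuffles k l) _) alpha =
    \sum_(s in shuffles k l) fps_star (qpolylog_series hbar
      (col_perm s (row_mx a a')) (col_perm s (row_mx b b'))
      (col_perm s (row_mx w w'))) (col_perm s (row_mx t t')) alpha); last first.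
    by elim/big_rec2: _ => // s f g _ <-.
  apply: eq_bigr => s _.
  have [_ ->] := fps_star_cint (Ds s) he (col_perm s (row_mx t t')) (leqnn D).
  apply/esym; exact: (cint_transfer (@measurable_tpermute R (k + l) s)
    (@lebesgue_tuple_permutation R (k + l) s) (cintegrable_cmeasurable (iH s))
    (iHp s)).
pose f1 := series_integrand hbar a b w e t D.
pose f2 := series_integrand hbar a' b' w' e t' D.
pose mu := (lebesgue_tuple R k \x lebesgue_tuple R l)%E.
have degP (bc : bmultinom (k + l) (mdeg alpha).+1 * bmultinom (k + l) (mdeg alpha).+1) :
    (mdeg bc.1 <= D)%N /\ (mdeg bc.2 <= D)%N by split; rewrite -ltnS bmdeg.
pose g (bc : bmultinom (k + l) (mdeg alpha).+1 * bmultinom (k + l) (mdeg alpha).+1)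
  (z : k.-tuple RT * l.-tuple RT) := f1 bc.1 z.1 * f2 bc.2 z.2.
have ig bc : cintegrable mu (g bc) /\
    cint mu (g bc) = fps_star (qpolylog_series hbar a b w) t bc.1 *
      fps_star (qpolylog_series hbar a' b' w') t' bc.2.
  have [i1 ->] := fps_star_cint Dw he t (degP bc).1.
  have [i2 ->] := fps_star_cint Dw' he t' (degP bc).2.
  exact: cint_prod.
have FE : F \o @tcat R k l = fun z =>
    \sum_(bc : bmultinom (k + l) (mdeg alpha).+1 * bmultinom (k + l) (mdeg alpha).+1 |
      mnm_add bc.1 bc.2 == alpha) g bc z.
  apply/funext => -[x y] /=; set z := tcat (x, y).
  have cl i : contour e z (lshift l i) = contour e x i.
    by rewrite /contour /z /tcat tnth_lshift.
  have cr i : contour e z (rshift k i) = contour e y i.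
    by rewrite /contour /z /tcat tnth_rshift.
  have tt i : row_mx t t' 0 i = i.
    rewrite mxE; case: fintype.splitP => j ij; rewrite mxE; exact: val_inj.
  pose K0 := \prod_(i < k + l) Kfun hbar (row_mx a a' 0 i) (row_mx b b' 0 i)
    (contour e z i) (row_mx w w' 0 i).
  have K0E : K0 = qkernel hbar a b w e x * qkernel hbar a' b' w' e y.
    rewrite /K0 big_split_ord; congr (_ * _); apply: eq_bigr => i _.
      by rewrite cl !row_mxEl.
    by rewrite cr !row_mxEr.
  pose X i : mpoly (k + l) C := mpolyX C (mnm1 i).
  pose G1 := \prod_(j < k) geom 'i D (\sum_(i < k | (i <= j)%N) contour e x i)
    (\sum_(i < k | (i <= j)%N) X (lshift l i)).
  pose G2 := \prod_(j < l) geom 'i D (\sum_(i < l | (i <= j)%N) contour e y i)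
    (\sum_(i < l | (i <= j)%N) X (rshift k i)).
  have f1E c : f1 c x = qkernel hbar a b w e x * mcoeff c G1.
    apply: (congr1 (fun q => qkernel hbar a b w e x * mcoeff c q)).
    apply: eq_bigr => j _; apply: (congr1 (geom 'i D _)).
    by apply: eq_bigr => i _; rewrite mxE.
  have f2E c : f2 c y = qkernel hbar a' b' w' e y * mcoeff c G2.
    apply: (congr1 (fun q => qkernel hbar a' b' w' e y * mcoeff c q)).
    apply: eq_bigr => j _; apply: (congr1 (geom 'i D _)).
    by apply: eq_bigr => i _; rewrite mxE.
  transitivity (K0 * mcoeff alpha (G1 * G2)).
    have SG := @shuffle_geom _ 'i k l (contour e z)
      (fun s => @contour_sum_neq0 _ e z s e0) D alpha (leqnn D).
    have -> : G1 = \prod_(j < k) geom 'i D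
        (\sum_(i < k | (i <= j)%N) contour e z (lshift l i))
        (\sum_(i < k | (i <= j)%N) X (lshift l i)).
      apply: eq_bigr => j _; apply: (congr1 (fun u => geom 'i D u _)).
      by apply: eq_bigr => i _; rewrite cl.
    have -> : G2 = \prod_(j < l) geom 'i D
        (\sum_(i < l | (i <= j)%N) contour e z (rshift k i))
        (\sum_(i < l | (i <= j)%N) X (rshift k i)).
      apply: eq_bigr => j _; apply: (congr1 (fun u => geom 'i D u _)).
      by apply: eq_bigr => i _; rewrite cr.
    rewrite SG mulr_sumr; apply: eq_bigr => s _.
    have cs i : contour e (tpermute s z) i = contour e z (s i).
      by rewrite /contour tnth_mktuple.
    apply: (congr2 (fun u q => u * mcoeff alpha q)).
      rewrite /K0 (reindex_inj (@perm_inj _ s)) /=.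
      by apply: eq_bigr => i _; rewrite cs !mxE.
    apply: eq_bigr => j _; apply: (congr2 (geom 'i D)); apply: eq_bigr => i _.
      exact: cs.
    by rewrite mxE tt.
  rewrite K0E mcoeffM mulr_sumr; apply: eq_big => [bc|bc _]; first by rewrite eq_sym.
  by rewrite /g /= f1E f2E mulrACA.
rewrite (cint_transfer (@measurable_tcat R k l) (@lebesgue_tuple_cat R k l)
  (cintegrable_cmeasurable iF)); last first.
  by rewrite FE; apply: cintegrable_sum => bc _; exact: (ig bc).1.
rewrite FE cint_sum => [|bc _]; last exact: (ig bc).1.
by apply: eq_bigr => bc _; rewrite (ig bc).2.
Qed.

End generating_series.

(** * Power series with many zeros *)

Section accumulating_zeros.
Variable R : realType.
Local Notation C := R[i].
Implicit Types (a : nat -> C) (z : C).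

Let S a z N := \sum_(n < N) a n * z ^+ n.

Definition vanishes_at a z := forall e : R, 0 < e ->
  exists N0, forall N, (N0 <= N)%N -> cabs (S a z N) <= e.

Lemma S_rec a z N : S a z N.+1 = S a z N + a N * z ^+ N.
Proof. by rewrite /S big_ord_recr. Qed.

Lemma geometric_small (M q e : R) : 0 <= q -> q <= 2^-1 -> 0 < e ->
  exists N0, forall N, (N0 <= N)%N -> M * q ^+ N <= e.
Proof.
move=> q0 q2 e0; have [M0|M0] := leP M 0.
  by exists 0%N => N _; apply: le_trans (ltW e0); rewrite mulr_le0_ge0 ?exprn_ge0.
exists (Num.truncn (M / e)).+1 => N hN.
have N0 : (0 : R) < N%:R by rewrite ltr0n; apply: leq_trans hN.
have h1 : q ^+ N <= (N%:R)^-1.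
  apply: (@le_trans _ _ (2^-1 ^+ N)); first by rewrite lerXn2r ?nnegrE ?invr_ge0.
  rewrite exprVn lef_pV2 ?posrE ?exprn_gt0//.
  by rewrite -natrX ler_nat ltnW// ltn_expl.
apply: (@le_trans _ _ (M * (N%:R)^-1)); first by rewrite ler_wpM2l// ltW.
rewrite ler_pdivrMr// mulrC -ler_pdivrMr//; apply: (@le_trans _ _ (Num.truncn (M / e)).+1%:R).
  by rewrite ltW// truncnS_gt.
by rewrite ler_nat.
Qed.

Section bounded.
Variables (a : nat -> C) (M q : R) (z : C).
Hypotheses (q0 : 0 <= q) (qz : q * cabs z <= 2^-1).
Hypothesis aM : forall n, cabs (a n) <= M * q ^+ n.

Lemma partial_sum_tail N d :
  cabs (S a z (N + d) - S a z N) <= 2 * M * (q * cabs z) ^+ N * (1 - 2^-1 ^+ d).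
Proof.
have M0 : 0 <= M by have := aM 0; rewrite expr0 mulr1; apply: le_trans; exact: cabs_ge0.
have z0 := cabs_ge0 z; have uz := qz; set u := q * cabs z in uz *.
have u0 : 0 <= u by rewrite mulr_ge0.
have uN : 0 <= u ^+ N by rewrite exprn_ge0.
elim: d => [|d IH].
  by rewrite addn0 subrr Normc.normc0 expr0 subrr mulr0.
rewrite addnS S_rec (_ : _ - _ = (S a z (N + d) - S a z N) +
  a (N + d)%N * z ^+ (N + d)); last by ring.
apply: le_trans (cabsD _ _) _.
have h : cabs (a (N + d)%N * z ^+ (N + d)) <= M * u ^+ N * 2^-1 ^+ d.
  rewrite cabsM cabsX; apply: (@le_trans _ _ (M * q ^+ (N + d) * cabs z ^+ (N + d))).
    by rewrite ler_wpM2r// exprn_ge0.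
  rewrite -mulrA -exprMn -/u exprD mulrA ler_wpM2l ?mulr_ge0//.
  by rewrite lerXn2r ?nnegrE ?invr_ge0.
apply: le_trans (lerD IH h) _; rewrite exprS.
by have := mulr_ge0 M0 uN; lra.
Qed.

Lemma partial_sum_le : vanishes_at a z ->
  forall N, cabs (S a z N) <= 2 * M * (q * cabs z) ^+ N.
Proof.
move=> az N; apply/ler_addgt0Pr => e e0.
have M0 : 0 <= M by have := aM 0; rewrite expr0 mulr1; apply: le_trans; exact: cabs_ge0.
have [N0 H] := az _ e0; have h := H (N + N0)%N (leq_addl _ _).
rewrite -(cabsN (S a z N)) (_ : - _ = (S a z (N + N0) - S a z N) - S a z (N + N0));
  last by ring.
apply: le_trans (cabsB _ _) _; rewrite lerD//.
apply: le_trans (partial_sum_tail N N0) _.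
rewrite ler_piMr ?mulr_ge0 ?exprn_ge0 ?mulr_ge0 ?cabs_ge0//.
Qed.

End bounded.

(** The coefficients of the quotient by X - z of a power series that vanishes
    at z. *)
Let quot a z n := - S a z n.+1 / z ^+ n.+1.

Lemma quot_sum a z y N : z != 0 ->
  (y - z) * S (quot a z) y N = S a y N - S a z N / z ^+ N * y ^+ N.
Proof.
move=> z0; have zN n : z ^+ n != 0 by rewrite expf_neq0.
elim: N => [|N IH]; first by rewrite /S !big_ord0 !mul0r mulr0 subr0.
rewrite 2!S_rec mulrDr IH /quot S_rec !exprS.
by field; rewrite z0 zN.
Qed.

(** Dividing by X - z_k turns the bound M into M / 4, as q <= 1 / 8, and keeps the
    other zeros, while the first coefficient is divided by - z_k, of modulus at
    most 2. Each zero thus gains a factor 2. *)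
Lemma vanishing_first_coef (q : R) (zs : nat -> C) :
  0 <= q -> q <= 8^-1 -> injective zs -> (forall i, 1 <= cabs (zs i) <= 2) ->
  forall a (M : R), (forall n, cabs (a n) <= M * q ^+ n) ->
  forall k, (forall i, (i < k)%N -> vanishes_at a (zs i)) ->
  cabs (a 0%N) <= M * 2^-1 ^+ k.
Proof.
move=> q0 q8 zinj z12 a M aM k; elim: k a M aM => [|k IH] a M aM az.
  exact: (aM 0%N).
have M0 : 0 <= M by have := aM 0; rewrite expr0 mulr1; apply: le_trans; exact: cabs_ge0.
have qz i : q * cabs (zs i) <= 4^-1.
  have /andP[h1 h2] := z12 i; apply: (@le_trans _ _ (8^-1 * 2)); last by lra.
  by rewrite ler_pM// cabs_ge0.
have qz2 i : q * cabs (zs i) <= 2^-1 by apply: le_trans (qz i) _; lra.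
have z0 i : zs i != 0.
  by rewrite -cabs_eq0 gt_eqF//; have /andP[h _] := z12 i; apply: lt_le_trans h.
have bM n : cabs (quot a (zs k) n) <= (M / 4) * q ^+ n.
  have := partial_sum_le q0 (qz2 k) aM (az k (ltnSn k)) n.+1 => h.
  have zp : 0 < cabs (zs k) ^+ n.+1.
    by rewrite exprn_gt0// lt_neqAle cabs_ge0 eq_sym cabs_eq0 z0.
  rewrite /quot cabsM cabsN cabsV cabsX ler_pdivrMr//; apply: le_trans h _.
  rewrite exprMn mulrA ler_wpM2r ?(ltW zp)// exprS mulrA ler_wpM2r ?exprn_ge0//.
  have := ler_wpM2l M0 q8; lra.
have bz i : (i < k)%N -> vanishes_at (quot a (zs k)) (zs i).
  move=> ik e e0; have ne : zs i - zs k != 0.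
    by rewrite subr_eq0 (inj_eq zinj) ltn_eqF.
  have c0 : 0 < cabs (zs i - zs k).
    by rewrite lt_neqAle cabs_ge0 eq_sym cabs_eq0 ne.
  have e2 : 0 < e * cabs (zs i - zs k) / 2 by rewrite divr_gt0 ?mulr_gt0.
  have [N1 H1] := az i (ltnW ik : (i < k.+1)%N) _ e2.
  have [N2 H2] := geometric_small (2 * M) (mulr_ge0 q0 (cabs_ge0 (zs i)))
    (qz2 i) e2.
  exists (maxn N1 N2) => N; rewrite geq_max => /andP[h1 h2].
  rewrite -(ler_pM2l c0) -cabsM quot_sum//.
  apply: le_trans (cabsB _ _) _.
  rewrite [leRHS](_ : _ = e * cabs (zs i - zs k) / 2 + e * cabs (zs i - zs k) / 2);
    last by lra.
  apply: lerD; first exact: H1.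
  apply: le_trans (H2 _ h2); rewrite cabsM cabsM cabsV !cabsX exprMn mulrA.
  rewrite ler_wpM2r ?exprn_ge0 ?cabs_ge0//.
  have zp : 0 < cabs (zs k) ^+ N.
    by rewrite exprn_gt0// lt_neqAle cabs_ge0 eq_sym cabs_eq0 z0.
  rewrite ler_pdivrMr// -[leRHS]mulrA -exprMn.
  exact: (partial_sum_le q0 (qz2 k) aM (az k (ltnSn k)) N).
have := IH _ _ bM bz.
rewrite /quot /S big_ord1 expr0 mulr1 expr1 => h.
have /andP[h1 h2] := z12 k.
rewrite cabsM cabsN cabsV ler_pdivrMr ?(lt_le_trans _ h1)// in h.
apply: le_trans h _; rewrite exprS.
have : 0 <= M * 2^-1 ^+ k by rewrite mulr_ge0// exprn_ge0.
nra.
Qed.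

(** Arbitrarily many zeros make the first coefficient smaller than any bound;
    dividing by X then moves on to the next coefficient with the same zeros. *)
Lemma vanishing_coefs (q M : R) (zs : nat -> C) a :
  0 <= q -> q <= 8^-1 -> injective zs -> (forall i, 1 <= cabs (zs i) <= 2) ->
  (forall n, cabs (a n) <= M * q ^+ n) -> (forall i, vanishes_at a (zs i)) ->
  forall n, a n = 0.
Proof.
move=> q0 q8 zinj z12 aM az n; elim: n a M aM az => [|n IH] a M aM az.
  apply/eqP; rewrite -cabs_eq0 eq_le cabs_ge0 andbT; apply/ler_addgt0Pr => e e0.
  have h2 : 0 <= (2^-1 : R) by lra.
  have [N H] := geometric_small M h2 (lexx _) e0.
  rewrite add0r; apply: le_trans (H N (leqnn N)).
  exact: (vanishing_first_coef q0 q8 zinj z12 aM).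
have M0 : 0 <= M by have := aM 0; rewrite expr0 mulr1; apply: le_trans; exact: cabs_ge0.
have a0 : a 0%N = 0.
  apply/eqP; rewrite -cabs_eq0 eq_le cabs_ge0 andbT; apply/ler_addgt0Pr => e e0.
  have h2 : 0 <= (2^-1 : R) by lra.
  have [N H] := geometric_small M h2 (lexx _) e0.
  rewrite add0r; apply: le_trans (H N (leqnn N)).
  exact: (vanishing_first_coef q0 q8 zinj z12 aM).
apply: (IH (fun n => a n.+1) (M * q)) => [m|i e e0].
  by rewrite -mulrA -exprS.
have /andP[z1 _] := z12 i.
have [N0 H] := az i _ e0; exists N0 => N hN.
have := H N.+1 (leqW hN); rewrite /S big_ord_recl a0 mul0r add0r.
rewrite (eq_bigr (fun m : 'I_N => zs i * (a m.+1 * zs i ^+ m))) => [|m _]; last first.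
  by rewrite /= /bump /= add1n exprS; ring.
rewrite -mulr_sumr cabsM; apply: le_trans.
by rewrite ler_peMl// cabs_ge0.
Qed.

End accumulating_zeros.

(** * Expansions in homogeneous polynomials *)

Section row_vector_norm.
Variables (R : realType) (n : nat).
Local Notation C := R[i].
Local Notation V := 'rV[C]_n.

Definition vnorm (v : V) : R := complex.Re `|v|.

Lemma vnormE (v : V) : `|v| = (vnorm v)%:C.
Proof. by rewrite /vnorm RRe_real// ger0_real. Qed.

Lemma vnorm_ge0 v : 0 <= vnorm v.
Proof. by rewrite -ler0c -vnormE. Qed.

Lemma vnormD u v : vnorm (u + v) <= vnorm u + vnorm v.
Proof. by rewrite -lecR rmorphD /= -!vnormE ler_normD. Qed.

Lemma vnormZ t v : vnorm (t *: v) = cabs t * vnorm v.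
Proof. by apply: complexI; rewrite rmorphM /= -!vnormE -normr_cabs normrZ. Qed.

Lemma vnorm_lt (v : V) (e : R) : 0 < e -> (vnorm v < e <-> forall j, cabs (v 0 j) < e).
Proof.
move=> e0; have E : (`|v| < e%:C) = (vnorm v < e) by rewrite vnormE ltcR.
rewrite -E; have -> : `|v| = `|0 - v| by rewrite sub0r normrN.
have -> : (`|0 - v| < e%:C) <-> ball (0 : V) e%:C v.
  by rewrite mx_norm_ball.
split=> H.
  move=> j; have := H.2 0 j; rewrite mxE.
  by rewrite -(@ball_normE C C^o) /ball_ /= sub0r normrN normr_cabs ltcR.
split=> [|i j]; first by rewrite ltcR.
rewrite ord1 mxE -(@ball_normE C C^o) /ball_ /=.
by rewrite sub0r normrN normr_cabs ltcR.
Qed.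

Lemma cabs_le_vnorm (v : V) j : cabs (v 0 j) <= vnorm v.
Proof.
apply/ler_addgt0Pr => e e0; apply: ltW.
have ve : 0 < vnorm v + e by rewrite ltr_wpDl// vnorm_ge0.
by apply: (proj1 (vnorm_lt v ve)); rewrite ltrDl.
Qed.

Lemma nearP (z : V) (P : V -> Prop) : (\forall x \near z, P x) <->
  exists2 e : R, 0 < e & forall v, vnorm v < e -> P (z + v).
Proof.
split=> [/nbhs_ballP[e e0 H]|[e e0 H]].
  have eE : e = (complex.Re e)%:C by rewrite RRe_real// gtr0_real.
  exists (complex.Re e) => [|v ve]; first by rewrite -ltcR -eE.
  apply: H; rewrite eE mx_norm_ball /ball_ /= opprD addrA subrr sub0r normrN.
  by rewrite vnormE ltcR.
apply/nbhs_ballP; exists e%:C => /=; first by rewrite ltcR.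
move=> x; rewrite mx_norm_ball /ball_ /= -normrN opprB vnormE ltcR => xz.
by rewrite -(subrK z x) addrC; exact: H.
Qed.

End row_vector_norm.

Section expandable.
Variables (R : realType) (n : nat).
Local Notation C := R[i].
Local Notation V := 'rV[C]_n.
Implicit Types (f g : V -> C) (z u v : V).

(** An expansion in homogeneous polynomials P_k with geometric bounds on the
    terms and on the remainders. Unlike convergence, these bounds are inherited
    by Cauchy products through finite identities. *)
Definition expansion f z (P : nat -> V -> C) (M K rho : R) :=
  [/\ 0 < rho /\ 0 <= K,
      forall k t v, P k (t *: v) = t ^+ k * P k v,
      forall k u v, exists q : {poly C}, forall t, P k (u + t *: v) = q.[t],
      forall k v, cabs (P k v) <= M * (K * vnorm v) ^+ k
    & forall N v, vnorm v <= rho ->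
        cabs (f (z + v) - \sum_(k < N) P k v) <= M * (K * vnorm v) ^+ N].

Definition expandable f z := exists P M K rho, expansion f z P M K rho.

Lemma expansion_M_ge0 f z P M K rho : expansion f z P M K rho -> 0 <= M.
Proof.
move=> [_ _ _ H _]; have := H 0%N 0; rewrite expr0 mulr1; apply: le_trans.
exact: cabs_ge0.
Qed.

Lemma expansion_le f z P M K rho M' K' rho' :
  M <= M' -> K <= K' -> 0 < rho' -> rho' <= rho ->
  expansion f z P M K rho -> expansion f z P M' K' rho'.
Proof.
move=> MM KK r0 rr E; have M0 := expansion_M_ge0 E.
case: E => [[rho0 K0] H1 H2 H3 H4].
have le k v : M * (K * vnorm v) ^+ k <= M' * (K' * vnorm v) ^+ k.
  have v0 := vnorm_ge0 v; have K'0 := le_trans K0 KK.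
  rewrite ler_pM ?exprn_ge0 ?mulr_ge0// lerXn2r ?nnegrE ?mulr_ge0//.
  by rewrite ler_wpM2r.
split=> //; first by split=> //; exact: le_trans KK.
- by move=> k v; apply: le_trans (le k v).
- by move=> N v vr; apply: le_trans (le N v); apply: H4; exact: le_trans rr.
Qed.

Lemma expandable_cst (c : C) z : expandable (fun=> c) z.
Proof.
exists (fun k _ => if k is 0%N then c else 0), (cabs c), 0, 1.
split=> //.
- by move=> [|k] t v; rewrite ?expr0 ?mul1r ?mulr0.
- move=> [|k] u v; first by exists c%:P => t; rewrite hornerC.
  by exists 0 => t; rewrite horner0.
- move=> [|k] v; first by rewrite expr0 mulr1.
  by rewrite Normc.normc0 mul0r expr0n mulr0.
- move=> [|N] v _; first by rewrite big_ord0 subr0 expr0 mulr1.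
  rewrite big_ord_recl /= big1 ?addr0 ?subrr ?Normc.normc0 => [|i _]; last by [].
  by rewrite mulr_ge0 ?cabs_ge0// mul0r expr0n.
Qed.

Lemma expandableD f g z : expandable f z -> expandable g z ->
  expandable (fun x => f x + g x) z.
Proof.
move=> [P [M [K [rho E]]]] [Q [M' [K' [rho' E']]]].
have M0 := expansion_M_ge0 E; have M'0 := expansion_M_ge0 E'.
have [[r0 K0] _ _ _ _] := E; have [[r0' K0'] _ _ _ _] := E'.
have m0 : 0 < Num.min rho rho' by rewrite lt_min r0.
have [[_ KK0] P1 P2 P3 P4] : expansion f z P M (K + K') (Num.min rho rho').
  by apply: expansion_le E; rewrite ?lerDl// ge_min lexx.
have [_ Q1 Q2 Q3 Q4] : expansion g z Q M' (K + K') (Num.min rho rho').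
  by apply: expansion_le E'; rewrite ?lerDr// ge_min lexx orbT.
exists (fun k v => P k v + Q k v), (M + M'), (K + K'), (Num.min rho rho').
split=> //.
- by move=> k t v; rewrite P1 Q1 mulrDr.
- move=> k u v; have [q1 h1] := P2 k u v; have [q2 h2] := Q2 k u v.
  by exists (q1 + q2) => t; rewrite h1 h2 hornerD.
- by move=> k v; rewrite mulrDl; apply: le_trans (cabsD _ _) _; exact: lerD.
- move=> N v vr; rewrite big_split /= opprD addrACA mulrDl.
  by apply: le_trans (cabsD _ _) _; rewrite lerD ?P4 ?Q4.
Qed.

Lemma expandableM f g z : expandable f z -> expandable g z ->
  expandable (fun x => f x * g x) z.
Proof.
move=> [P [M [K [rho E]]]] [Q [M' [K' [rho' E']]]].
have M0 := expansion_M_ge0 E; have M'0 := expansion_M_ge0 E'.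
have [[r0 K0] _ _ _ _] := E; have [[r0' K0'] _ _ _ _] := E'.
have m0 : 0 < Num.min rho rho' by rewrite lt_min r0.
have [[_ KK0] P1 P2 P3 P4] : expansion f z P M (K + K') (Num.min rho rho').
  by apply: expansion_le E; rewrite ?lerDl// ge_min lexx.
have [_ Q1 Q2 Q3 Q4] : expansion g z Q M' (K + K') (Num.min rho rho').
  by apply: expansion_le E'; rewrite ?lerDr// ge_min lexx orbT.
set L := K + K' in KK0 P3 P4 Q3 Q4.
have n2 N : N.+1%:R <= (2 : R) ^+ N by rewrite -natrX ler_nat ltn_expl.
have bnd N v : N.+1%:R * (M * M' * (L * vnorm v) ^+ N) <=
    M * M' * ((2 * L) * vnorm v) ^+ N.
  rewrite -[2 * L * _]mulrA [(2 * _) ^+ N]exprMn.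
  rewrite [leRHS](_ : _ = 2 ^+ N * (M * M' * (L * vnorm v) ^+ N)); last by ring.
  by rewrite ler_wpM2r// !mulr_ge0// exprn_ge0// mulr_ge0// vnorm_ge0.
exists (fun k v => \sum_(i < k.+1) P i v * Q (k - i)%N v), (M * M'), (2 * L),
  (Num.min rho rho').
split=> //.
- by split=> //; rewrite mulr_ge0.
- move=> k t v; rewrite mulr_sumr; apply: eq_bigr => i _.
  by rewrite P1 Q1 mulrACA -exprD subnKC// -ltnS.
- move=> k u v.
  have /choice[p hp] i : exists q : {poly C}, forall t, P i (u + t *: v) = q.[t].
    exact: P2.
  have /choice[q hq] i : exists q : {poly C}, forall t, Q i (u + t *: v) = q.[t].
    exact: Q2.
  exists (\sum_(i < k.+1) p i * q (k - i)%N) => t.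
  by rewrite horner_sum; apply: eq_bigr => i _; rewrite hornerM hp hq.
- move=> k v; apply: le_trans (bnd k v).
  apply: (@le_trans _ _ (\sum_(i < k.+1) M * M' * (L * vnorm v) ^+ k)); last first.
    by rewrite sumr_const card_ord mulr_natl.
  elim/big_rec2: _ => [|i x y _ h]; first by rewrite Normc.normc0.
  apply: le_trans (cabsD _ _) (lerD _ h); rewrite cabsM.
  apply: le_trans (ler_pM (cabs_ge0 _) (cabs_ge0 _) (P3 i v) (Q3 _ v)) _.
  by rewrite mulrACA -exprD subnKC// -ltnS.
- move=> N v vr; apply: le_trans (bnd N v).
  have E1 : \sum_(k < N) \sum_(i < k.+1) P i v * Q (k - i)%N v =
      \sum_(i < N) P i v * \sum_(j < N - i) Q j v.
    elim: N => [|N IH]; first by rewrite !big_ord0.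
    rewrite big_ord_recr IH big_ord_recr [RHS]big_ord_recr /= addrA subSnn.
    congr (_ + _); last by rewrite big_ord1 subnn.
    rewrite -big_split; apply: eq_bigr => i _ /=.
    by rewrite subSn ?(ltnW (ltn_ord i))// big_ord_recr mulrDr.
  rewrite E1 (_ : _ - _ = \sum_(i < N) P i v * (g (z + v) - \sum_(j < N - i) Q j v)
     + (f (z + v) - \sum_(i < N) P i v) * g (z + v)); last first.
    rewrite mulrBl mulr_suml; under [in RHS]eq_bigr do rewrite mulrBr.
    by rewrite sumrB; ring.
  rewrite -natr1 [leRHS]mulrDl mul1r; apply: le_trans (cabsD _ _) (lerD _ _).
    rewrite mulr_natl -[X in _ *+ X](card_ord N) -sumr_const.
    elim/big_rec2: _ => [|i x y _ h]; first by rewrite Normc.normc0.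
    apply: le_trans (cabsD _ _) (lerD _ h); rewrite cabsM.
    apply: le_trans (ler_pM (cabs_ge0 _) (cabs_ge0 _) (P3 i v) (Q4 _ v vr)) _.
    by rewrite mulrACA -exprD subnKC// ltnW.
  have g0 : cabs (g (z + v)) <= M'.
    by have := Q4 0%N v vr; rewrite big_ord0 subr0 expr0 mulr1.
  rewrite cabsM mulrAC; exact: ler_pM (cabs_ge0 _) (cabs_ge0 _) (P4 N v vr) g0.
Qed.

(** If f vanishes near a point c close to the centre z of an expansion, then the
    restriction of f to the line through z and c has infinitely many zeros, so
    all the P_k vanish at c. This holds for all points near c, hence the
    polynomials P_k vanish on every line through c. *)
Lemma expandable_zero f z : expandable f z ->
  exists2 d : R, 0 < d & forall c (e : R), vnorm c < d -> 0 < e ->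
    (forall v, vnorm (v - c) < e -> f (z + v) = 0) ->
    forall v, vnorm v < d -> f (z + v) = 0.
Proof.
move=> [P [M [K [rho [[r0 K0] H1 H2 H3 H4]]]]].
have M0 : 0 <= M by have := H3 0%N 0; rewrite expr0 mulr1; apply: le_trans; exact: cabs_ge0.
pose d := Num.min (rho / 2) (8^-1 / (K + 1)).
have K1 : 0 < K + 1 by rewrite ltr_wpDl.
have d0 : 0 < d by rewrite lt_min !divr_gt0.
have dr v : vnorm v < d -> vnorm v * 2 <= rho.
  by rewrite lt_min => /andP[/ltW h _]; lra.
have dK v : vnorm v < d -> K * vnorm v <= 8^-1.
  rewrite lt_min => /andP[_]; rewrite ltr_pdivlMr// => /ltW h.
  by apply: le_trans h; have := vnorm_ge0 v; lra.
exists d => // c e cd e0 fz.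
have P0 v : vnorm v < d -> vnorm (v - c) < e -> forall k, P k v = 0.
  move=> vd ve k.
  pose s := Num.min 1 ((e - vnorm (v - c)) / (vnorm v + 1)).
  have v1 : 0 < vnorm v + 1 by rewrite ltr_wpDl// vnorm_ge0.
  have s0 : 0 < s by rewrite lt_min ltr01 divr_gt0// subr_gt0.
  have s1 : s <= 1 by rewrite ge_min lexx.
  have sv : s * vnorm v < e - vnorm (v - c).
    apply: (@lt_le_trans _ _ (s * (vnorm v + 1))); first by rewrite ltr_pM2l// ltrDl.
    by rewrite -ler_pdivlMr// ge_min lexx orbT.
  (* distinct multiples of v, which stay within e of c *)
  pose x (i : nat) : R := 1 + s / i.+1%:R.
  have si i : 0 < s / i.+1%:R <= s.
    by rewrite divr_gt0 ?ltr0n//= ler_pdivrMr ?ltr0n// ler_peMr ?ler1n// ltW.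
  have x12 i : 1 <= x i <= 2.
    have /andP[h1 h2] := si i.
    by rewrite /x lerDl (ltW h1)/= -[leRHS]/(1 + 1) lerD2l; apply: le_trans h2 _.
  have xabs i : cabs (x i)%:C = x i.
    by rewrite cabs_real ger0_norm//; have /andP[] := x12 i; lra.
  apply: (@vanishing_coefs R (K * vnorm v) M (fun i => (x i)%:C) (fun k => P k v)).
  - by rewrite mulr_ge0// vnorm_ge0.
  - exact: dK.
  - move=> i j /complexI /addrI; rewrite /= => /(mulfI (lt0r_neq0 s0)) /invr_inj.
    by move/eqP; rewrite eqr_nat => /eqP[].
  - by move=> i; rewrite xabs.
  - by move=> m; exact: H3.
  - move=> i eps eps0; have /andP[x1 x2] := x12 i.
    have xv : f (z + (x i)%:C *: v) = 0.
      apply: fz; rewrite (_ : _ - c = (v - c) + (s / i.+1%:R)%:C *: v); last first.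
        by rewrite /x rmorphD scalerDl scale1r addrAC.
      apply: le_lt_trans (vnormD _ _) _; rewrite vnormZ cabs_real.
      have /andP[/ltW s1' s2] := si i; rewrite ger0_norm//.
      rewrite -ltrBrDl.
      exact: le_lt_trans (ler_wpM2r (vnorm_ge0 v) s2) sv.
    have q2 : K * (x i * vnorm v) <= 2^-1.
      have := dK _ vd; have := mulr_ge0 K0 (vnorm_ge0 v).
      rewrite mulrCA; set u := K * _ => u0 u8; nra.
    have [|N0 HN] := geometric_small M _ q2 eps0.
      by rewrite !mulr_ge0 ?vnorm_ge0//; lra.
    exists N0 => N hN; apply: le_trans (HN N hN).
    have := H4 N ((x i)%:C *: v); rewrite vnormZ xabs xv sub0r cabsN => h.
    rewrite (eq_bigr (fun k : 'I_N => P k ((x i)%:C *: v))) => [|j _].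
      apply: h; apply: le_trans (dr _ vd); rewrite mulrC ler_wpM2l//.
      exact: vnorm_ge0.
    by rewrite H1 mulrC.
have PT k v : P k v = 0.
  have [q hq] := H2 k c (v - c).
  have v1 : 0 < vnorm (v - c) + 1 by rewrite ltr_wpDl// vnorm_ge0.
  pose s := Num.min (d - vnorm c) e / (vnorm (v - c) + 1).
  have s0 : 0 < s by rewrite divr_gt0// lt_min subr_gt0 cd.
  have q0 : q = 0.
    apply: (@roots_geq_poly_eq0 _ q [seq (s / i.+2%:R)%:C | i <- iota 0 (size q)]).
    - apply/allP => _ /mapP[i _ ->]; rewrite /root -hq.
      have si : 0 <= s / i.+2%:R < s.
        rewrite divr_ge0 ?(ltW s0)//= ltr_pdivrMr ?ltr0n// ltr_pMr// ltr1n//.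
      have /andP[si0 si1] := si.
      have small : vnorm ((s / i.+2%:R)%:C *: (v - c)) < Num.min (d - vnorm c) e.
        rewrite vnormZ cabs_real ger0_norm//.
        apply: (@le_lt_trans _ _ (s / i.+2%:R * (vnorm (v - c) + 1))).
          by rewrite ler_wpM2l// lerDl.
        by rewrite -ltr_pdivlMr.
      rewrite lt_min in small; have /andP[sm1 sm2] := small.
      rewrite P0//; last by rewrite addrC addKr.
      by apply: le_lt_trans (vnormD _ _) _; lra.
    - rewrite map_inj_uniq ?iota_uniq// => i j /complexI /(mulfI (lt0r_neq0 s0)).
      by move=> /invr_inj /eqP; rewrite eqr_nat => /eqP[].
    - by rewrite size_map size_iota.
  by have := hq 1; rewrite q0 horner0 scale1r addrC subrK.
move=> v vd; apply/eqP; rewrite -cabs_eq0 eq_le cabs_ge0 andbT.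
apply/ler_addgt0Pr => eps eps0; rewrite add0r.
have q2 : K * vnorm v <= 2^-1 by apply: le_trans (dK _ vd) _; lra.
have [|N HN] := geometric_small M _ q2 eps0; first by rewrite mulr_ge0// vnorm_ge0.
apply: le_trans (HN N (leqnn N)).
have := H4 N v; rewrite big1 ?subr0 => [|i _]; last exact: PT.
by apply; have := dr _ vd; have := vnorm_ge0 v; lra.
Qed.

End expandable.

Section analytic.
Variables (R : realType) (N : nat).
Local Notation C := R[i].
Local Notation V := 'rV[C]_N.

Lemma bmultinom_sum_degree (A : nmodType) (G : multinom N -> A) d :
  \sum_(beta : bmultinom N d) G beta =
  \sum_(k < d) \sum_(beta : bmultinom N k.+1 | mdeg beta == k) G beta.
Proof.
rewrite (partition_big (fun beta : bmultinom N d => Ordinal (bmdeg beta)) xpredT)//=.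
apply: eq_bigr => k _.
pose h (beta : bmultinom N k.+1) : bmultinom N d :=
  BMultinom (leq_trans (bmdeg beta) (ltn_ord k)).
pose h' (beta : bmultinom N d) : bmultinom N k.+1 := insubd (@bm0 N k) (beta : multinom N).
have hK (beta : bmultinom N d) : mdeg beta = k -> bmnm (h' beta) = beta.
  move=> E; rewrite /h' -[LHS]/(val (insubd (@bm0 N k) (beta : multinom N))).
  by rewrite val_insubd E ltnSn.
rewrite (reindex_onto h h') => [|beta /eqP/(congr1 val)/= E]; last first.
  by apply: val_inj; rewrite /= hK.
apply: eq_big => beta //=; rewrite -val_eqE /=.
case: eqP => //= E; apply/eqP/val_inj; exact: (hK (h beta) E).
Qed.

Lemma cabs_monomial_le (v : V) (beta : multinom N) :
  cabs (\prod_(j < N) v 0 j ^+ beta j) <= vnorm v ^+ mdeg beta.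
Proof.
rewrite cabs_prod mdegE expr_sum; apply: ler_prod => j _.
by rewrite cabs_ge0 cabsX lerXn2r ?nnegrE ?cabs_ge0 ?vnorm_ge0// cabs_le_vnorm.
Qed.

(** The homogeneous parts of the series have geometric bounds with ratio
    |v| / r, so on the ball of radius r / 2 each remainder is at most twice the
    bound for its first term. *)
Lemma analytic_expandable (f : V -> C) z : analytic_at f z -> expandable f z.
Proof.
move=> [rC rC0 [c [[MC MCP] cvgf]]].
have rE : rC = (complex.Re rC)%:C by rewrite RRe_real// gtr0_real.
set r := complex.Re rC in rE.
have r0 : 0 < r by rewrite -ltcR -rE.
have ME : MC = (complex.Re MC)%:C.
  rewrite RRe_real// ger0_real//; apply: le_trans (MCP 0%N).
  by apply: sumr_ge0 => b _; rewrite mulr_ge0 ?exprn_ge0 ?normr_ge0 ?(ltW rC0).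
set M := complex.Re MC in ME.
have MP d : \sum_(beta : bmultinom N d) cabs (c beta) * r ^+ mdeg beta <= M.
  rewrite -lecR -ME rmorph_sum; apply: le_trans (MCP d).
  by apply: ler_sum => b _; rewrite rmorphM rmorphXn /= -rE -normr_cabs.
pose P k (v : V) : C := \sum_(beta : bmultinom N k.+1 | mdeg beta == k)
  c beta * \prod_(j < N) v 0 j ^+ (beta : multinom N) j.
have P3 k v : cabs (P k v) <= M * (r^-1 * vnorm v) ^+ k.
  apply: (@le_trans _ _ (\sum_(beta : bmultinom N k.+1 | mdeg beta == k)
      cabs (c beta) * r ^+ mdeg beta * (r^-1 * vnorm v) ^+ k)).
    rewrite /P; elim/big_rec2: _ => [|b x y /eqP E h]; first by rewrite Normc.normc0.
    apply: le_trans (cabsD _ _) (lerD _ h); rewrite cabsM -mulrA ler_wpM2l ?cabs_ge0//.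
    apply: le_trans (cabs_monomial_le _ _) _; rewrite E exprMn mulrA -exprMn.
    by rewrite mulfV ?gt_eqF// expr1n mul1r.
  rewrite -mulr_suml ler_wpM2r ?exprn_ge0 ?mulr_ge0 ?vnorm_ge0 ?invr_ge0 ?(ltW r0)//.
  apply: le_trans (MP k.+1); rewrite [leRHS](bigID (fun b : bmultinom N k.+1 => mdeg b == k))/=.
  by rewrite lerDl sumr_ge0// => b _; rewrite mulr_ge0 ?cabs_ge0// exprn_ge0// ltW.
have M0 : 0 <= M by have := MP 0%N; apply: le_trans; rewrite sumr_ge0// => b _;
  rewrite mulr_ge0 ?cabs_ge0// exprn_ge0// ltW.
exists P, (2 * M), r^-1, (r / 2); split.
- by split; [rewrite divr_gt0|rewrite invr_ge0 ltW].
- move=> k t v; rewrite /P mulr_sumr; apply: eq_bigr => b /eqP E.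
  rewrite mulrCA; congr (_ * _); under eq_bigr do rewrite mxE exprMn.
  by rewrite big_split /= -expr_sum -mdegE E.
- move=> k u v; exists (\sum_(beta : bmultinom N k.+1 | mdeg beta == k)
    (c beta)%:P * \prod_(j < N) ((u 0 j)%:P + (v 0 j)%:P * 'X) ^+ (beta : multinom N) j).
  move=> t; rewrite horner_sum; apply: eq_bigr => b _; rewrite hornerM hornerC.
  congr (_ * _); rewrite horner_prod; apply: eq_bigr => j _.
  by rewrite horner_exp hornerD hornerM !hornerC hornerX !mxE [t * _]mulrC.
- move=> k v; apply: le_trans (P3 k v) _.
  by rewrite ler_wpM2r ?exprn_ge0 ?mulr_ge0 ?vnorm_ge0 ?invr_ge0 ?(ltW r0)//; lra.
move=> n v vr.
have vr1 : `|v| < rC by rewrite rE vnormE ltcR; have := r0; lra.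
have H (t : C) : 0 < t -> \forall d \near \oo, `|f (z + v) - \sum_(beta : bmultinom N d)
    c beta * \prod_(j < N) v 0 j ^+ (beta : multinom N) j| <= t.
  exact: (proj1 (@cvgrPdist_le C C^o _ _ _ _ _) (cvgf v vr1)).
apply/ler_addgt0Pr => e e0.
have eC : 0 < e%:C :> C by rewrite (ltcR 0).
have [d0 _ Hd] := H _ eC.
have := Hd (n + d0)%N (leq_addl _ _); rewrite /= normr_cabs lecR.
rewrite (bmultinom_sum_degree (fun b => c b * \prod_(j < N) v 0 j ^+ b j)) => h.
have q2 : r^-1 * vnorm v * cabs (1 : C) <= 2^-1.
  rewrite (_ : cabs 1 = 1) ?mulr1; last by rewrite (cabs_real 1) normr1.
  by rewrite mulrC ler_pdivrMr//; lra.
have q0 : 0 <= r^-1 * vnorm v by rewrite mulr_ge0 ?vnorm_ge0// invr_ge0 ltW.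
have := @partial_sum_tail R (fun k => P k v) M _ 1 q0 q2 (fun k => P3 k v) n d0.
rewrite (_ : cabs 1 = 1) ?mulr1; last by rewrite (cabs_real 1) normr1.
under [X in cabs (X - _)]eq_bigr do rewrite expr1n mulr1.
under [X in cabs (_ - X)]eq_bigr do rewrite expr1n mulr1.
move=> h2; rewrite -(subrKA (\sum_(k < n + d0) P k v)) addrC.
apply: le_trans (cabsD _ _) _; apply: lerD h.
apply: le_trans h2 _; rewrite ler_piMr ?mulr_ge0 ?exprn_ge0//.
Qed.

End analytic.

(** Every map between the spaces of parameters that occurs below selects
    coordinates. *)
Section coordinate_projection.
Variables (R : realType) (m n : nat) (h : 'I_n -> 'I_m).
Local Notation C := R[i].
Implicit Types (u v z : 'rV[C]_m).

Lemma colsubD u v : colsub h (u + v) = colsub h u + colsub h v.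
Proof. by apply/matrixP => i j; rewrite !mxE. Qed.

Lemma colsubZ (t : C) v : colsub h (t *: v) = t *: colsub h v.
Proof. by apply/matrixP => i j; rewrite !mxE. Qed.

Lemma vnorm_colsub v : vnorm (colsub h v) <= vnorm v.
Proof.
apply/ler_addgt0Pr => e e0; apply: ltW.
have ve : 0 < vnorm v + e by rewrite ltr_wpDl// vnorm_ge0.
apply/(vnorm_lt _ ve) => j; rewrite mxE.
by apply: le_lt_trans (cabs_le_vnorm _ _) _; rewrite ltrDl.
Qed.

Lemma near_colsub z (P : 'rV[C]_n -> Prop) :
  (\forall x \near colsub h z, P x) -> \forall x \near z, P (colsub h x).
Proof.
move=> /nearP[e e0 H]; apply/nearP; exists e => // v ve.
by rewrite colsubD; apply: H; apply: le_lt_trans (vnorm_colsub v) ve.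
Qed.

Lemma expandable_colsub (f : 'rV[C]_n -> C) z :
  expandable f (colsub h z) -> expandable (fun x => f (colsub h x)) z.
Proof.
move=> [P [M [K [rho E]]]]; have M0 := expansion_M_ge0 E.
case: E => [[r0 K0] H1 H2 H3 H4].
have le k v : M * (K * vnorm (colsub h v)) ^+ k <= M * (K * vnorm v) ^+ k.
  by rewrite ler_wpM2l// lerXn2r ?nnegrE ?mulr_ge0 ?vnorm_ge0// ler_wpM2l// vnorm_colsub.
exists (fun k v => P k (colsub h v)), M, K, rho; split=> //.
- by move=> k t v; rewrite colsubZ H1.
- move=> k u v; have [q hq] := H2 k (colsub h u) (colsub h v); exists q => t.
  by rewrite colsubD colsubZ hq.
- by move=> k v; apply: le_trans (le k v).
- move=> N v vr; apply: le_trans (le N v); rewrite colsubD; apply: H4.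
  exact: le_trans (vnorm_colsub v) vr.
Qed.

End coordinate_projection.

(** * Continuation along a path *)

Section germ_continuation.
Variables (R : realType) (n : nat).
Local Notation C := R[i].
Local Notation V := 'rV[C]_n.
Implicit Types (F : V -> C) (H : R -> V -> C) (gamma : R -> V).

(** Analytic continuation along a path, with germs that are only required to be
    expandable: in this form sums and products can be continued term by term. *)
Definition germ_continuation F gamma (v : C) := exists H,
  [/\ \forall z \near gamma 0, H 0 z = F z,
      (forall s : R, s \in `[0, 1] -> expandable (H s) (gamma s)),
      (forall s : R, s \in `[0, 1] -> \forall s' \near s, s' \in `[0, 1] ->
        \forall z \near gamma s', H s' z = H s z)
    & H 1 (gamma 1) = v].

Lemma germ_continuation_cst c gamma : germ_continuation (fun=> c) gamma c.
Proof.
exists (fun _ _ => c); split=> [|s _|s _|//]; first by near=> z.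
- exact: expandable_cst.
- by near=> s' => _; near=> z.
Unshelve. all: by end_near. Qed.

Lemma germ_continuationD F F' gamma v v' :
  germ_continuation F gamma v -> germ_continuation F' gamma v' ->
  germ_continuation (fun z => F z + F' z) gamma (v + v').
Proof.
move=> [H [F0 E G H1]] [H' [F0' E' G' H1']]; exists (fun s z => H s z + H' s z).
split=> [|s s01|s s01|]; last by rewrite H1 H1'.
- by apply: filterS2 F0 F0' => z -> ->.
- by apply: expandableD; [exact: E|exact: E'].
- apply: filterS2 (G s s01) (G' s s01) => s' h h' s'01.
  by apply: filterS2 (h s'01) (h' s'01) => z -> ->.
Qed.

Lemma germ_continuationM F F' gamma v v' :
  germ_continuation F gamma v -> germ_continuation F' gamma v' ->
  germ_continuation (fun z => F z * F' z) gamma (v * v').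
Proof.
move=> [H [F0 E G H1]] [H' [F0' E' G' H1']]; exists (fun s z => H s z * H' s z).
split=> [|s s01|s s01|]; last by rewrite H1 H1'.
- by apply: filterS2 F0 F0' => z -> ->.
- by apply: expandableM; [exact: E|exact: E'].
- apply: filterS2 (G s s01) (G' s s01) => s' h h' s'01.
  by apply: filterS2 (h s'01) (h' s'01) => z -> ->.
Qed.

Lemma germ_continuation_sum (I : Type) (r : seq I) (P : pred I)
    (F : I -> V -> C) gamma (v : I -> C) :
  (forall i, P i -> germ_continuation (F i) gamma (v i)) ->
  germ_continuation (fun z => \sum_(i <- r | P i) F i z) gamma
    (\sum_(i <- r | P i) v i).
Proof.
move=> FP; elim: r => [|i r IH].
  rewrite big_nil; under eq_fun do rewrite big_nil; exact: germ_continuation_cst.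
rewrite big_cons; under eq_fun do rewrite big_cons.
by case: (P i) (FP i) => // /(_ isT) Fi; exact: germ_continuationD.
Qed.

(** Continuity on [0, 1] in terms of the norm, in which the radii of expansions
    are measured. *)
Definition path_continuous gamma := forall s : R, s \in `[0, 1] ->
  forall e : R, 0 < e -> \forall s' \near s, s' \in `[0, 1] ->
  vnorm (gamma s' - gamma s) < e.

(** The set of s such that the germ at gamma s vanishes is open and closed in
    [0, 1]. *)
Lemma germ_continuation_eq0 F gamma v : germ_continuation F gamma v ->
  path_continuous gamma -> (\forall z \near gamma 0, F z = 0) -> v = 0.
Proof.
move=> [H [F0 E G Hv]] gc F00; rewrite -{}Hv {v}.
have H0 : \forall z \near gamma 0, H 0 z = 0 by apply: filterS2 F0 F00 => z ->.
pose B := [set s : R | s \in `[0, 1] /\ \forall z \near gamma s, H s z = 0].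
have loc (s : R) : s \in `[0, 1] -> \forall s' \near s, s' \in `[0, 1] -> (B s' <-> B s).
  move=> s01; have [d d0 Hd] := expandable_zero (E s s01).
  apply: filterS2 (G s s01) (gc s s01 _ d0) => s' h1 h2 s'01.
  have {}h1 := h1 s'01; have {}h2 := h2 s'01; split=> -[_ Bs]; split=> //.
    have /nearP[e e0 He] : \forall z \near gamma s', H s z = 0.
      by apply: filterS2 h1 Bs => z -> ->.
    apply/nearP; exists d => //; apply: (Hd _ e h2 e0) => v ve.
    rewrite (_ : gamma s + v = gamma s' + (v - (gamma s' - gamma s))); first exact: He.
    by rewrite opprB addrCA [gamma s' + _]addrCA subrr addr0 addrC.
  have {Bs} /nearP[e e0 He] := Bs.
  have Hs v : vnorm v < d -> H s (gamma s + v) = 0.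
    apply: (Hd 0 e _ e0) => [|u]; last by rewrite subr0; exact: He.
    by rewrite -(scale0r (0 : V)) vnormZ Normc.normc0 mul0r.
  have : \forall z \near gamma s', H s z = 0.
    apply/nearP; exists (d - vnorm (gamma s' - gamma s)); first by rewrite subr_gt0.
    move=> v ve; rewrite -(subrK (gamma s) (gamma s')) addrAC addrC; apply: Hs.
    by apply: le_lt_trans (vnormD _ _) _; rewrite -ltrBrDl.
  by apply: filterS2 h1 => z -> ->.
have B01 : B = `[0, 1]%classic.
  apply: (@segment_connected R 0 1).
  - by exists 0; split=> //; rewrite in_itv /= lexx ler01.
  - exists (interior (~` `[0, 1]%classic `|` B)); first exact: open_interior.
    apply/seteqP; split=> s.
      move=> Bs; have s01 := Bs.1; split=> //=.
      apply: filterS (loc s s01) => s' h.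
      have [s'01|] := boolP (s' \in `[0, 1]); first by right; apply/(h s'01).
      by move=> /negP; left.
    by move=> [s01 /interior_subset[]].
  - exists (closure B); first exact: closed_closure.
    apply/seteqP; split=> s; first by move=> Bs; split; [exact: Bs.1|exact: subset_closure].
    move=> [s01 cs]; have [s' [Bs' h]] := cs _ (loc s s01).
    exact: (h Bs'.1).1.
have : B 1 by rewrite B01 /= in_itv /= ler01 lexx.
by move=> [_ /nbhs_singleton].
Qed.

End germ_continuation.

Section germ_continuation_colsub.
Variables (R : realType) (m n : nat) (h : 'I_n -> 'I_m).
Local Notation C := R[i].

Lemma germ_continuation_colsub F (gamma : R -> 'rV[C]_m) v :
  continues_to F (fun s => colsub h (gamma s)) v ->
  germ_continuation (fun z => F (colsub h z)) gamma v.
Proof.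
move=> [g [g0 ga gg g1]]; exists (fun s z => g s (colsub h z)); split=> //.
- exact: near_colsub g0.
- by move=> s s01; apply/expandable_colsub/analytic_expandable/ga.
- move=> s s01; apply: filterS (gg s s01) => s' Hs' s'01.
  exact: near_colsub (Hs' s'01).
Qed.

End germ_continuation_colsub.

Section fps_germ_continuation.
Variables (R : realType) (n : nat) (gamma : R -> 'rV[R[i]]_n).
Local Notation C := R[i].

Definition fps_germ_continuation m (S : 'rV[C]_n -> fps C m) (c : fps C m) :=
  forall beta, germ_continuation (fun z => S z beta) gamma (c beta).

Lemma fps_germ_continuation_colsub m q (h : 'I_q -> 'I_n) (S : 'rV[C]_q -> fps C m)
    (delta : R -> 'rV[C]_q) :
  (forall x, delta x = colsub h (gamma x)) -> fps_continuable S delta ->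
  fps_germ_continuation (fun z => S (colsub h z)) (fps_continuation S delta).
Proof.
move=> /funext-> SP beta; apply: (germ_continuation_colsub (F := fun z => S z beta)).
exact: (xgetPex 0 (SP beta)).
Qed.

Lemma fps_germ_continuation_mul m (S S' : 'rV[C]_n -> fps C m) c c' :
  fps_germ_continuation S c -> fps_germ_continuation S' c' ->
  fps_germ_continuation (fun z => fps_mul (S z) (S' z)) (fps_mul c c').
Proof.
move=> Sc Sc' alpha; apply: germ_continuation_sum => bc _.
exact: germ_continuationM.
Qed.

Lemma fps_germ_continuation_star m N (t : 'rV['I_N]_m) (S : 'rV[C]_n -> fps C m) c :
  fps_germ_continuation S c ->
  fps_germ_continuation (fun z => fps_star (S z) t) (fps_star c t).
Proof.
move=> Sc alpha; apply: germ_continuation_sum => beta _.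
by apply: germ_continuationM => //; exact: germ_continuation_cst.
Qed.

Let sum_fpsE (I : Type) (r : seq I) (P : pred I) m (c : I -> fps C m) beta :
  (\sum_(i <- r | P i) c i) beta = \sum_(i <- r | P i) c i beta.
Proof. by elim/big_rec2: _ => // i f g _ <-. Qed.

Lemma fps_germ_continuation_sum m (I : Type) (r : seq I) (P : pred I)
    (S : I -> 'rV[C]_n -> fps C m) (c : I -> fps C m) :
  (forall i, P i -> fps_germ_continuation (S i) (c i)) ->
  fps_germ_continuation (fun z => \sum_(i <- r | P i) S i z)
    (\sum_(i <- r | P i) c i).
Proof.
move=> Sc beta; rewrite sum_fpsE.
under eq_fun do rewrite sum_fpsE.
by apply: germ_continuation_sum => i Pi; exact: Sc.
Qed.

Lemma fps_germ_continuation_unique m (S S' : 'rV[C]_n -> fps C m) c c' :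
  path_continuous gamma ->
  fps_germ_continuation S c -> fps_germ_continuation S' c' ->
  (\forall z \near gamma 0, S z = S' z) -> c = c'.
Proof.
move=> gc Sc Sc' SS'; apply/funext => beta; apply/eqP; rewrite -subr_eq0; apply/eqP.
have h := germ_continuationD (Sc beta)
  (germ_continuationM (germ_continuation_cst (-1) gamma) (Sc' beta)).
rewrite mulN1r in h; apply: germ_continuation_eq0 h gc _.
by apply: filterS SS' => z ->; rewrite mulN1r subrr.
Qed.

End fps_germ_continuation.

(** * The formula for the continuations *)

Section domain.
Variable R : realType.
Local Notation C := R[i].

(** Moving hbar and w by less than e lowers the bound on |Im w_j| by at most
    pi b_j e and raises |Im w_j| by at most e, so it is enough that
    e (1 + pi b_j) is less than the gap between the two. *)
Lemma qpolylog_domain_open (hbar : C) m (a b : 'rV[nat]_m) (w : 'rV[C]_m) :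
  qpolylog_domain hbar a b w ->
  exists2 e : R, 0 < e & forall (h : C) (v : 'rV[C]_m), cabs (h - hbar) < e -> vnorm (v - w) < e ->
    qpolylog_domain h a b v.
Proof.
move=> [h0 H].
pose B j : R := (b 0 j)%:R; pose A j : R := (a 0 j)%:R.
pose gap j := pi * (A j + B j * complex.Re hbar) - `|complex.Im (w 0 j)|.
have B0 j : 0 <= B j by rewrite ler0n.
have pB j : 0 < 1 + pi * B j by rewrite ltr_pwDl// mulr_ge0// pi_ge0.
have gap0 j : 0 < gap j / (1 + pi * B j) by rewrite divr_gt0// subr_gt0 H.
have : \forall e \near (0 : R)^'+, e < complex.Re hbar /\
    forall j, e < gap j / (1 + pi * B j).
  apply: filterI; first exact: nbhs_right_lt.
  apply: (@filter_forall R 'I_m (fun j e => e < gap j / (1 + pi * B j)) (0 : R)^'+) => j.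
  exact: nbhs_right_lt.
move=> /(filterI (nbhs_right_gt (0 : R))) /filter_ex[e [e0 [eh ej]]].
exists e => // h v hh vw.
have hr : complex.Re hbar - e < complex.Re h.
  have := Re_le_cabs (h - hbar); rewrite cReD cReN => /le_lt_trans /(_ hh).
  by rewrite ltr_norml => /andP[]; lra.
split=> [|j]; first by lra.
have vj : `|complex.Im (v 0 j)| < `|complex.Im (w 0 j)| + e.
  have : `|complex.Im ((v - w) 0 j)| < e.
    by apply: le_lt_trans (Im_le_cabs _) (le_lt_trans (cabs_le_vnorm _ _) vw).
  rewrite !mxE cImD cImN => ve; rewrite -(subrKC (complex.Im (w 0 j)) (complex.Im (v 0 j))).
  by apply: le_lt_trans (ler_normD _ _) _; rewrite ltrD2l.
apply: lt_le_trans vj _; have := ej j; rewrite ltr_pdivlMr// /gap -/(A j) -/(B j) => g.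
have : pi * B j * (complex.Re hbar - e) <= pi * B j * complex.Re h.
  by rewrite ler_wpM2l ?mulr_ge0 ?pi_ge0// ltW.
by move: (A j) (B j) (pi : R) g => A' B' p; lra.
Qed.

End domain.

Section paths.
Variable R : realType.
Local Notation C := R[i].

Definition entry_continuous (f : R -> C) := forall s : R, s \in `[0, 1] ->
  forall e : R, 0 < e -> \forall s' \near s, s' \in `[0, 1] -> cabs (f s' - f s) < e.

Lemma path_continuous_entries n (gamma : R -> 'rV[C]_n) :
  (forall j, entry_continuous (fun x => gamma x 0 j)) -> path_continuous gamma.
Proof.
move=> H s s01 e e0.
have : \forall s' \near s, forall j, s' \in `[0, 1] ->
    cabs (gamma s' 0 j - gamma s 0 j) < e.
  apply: (@filter_forall R 'I_n (fun j s' => s' \in `[0, 1] ->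
    cabs (gamma s' 0 j - gamma s 0 j) < e) (nbhs s)) => j.
  exact: H.
apply: filterS => s' Hs' s'01; apply/vnorm_lt => // j.
by rewrite !mxE; exact: Hs'.
Qed.

Lemma within_entry_continuous n (gamma : R -> 'rV[C]_n) j :
  {within `[0, 1], continuous gamma} -> entry_continuous (fun x => gamma x 0 j).
Proof.
move=> /subspace_continuousP gc s s01 e e0.
have : \forall z \near gamma s, vnorm (z - gamma s) < e.
  by apply/nearP; exists e => // v; rewrite [gamma s + v]addrC addrK.
move=> /(gc s s01) H.
have {}H : \forall s' \near s, s' \in `[0, 1] -> vnorm (gamma s' - gamma s) < e by exact: H.
apply: filterS H => s' h s'01; apply: le_lt_trans (h s'01).
by have := cabs_le_vnorm (gamma s' - gamma s) j; rewrite !mxE.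
Qed.

Lemma within_scalar_continuous (f : R -> C) :
  {within `[0, 1], continuous f} -> entry_continuous f.
Proof.
move=> /subspace_continuousP fc s s01 e e0.
have : \forall z \near f s, cabs (z - f s) < e.
  apply/(@nbhs_ballP C C^o); exists e%:C => /=; first by rewrite ltcR.
  by move=> z; rewrite -(@ball_normE C C^o) /ball_ /= -normrN opprB normr_cabs ltcR.
by move=> /(fc s s01) H; exact: H.
Qed.

End paths.

Section coordinates.
Variables (A : Type).

Lemma row_colsub m n (u : 'rV[A]_(m + n)) :
  row_mx (colsub (@lshift m n) u) (colsub (@rshift m n) u) = u.
Proof.
apply/rowP => j; case: (split_ordP j) => i ->.
  by rewrite row_mxEl [LHS]mxE.
by rewrite row_mxEr [LHS]mxE.
Qed.

Lemma colsub_rowl m n (u : 'rV[A]_m) (v : 'rV[A]_n) :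
  colsub (@lshift m n) (row_mx u v) = u.
Proof. by apply/matrixP => i j; rewrite [LHS]mxE row_mxEl. Qed.

Lemma colsub_rowr m n (u : 'rV[A]_m) (v : 'rV[A]_n) :
  colsub (@rshift m n) (row_mx u v) = v.
Proof. by apply/matrixP => i j; rewrite [LHS]mxE row_mxEr. Qed.

Lemma colsub_perm n (s : 'S_n) (u : 'rV[A]_n) : colsub s u = col_perm s u.
Proof. by apply/matrixP => i j; rewrite !mxE. Qed.

(** The first coordinate stands for hbar, which all the functions share; h
    selects among the others. *)
Definition fix_first q n (h : 'I_q -> 'I_n) (j : 'I_(1 + q)) : 'I_(1 + n) :=
  match fintype.split j with inl i => lshift n i | inr i => rshift 1 (h i) end.

Lemma fix_first_l q n (h : 'I_q -> 'I_n) i : fix_first h (lshift q i) = lshift n i.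
Proof.
rewrite /fix_first; case: split_ordP => j E; first by rewrite (lshift_inj E).
by move/eqP: E; rewrite eq_lrshift.
Qed.

Lemma fix_first_r q n (h : 'I_q -> 'I_n) i : fix_first h (rshift 1 i) = rshift 1 (h i).
Proof.
rewrite /fix_first; case: split_ordP => j E; last by rewrite (rshift_inj E).
by move/eqP: E; rewrite eq_rlshift.
Qed.

Lemma colsub_fix_first q n (h : 'I_q -> 'I_n) (c : 'rV[A]_1) (u : 'rV[A]_n) :
  colsub (fix_first h) (row_mx c u) = row_mx c (colsub h u).
Proof.
apply/rowP => j; rewrite [LHS]mxE; case: (split_ordP j) => i ->.
  by rewrite fix_first_l !row_mxEl.
by rewrite fix_first_r !row_mxEr mxE.
Qed.

End coordinates.

Section continuation.
Variables (R : realType) (k l : nat).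
Local Notation C := R[i].
Variables (a b : 'rV[nat]_k) (a' b' : 'rV[nat]_l).

Let t : 'rV['I_(k + l)]_k := \row_i lshift l i.
Let t' : 'rV['I_(k + l)]_l := \row_j rshift k j.

Lemma fps_star_shuffle_near (hbar : C) (w : 'rV[C]_k) (w' : 'rV[C]_l) :
  qpolylog_domain hbar a b w -> qpolylog_domain hbar a' b' w' ->
  exists2 e : R, 0 < e & forall h u,
    cabs (h - hbar) < e -> vnorm (u - row_mx w w') < e ->
    fps_mul (fps_star (qpolylog_series h a b (colsub (@lshift k l) u)) t)
            (fps_star (qpolylog_series h a' b' (colsub (@rshift k l) u)) t')
    = \sum_(s in shuffles k l)
        fps_star (qpolylog_series h (col_perm s (row_mx a a'))
                    (col_perm s (row_mx b b')) (colsub s u))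
                 (col_perm s (row_mx t t')).
Proof.
move=> /qpolylog_domain_open[e e0 De] /qpolylog_domain_open[e' e0' De'].
exists (Num.min e e') => [|h u]; first by rewrite lt_min e0.
rewrite !lt_min => /andP[he he'] /andP[ue ue'].
under [RHS]eq_bigr do rewrite colsub_perm -{1}(row_colsub u).
apply: fps_star_shuffle.
- apply: De => //; rewrite -(colsub_rowl w w') -[- _]scaleN1r -colsubZ -colsubD scaleN1r.
  exact: le_lt_trans (vnorm_colsub _ _) ue.
- apply: De' => //; rewrite -(colsub_rowr w w') -[- _]scaleN1r -colsubZ -colsubD scaleN1r.
  exact: le_lt_trans (vnorm_colsub _ _) ue'.
Qed.

Lemma entry_continuous_row (w : R -> 'rV[C]_k) (w' : R -> 'rV[C]_l) j :
  {within `[0, 1], continuous w} -> {within `[0, 1], continuous w'} ->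
  entry_continuous (fun x => row_mx (w x) (w' x) 0 j).
Proof.
move=> wc wc'; case: (split_ordP j) => i ->.
  under [X in entry_continuous X]eq_fun do rewrite row_mxEl.
  exact: within_entry_continuous.
under [X in entry_continuous X]eq_fun do rewrite row_mxEr.
exact: within_entry_continuous.
Qed.

Lemma fps_star_shuffle_continuation (hbar : C) (w : R -> 'rV[C]_k) (w' : R -> 'rV[C]_l) :
  {within `[0, 1], continuous w} -> {within `[0, 1], continuous w'} ->
  qpolylog_domain hbar a b (w 0) -> qpolylog_domain hbar a' b' (w' 0) ->
  fps_continuable (qpolylog_series hbar a b) w ->
  fps_continuable (qpolylog_series hbar a' b') w' ->
  (forall s, s \in shuffles k l ->
     fps_continuable (qpolylog_series hbar (col_perm s (row_mx a a'))
                        (col_perm s (row_mx b b')))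
                     (fun x => col_perm s (row_mx (w x) (w' x)))) ->
  fps_mul (fps_star (fps_continuation (qpolylog_series hbar a b) w) t)
          (fps_star (fps_continuation (qpolylog_series hbar a' b') w') t')
  = \sum_(s in shuffles k l)
      fps_star (fps_continuation
                  (qpolylog_series hbar (col_perm s (row_mx a a'))
                     (col_perm s (row_mx b b')))
                  (fun x => col_perm s (row_mx (w x) (w' x))))
               (col_perm s (row_mx t t')).
Proof.
move=> wc wc' D D' cw cw' cs.
pose gamma x := row_mx (w x) (w' x).
have gc : path_continuous gamma.
  by apply: path_continuous_entries => j; exact: entry_continuous_row.
apply: (fps_germ_continuation_unique gc).
- apply: fps_germ_continuation_mul; apply: fps_germ_continuation_star.
    by apply: (fps_germ_continuation_colsub (h := @lshift k l)) cw => x; rewrite colsub_rowl.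
  by apply: (fps_germ_continuation_colsub (h := @rshift k l)) cw' => x; rewrite colsub_rowr.
- apply: fps_germ_continuation_sum => s ss; apply: fps_germ_continuation_star.
  by apply: (fps_germ_continuation_colsub (h := s)) (cs s ss) => x; rewrite colsub_perm.
have [e e0 De] := fps_star_shuffle_near D D'.
apply/nearP; exists e => // v ve; apply: De; first by rewrite subrr Normc.normc0.
by rewrite addrAC subrr add0r.
Qed.

Lemma qpolylog_series_joint_colsub q n (h : 'I_q -> 'I_n) (c d : 'rV[nat]_q)
    (z : 'rV[C]_(1 + n)) :
  qpolylog_series_joint c d (colsub (fix_first h) z) =
  qpolylog_series (lsubmx z 0 0) c d (colsub h (rsubmx z)).
Proof.
by rewrite -{1}(hsubmxK z) colsub_fix_first /qpolylog_series_joint row_mxKl row_mxKr.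
Qed.

Lemma fps_star_shuffle_joint_continuation (hbar : R -> C) (w : R -> 'rV[C]_k)
    (w' : R -> 'rV[C]_l) :
  {within `[0, 1], continuous hbar} ->
  {within `[0, 1], continuous w} -> {within `[0, 1], continuous w'} ->
  qpolylog_domain (hbar 0) a b (w 0) ->
  qpolylog_domain (hbar 0) a' b' (w' 0) ->
  fps_continuable (qpolylog_series_joint a b)
                  (fun x => row_mx (hbar x)%:M (w x)) ->
  fps_continuable (qpolylog_series_joint a' b')
                  (fun x => row_mx (hbar x)%:M (w' x)) ->
  (forall s, s \in shuffles k l ->
     fps_continuable (qpolylog_series_joint (col_perm s (row_mx a a'))
                        (col_perm s (row_mx b b')))
                     (fun x => row_mx (hbar x)%:M
                                 (col_perm s (row_mx (w x) (w' x))))) ->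
  fps_mul (fps_star (fps_continuation (qpolylog_series_joint a b)
                       (fun x => row_mx (hbar x)%:M (w x))) t)
          (fps_star (fps_continuation (qpolylog_series_joint a' b')
                       (fun x => row_mx (hbar x)%:M (w' x))) t')
  = \sum_(s in shuffles k l)
      fps_star (fps_continuation
                  (qpolylog_series_joint (col_perm s (row_mx a a'))
                     (col_perm s (row_mx b b')))
                  (fun x => row_mx (hbar x)%:M
                              (col_perm s (row_mx (w x) (w' x)))))
               (col_perm s (row_mx t t')).
Proof.
move=> hc wc wc' D D' cw cw' cs.
pose gamma x : 'rV[C]_(1 + (k + l)) := row_mx (hbar x)%:M (row_mx (w x) (w' x)).
have gc : path_continuous gamma.
  apply: path_continuous_entries => j; case: (split_ordP j) => i ->.
    under [X in entry_continuous X]eq_fun do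
      rewrite row_mxEl mxE ord1 eqxx mulr1n.
    exact: within_scalar_continuous.
  under [X in entry_continuous X]eq_fun do rewrite row_mxEr.
  exact: entry_continuous_row.
apply: (fps_germ_continuation_unique gc).
- apply: fps_germ_continuation_mul; apply: fps_germ_continuation_star.
    apply: (fps_germ_continuation_colsub (h := fix_first (@lshift k l))) cw => x.
    by rewrite colsub_fix_first colsub_rowl.
  apply: (fps_germ_continuation_colsub (h := fix_first (@rshift k l))) cw' => x.
  by rewrite colsub_fix_first colsub_rowr.
- apply: fps_germ_continuation_sum => s ss; apply: fps_germ_continuation_star.
  apply: (fps_germ_continuation_colsub (h := fix_first s)) (cs s ss) => x.
  by rewrite colsub_fix_first colsub_perm.
have [e e0 De] := fps_star_shuffle_near D D'.
apply/nearP; exists e => // v ve.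
rewrite !qpolylog_series_joint_colsub.
under [RHS]eq_bigr do rewrite qpolylog_series_joint_colsub.
rewrite -(hsubmxK v) /gamma add_row_mx row_mxKl row_mxKr; apply: De.
- rewrite (_ : _ - _ = v 0 (lshift (k + l) 0)).
    by apply: le_lt_trans ve; exact: cabs_le_vnorm.
  by rewrite !mxE eqxx mulr1n addrAC subrr add0r.
- rewrite addrAC subrr add0r; apply/(vnorm_lt _ e0) => j; rewrite mxE.
  by apply: le_lt_trans ve; exact: cabs_le_vnorm.
Qed.

End continuation.

Unset Implicit Arguments.

Theorem theorem3p7 (R : realType) (k l : nat) (hk : (1 <= k)%N) (hl : (1 <= l)%N)
    (a b : 'rV[nat]_k) (a' b' : 'rV[nat]_l) :
  let t : 'rV['I_(k + l)]_k := \row_i lshift l i in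
  let t' : 'rV['I_(k + l)]_l := \row_j rshift k j in
  (* for Re hbar > 0, in the domain of convergence *)
  (forall (hbar : R[i]) (w : 'rV[R[i]]_k) (w' : 'rV[R[i]]_l),
     qpolylog_domain hbar a b w -> qpolylog_domain hbar a' b' w' ->
     fps_mul (fps_star (qpolylog_series hbar a b w) t)
             (fps_star (qpolylog_series hbar a' b' w') t')
     = \sum_(s in shuffles k l)
         fps_star (qpolylog_series hbar (col_perm s (row_mx a a'))
                     (col_perm s (row_mx b b')) (col_perm s (row_mx w w')))
                  (col_perm s (row_mx t t')))
  /\
  (* for the analytic continuations in (w, w') at fixed hbar *)
  (forall (hbar : R[i]) (w : R -> 'rV[R[i]]_k) (w' : R -> 'rV[R[i]]_l),
     {within `[0, 1], continuous w} -> {within `[0, 1], continuous w'} ->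
     qpolylog_domain hbar a b (w 0) -> qpolylog_domain hbar a' b' (w' 0) ->
     fps_continuable (qpolylog_series hbar a b) w ->
     fps_continuable (qpolylog_series hbar a' b') w' ->
     (forall s, s \in shuffles k l ->
        fps_continuable (qpolylog_series hbar (col_perm s (row_mx a a'))
                           (col_perm s (row_mx b b')))
                        (fun x => col_perm s (row_mx (w x) (w' x)))) ->
     fps_mul (fps_star (fps_continuation (qpolylog_series hbar a b) w) t)
             (fps_star (fps_continuation (qpolylog_series hbar a' b') w') t')
     = \sum_(s in shuffles k l)
         fps_star (fps_continuation
                     (qpolylog_series hbar (col_perm s (row_mx a a'))
                        (col_perm s (row_mx b b')))
                     (fun x => col_perm s (row_mx (w x) (w' x))))
                  (col_perm s (row_mx t t')))
  /\
  (* for the joint analytic continuations in (hbar, w, w') *)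
  (forall (hbar : R -> R[i]) (w : R -> 'rV[R[i]]_k) (w' : R -> 'rV[R[i]]_l),
     {within `[0, 1], continuous hbar} ->
     {within `[0, 1], continuous w} -> {within `[0, 1], continuous w'} ->
     qpolylog_domain (hbar 0) a b (w 0) ->
     qpolylog_domain (hbar 0) a' b' (w' 0) ->
     fps_continuable (qpolylog_series_joint a b)
                     (fun x => row_mx (hbar x)%:M (w x)) ->
     fps_continuable (qpolylog_series_joint a' b')
                     (fun x => row_mx (hbar x)%:M (w' x)) ->
     (forall s, s \in shuffles k l ->
        fps_continuable (qpolylog_series_joint (col_perm s (row_mx a a'))
                           (col_perm s (row_mx b b')))
                        (fun x => row_mx (hbar x)%:M
                                    (col_perm s (row_mx (w x) (w' x))))) ->
     fps_mul (fps_star (fps_continuation (qpolylog_series_joint a b)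
                          (fun x => row_mx (hbar x)%:M (w x))) t)
             (fps_star (fps_continuation (qpolylog_series_joint a' b')
                          (fun x => row_mx (hbar x)%:M (w' x))) t')
     = \sum_(s in shuffles k l)
         fps_star (fps_continuation
                     (qpolylog_series_joint (col_perm s (row_mx a a'))
                        (col_perm s (row_mx b b')))
                     (fun x => row_mx (hbar x)%:M
                                 (col_perm s (row_mx (w x) (w' x)))))
                  (col_perm s (row_mx t t'))).
Proof.
move=> t t'; split; last split.
- move=> hbar w w'; exact: fps_star_shuffle.
- move=> hbar w w'; exact: fps_star_shuffle_continuation.
- move=> hbar w w'; exact: fps_star_shuffle_joint_continuation.
Qed.
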